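(* Let $g$ be a smooth pseudo-Riemannian metric (of any signature) defined near a point $x_0\in\mathbb{R}^4$. Then on a sufficiently small connected open neighborhood $U$ of $x_0$ (with the fixed standard coordinates) the following holds: for every $\varepsilon>0$ there exists a metric $\hat g$ on $U$ such that $\hat g$ is $\varepsilon$-close to $g$ in the $C^2$-sense on $U$ and $\hat g$ is geodesically rigid. Moreover, there exists $\varepsilon'>0$ such that every metric on $U$ that is $\varepsilon'$-close to $\hat g$ in the $C^2$-sense is also geodesically rigid.
   Context: All metrics are smooth, nondegenerate, of arbitrary signature. Two metrics $g,\bar g$ on the same connected manifold are geodesically equivalent if every geodesic of $g$ is, after a reparameterization, a geodesic of $\bar g$. A metric $g$ is geodesically rigid if every metric $\bar g$ on the same manifold that is geodesically equivalent to $g$ is proportional to $g$, i.e. $\bar g=\mathrm{const}\cdot g$. Given an open set $U\subset\mathbb{R}^4$ with fixed coordinates, metrics are viewed as maps from $U$ to the $10$-dimensional space of symmetric $4\times4$ matrices; $g$ is $\varepsilon$-close to $\bar g$ in the $C^2$-sense if the components of $g$ and their first and second partial derivatives are, uniformly on $U$, $\varepsilon$-close to those of $\bar g$. *)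

(* Defs.v *)
From HB Require Import structures.
From mathcomp Require Import all_boot all_order all_algebra.
From mathcomp Require Import all_classical all_reals all_analysis.

Set Implicit Arguments.
Unset Strict Implicit.
Unset Printing Implicit Defensive.

Import Order.TTheory GRing.Theory Num.Theory.
Import numFieldNormedType.Exports.

Local Open Scope classical_set_scope.
Local Open Scope ring_scope.

(* Points of R^m are row vectors and a metric is a matrix-valued function.
   Library derivatives act on total functions, so functions are total
   throughout; all conditions concern points of an open set U only, where
   derivatives do not depend on the values outside U. *)

Definition partial (R : realType) (n : nat) (i : 'I_n.+1)
    (f : 'rV[R]_n.+1 -> R) : 'rV[R]_n.+1 -> R :=
  fun x => 'D_(delta_mx 0 i) f x.

(* iter_partial [:: i1; ...; ip] f = d_i1 (... (d_ip f)) *)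
Definition iter_partial (R : realType) (n : nat) (s : seq 'I_n.+1)
    (f : 'rV[R]_n.+1 -> R) : 'rV[R]_n.+1 -> R :=
  foldr (@partial R n) f s.

(* C^infinity on the open set U: all iterated partial derivatives are (Frechet)
   differentiable at the points of U, hence also continuous there. *)
Definition smooth_on (R : realType) (n : nat) (U : set 'rV[R]_n.+1)
    (f : 'rV[R]_n.+1 -> R) : Prop :=
  forall (s : seq 'I_n.+1) (x : 'rV[R]_n.+1), U x ->
    differentiable (iter_partial s f) x.

Definition entry (R : realType) (n : nat) (g : 'rV[R]_n.+1 -> 'M[R]_n.+1)
    (i j : 'I_n.+1) : 'rV[R]_n.+1 -> R :=
  fun x => g x i j.

(* Smooth pseudo-Riemannian metric on U, of arbitrary signature. *)
Definition metric_on (R : realType) (n : nat) (U : set 'rV[R]_n.+1)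
    (g : 'rV[R]_n.+1 -> 'M[R]_n.+1) : Prop :=
  [/\ forall i j, smooth_on U (entry g i j),
      forall x, U x -> (g x)^T = g x
    & forall x, U x -> g x \in unitmx].

(* christoffel g k i j = Gamma^k_ij of the Levi-Civita connection of g *)
Definition christoffel (R : realType) (n : nat)
    (g : 'rV[R]_n.+1 -> 'M[R]_n.+1) (k i j : 'I_n.+1) (x : 'rV[R]_n.+1) : R :=
  2^-1 * \sum_(l < n.+1) invmx (g x) k l *
    (partial i (entry g j l) x + partial j (entry g i l) x
     - partial l (entry g i j) x).

Definition open_interval (R : realType) (I : set R) : Prop :=
  open I /\ is_interval I.

Definition twice_derivable_on (R : realType) (V : normedModType R)
    (I : set R) (c : R -> V) : Prop :=
  forall t, I t -> derivable c t 1 /\ derivable (derive1 c) t 1.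

(* Affinely parametrized geodesic of (U, g).  Solutions of the geodesic
   equation are automatically smooth, since its coefficients are. *)
Definition geodesic_on (R : realType) (n : nat) (U : set 'rV[R]_n.+1)
    (g : 'rV[R]_n.+1 -> 'M[R]_n.+1) (I : set R) (c : R -> 'rV[R]_n.+1) : Prop :=
  [/\ open_interval I,
      forall t, I t -> U (c t),
      twice_derivable_on I c
    & forall t, I t -> forall k : 'I_n.+1,
        derive1n 2 c t 0 k
        + \sum_(i < n.+1) \sum_(j < n.+1)
            christoffel g k i j (c t) * derive1 c t 0 i * derive1 c t 0 j = 0].

(* phi is a change of parameter from J onto I; phi' having no zero on the
   interval J, phi is injective on J. *)
Definition reparametrization (R : realType) (J I : set R) (phi : R -> R) : Prop :=
  [/\ open_interval J, phi @` J = I, twice_derivable_on J phi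
    & forall s, J s -> derive1 phi s != 0].

Definition geodesically_equivalent (R : realType) (n : nat)
    (U : set 'rV[R]_n.+1) (g h : 'rV[R]_n.+1 -> 'M[R]_n.+1) : Prop :=
  forall (I : set R) (c : R -> 'rV[R]_n.+1), geodesic_on U g I c ->
  exists (J : set R) (phi : R -> R),
    reparametrization J I phi /\ geodesic_on U h J (c \o phi).

Definition geodesically_rigid (R : realType) (n : nat) (U : set 'rV[R]_n.+1)
    (g : 'rV[R]_n.+1 -> 'M[R]_n.+1) : Prop :=
  forall h : 'rV[R]_n.+1 -> 'M[R]_n.+1,
    metric_on U h -> geodesically_equivalent U g h ->
    exists a : R, forall x, U x -> h x = a *: g x.

Definition C2_close (R : realType) (n : nat) (U : set 'rV[R]_n.+1) (e : R)
    (g h : 'rV[R]_n.+1 -> 'M[R]_n.+1) : Prop :=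
  forall (i j : 'I_n.+1) (s : seq 'I_n.+1), (size s <= 2)%N ->
  forall x, U x ->
    `|iter_partial s (entry g i j) x - iter_partial s (entry h i j) x| < e.

(* Main.v *)
(** If [h] is geodesically equivalent to [g], comparing accelerations of common geodesics
    shows that the Levi-Civita connections differ by [delta phi + phi delta] for a 1-form
    [phi].  Since the curvature endomorphisms [R_lk] of [h] are skew for [h], the components
    of [R_lk h^-1 + (R_lk h^-1)^T] with both indices outside [{k, l}] vanish, where the
    change of connection does not contribute and [R] may be taken to be the curvature of
    [g].  These are linear equations for the symmetric matrix [h^-1] which depend on the
    2-jet of [g] only; in dimension 4 their solutions are the multiples of [g^-1] as soon as
    one determinant ([weyl_det]) is nonzero.  This holds on a neighbourhood of a generic
    point, so that [h] is conformal to [g] there, and then [phi = 0].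

    The differences [h - c g], [phi] and one second order trace form a closed linear system
    of first order, with smooth coefficients, hence vanish on the connected set [U] if they
    vanish at one point: genericity at the single point [x0] gives rigidity on [U].  It is
    an open condition on the 2-jet at [x0], and it can be reached by adding
    [s I + t q (x - x0)] to [g], with [q] a fixed quadratic form, because the determinant is
    nonzero for the flat metric perturbed by [q] and depends polynomially on [1/s] and [1/t]
    up to a nonzero factor. *)

Require Import Defs.
From HB Require Import structures.
From mathcomp Require Import all_boot all_order all_algebra.
From mathcomp Require Import all_classical all_reals all_analysis.
From mathcomp Require Import ring lra.

Set Implicit Arguments.
Unset Strict Implicit.
Unset Printing Implicit Defensive.

Import Order.TTheory GRing.Theory Num.Theory.
Import numFieldNormedType.Exports.

Local Open Scope classical_set_scope.
Local Open Scope ring_scope.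

(** * Partial derivatives of smooth functions *)

(** Geodesic equivalence speaks about curves only, so comparing connections at a point requires a
    geodesic of [g] through that point with every prescribed velocity; this is why an existence
    theorem for differential equations is part of the proof. The algebra is done on [h^-1] because,
    once [phi] is known to be closed, the terms by which the two curvatures differ carry a Kronecker
    delta in the upper index, and composing with [h^-1] leaves that index free to avoid the deltas.
    The obstacle is that genericity is arranged at [x0] only, while the curvature may degenerate
    elsewhere in [U]: the algebraic argument works near [x0], and a differential one carries its
    conclusion across [U]. That system closes because, modulo [h - c g] and [phi], all derivatives
    of [phi] reduce to one function times [h]. The determinant is never computed: it is nonzero
    because a linear map is injective, for a tensor chosen so that each equation isolates one or two
    unknowns, and this passes to perturbations of [g] because a nonzero polynomial has finitely many
    roots. *)

Section PartialRules.
Context {R : realType} {n : nat}.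
Local Notation V := 'rV[R]_n.+1.
Implicit Types (f g : V -> R) (x : V) (i j : 'I_n.+1) (U : set V).

Lemma near_partial f g x i :
  {near x, f =1 g} -> partial i f x = partial i g x.
Proof. exact: near_eq_derive. Qed.

Lemma partial_eq_on U f g i : open U -> {in U, f =1 g} ->
  {in U, partial i f =1 partial i g}.
Proof.
move=> oU fg x /set_mem Ux; apply: near_partial.
near=> y; apply: fg; apply/mem_set; near: y; exact: open_nbhs_nbhs.
Unshelve. all: by end_near. Qed.

Lemma partialD f g x i : differentiable f x -> differentiable g x ->
  partial i (fun y => f y + g y) x = partial i f x + partial i g x.
Proof. by move=> df dg; exact: deriveD (diff_derivable df) (diff_derivable dg). Qed.

Lemma partialB f g x i : differentiable f x -> differentiable g x ->
  partial i (fun y => f y - g y) x = partial i f x - partial i g x.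
Proof. by move=> df dg; exact: deriveB (diff_derivable df) (diff_derivable dg). Qed.

Lemma partialM f g x i : differentiable f x -> differentiable g x ->
  partial i (fun y => f y * g y) x = partial i f x * g x + f x * partial i g x.
Proof.
move=> df dg.
by rewrite [LHS](deriveM (diff_derivable df) (diff_derivable dg)) addrC [_ *: 'D_ _ f x]mulrC.
Qed.

Lemma partial_cst (c : R) x i : partial i (fun=> c) x = 0.
Proof. exact: derive_cst. Qed.

Lemma partialZ (c : R) f x i : differentiable f x ->
  partial i (fun y => c * f y) x = c * partial i f x.
Proof.
move=> df; rewrite partialM//.
by rewrite partial_cst mul0r add0r.
Qed.

Lemma partialV f x i : differentiable f x -> f x != 0 ->
  partial i (fun y => (f y)^-1) x = - (f x)^-1 * (f x)^-1 * partial i f x.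
Proof.
move=> df fx; rewrite [LHS](deriveV fx (diff_derivable df)).
by rewrite expr2 invfM -[_ *: _]/(_ * _) !mulNr.
Qed.

Lemma differentiable_bigsum (I : Type) (r : seq I) (P : pred I)
    (f : I -> V -> R) x :
  (forall a, differentiable (f a) x) ->
  differentiable (fun y => \sum_(a <- r | P a) f a y) x.
Proof.
move=> df; elim: r => [|a r IH].
  by under eq_fun do rewrite big_nil; exact: differentiable_cst.
under eq_fun do rewrite big_cons.
by case: (P a) => //; exact: differentiableD.
Qed.

Lemma partial_sum (I : Type) (r : seq I) (P : pred I) (f : I -> V -> R) x i :
  (forall a, differentiable (f a) x) ->
  partial i (fun y => \sum_(a <- r | P a) f a y) x =
  \sum_(a <- r | P a) partial i (f a) x.
Proof.
move=> df; elim: r => [|a r IH].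
  by under [in LHS]eq_fun do rewrite big_nil; rewrite big_nil partial_cst.
under [in LHS]eq_fun do rewrite big_cons.
rewrite big_cons; case: (P a) => //; rewrite partialD ?IH//.
exact: differentiable_bigsum.
Qed.

Lemma derive_partials f x (v : V) : differentiable f x ->
  'D_v f x = \sum_i v 0 i * partial i f x.
Proof.
move=> df; rewrite deriveE// {1}(row_sum_delta v) linear_sum/=.
by apply: eq_bigr => i _; rewrite linearZ/= /partial deriveE.
Qed.

Lemma is_derive_line f x (v : V) (t : R) : differentiable f (x + t *: v) ->
  is_derive t 1 (fun s => f (x + s *: v)) ('D_v f (x + t *: v)).
Proof.
move=> df.
have dl : is_diff t (fun s : R => x + s *: v) (fun s : R => s *: v).
  have -> : (fun s : R => x + s *: v) = cst x + ( *:%R ^~ v) by [].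
  by have := is_diffD (is_diff_cst x t) (is_diff_scalel t v); rewrite add0r.
pose l := fun s : R => x + s *: v.
have dlt : differentiable l t by case: dl.
have E := @diff_comp _ _ _ _ l f t dlt df.
have dc : differentiable (f \o l) t by apply: differentiable_comp.
apply: DeriveDef; first exact: diff_derivable dc.
rewrite !deriveE//.
by rewrite [LHS](congr1 (@^~ 1) E)/= (diff_val (is_diff_def:=dl)) scale1r.
Qed.

Lemma MVT_line f x (v : V) :
  (forall t : R, 0 <= t <= 1 -> differentiable f (x + t *: v)) ->
  exists2 t : R, 0 < t < 1 & f (x + v) - f x = 'D_v f (x + t *: v).
Proof.
move=> df; pose l := fun s : R => f (x + s *: v).
pose dl := fun s : R => 'D_v f (x + s *: v).
have H (t : R) : 0 <= t <= 1 -> is_derive t 1 l (dl t).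
  by move=> t01; apply: is_derive_line; exact: df.
have cl : {within `[0, 1], continuous l}.
  apply: (@derivable_within_continuous R R) => t.
  by rewrite in_itv => /H [].
have dlo (t : R) : t \in `]0, 1[ -> is_derive t 1 l (dl t).
  by rewrite in_itv => /andP[t0 t1]; apply: H; rewrite !ltW.
have [t t01 E] := @MVT R l dl 0 1 ltr01 dlo cl.
exists t; first by move: t01; rewrite in_itv.
by move: E; rewrite /l /dl scale1r scale0r addr0 subr0 mulr1.
Qed.

End PartialRules.

Section Smooth.
Context {R : realType} {n : nat}.
Local Notation V := 'rV[R]_n.+1.
Implicit Types (f g : V -> R) (x : V) (i j : 'I_n.+1) (U : set V).

(** Differentiability up to a finite order. The derivative of a product or of an inverse contains
    the functions themselves at one order less, so induction on the order proves these rules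
    directly, where lists of directions would need a Leibniz formula. *)
Fixpoint ck (k : nat) U f : Prop :=
  if k is k'.+1 then
    (forall x, U x -> differentiable f x) /\ forall i, ck k' U (partial i f)
  else forall x, U x -> differentiable f x.

Lemma smooth_onP U f : smooth_on U f <-> forall k, ck k U f.
Proof.
split=> [sf k|cf s].
  elim: k f sf => [|k IH] f sf /=; first exact: (sf [::]).
  split=> [|i]; first exact: (sf [::]).
  apply: IH => s x Ux; have := sf (rcons s i) x Ux.
  by rewrite /iter_partial foldr_rcons.
elim/last_ind: s f cf => [|s i IH] f cf x Ux; first exact: (cf 0%N).
rewrite /iter_partial foldr_rcons; apply: IH => // k.
exact: (cf k.+1).2.
Qed.

Lemma ckS k U f : ck k.+1 U f -> ck k U f.
Proof.
elim: k f => [|k IH] f [df pf]; first exact: df.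
by split=> // i; apply: IH; exact: pf.
Qed.

Lemma differentiable_eq_on U f g x : open U -> {in U, f =1 g} -> U x ->
  differentiable f x -> differentiable g x.
Proof.
move=> oU fg Ux df.
have nfg : \forall y \near (0 : V), f (y + x) = g (y + x).
  have : {near x, f =1 g}.
    near=> y; apply: fg; apply/mem_set; near: y; exact: open_nbhs_nbhs.
  by rewrite (near_shift 0) subr0.
have E : g \o shift x = cst (g x) + 'd f x +o_ (0 : V) id.
  have /eqaddoP H := diff_locally df.
  apply/eqaddoP => e e0; have := H e e0.
  apply: filterS2 nfg => y /= Ey.
  by rewrite !fctE /= Ey -(fg x) //; apply/mem_set.
apply/diff_locallyP; rewrite (diff_unique (diff_continuous df) E).
split; [exact: diff_continuous|exact: E].
Unshelve. all: by end_near. Qed.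

Lemma ck_eq_on k U f g : open U -> {in U, f =1 g} -> ck k U f -> ck k U g.
Proof.
move=> oU; elim: k f g => [|k IH] f g fg /=.
  by move=> df x Ux; exact: (differentiable_eq_on oU fg Ux (df x Ux)).
move=> [df pf]; split=> [x Ux|i].
  by exact: (differentiable_eq_on oU fg Ux (df x Ux)).
by apply: (IH (partial i f)) => //; exact: partial_eq_on.
Qed.

Lemma ck_cst k U (c : R) : ck k U (fun=> c).
Proof.
elim: k c => [|k IH] c /=; first by move=> x _; exact: differentiable_cst.
split=> [x _|i]; first exact: differentiable_cst.
by have -> : partial i (fun=> c) = (fun=> 0) :> (V -> R); [apply/funext => x; exact: partial_cst|].
Qed.

Lemma ckD k U f g : open U -> ck k U f -> ck k U g -> ck k U (fun x => f x + g x).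
Proof.
move=> oU; elim: k f g => [|k IH] f g /=.
  by move=> df dg x Ux; apply: differentiableD; [exact: df|exact: dg].
move=> [df pf] [dg pg]; split=> [x Ux|i].
  by apply: differentiableD; [exact: df|exact: dg].
apply: (@ck_eq_on _ _ (fun x => partial i f x + partial i g x)) => //; last exact: IH.
by move=> x /set_mem Ux; rewrite partialD//; [exact: df|exact: dg].
Qed.

Lemma ckM k U f g : open U -> ck k U f -> ck k U g -> ck k U (fun x => f x * g x).
Proof.
move=> oU; elim: k f g => [|k IH] f g.
  by move=> df dg x Ux; apply: differentiableM; [exact: df|exact: dg].
move=> cf cg; have [[df pf] [dg pg]] := (cf, cg); split=> [x Ux|i].
  by apply: differentiableM; [exact: df|exact: dg].
apply: (@ck_eq_on _ _ (fun x => partial i f x * g x + f x * partial i g x)) => //.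
  by move=> x /set_mem Ux; rewrite partialM//; [exact: df|exact: dg].
by apply: ckD; [|apply: IH (pf i) (ckS cg)|apply: IH (ckS cf) (pg i)].
Qed.

Lemma ckV k U f : open U -> (forall x, U x -> f x != 0) ->
  ck k U f -> ck k U (fun x => (f x)^-1).
Proof.
move=> oU f0; elim: k => [|k IH].
  by move=> df x Ux; apply: differentiableV; [exact: df|exact: f0].
move=> cf; have [df pf] := cf; split=> [x Ux|i].
  by apply: differentiableV; [exact: df|exact: f0].
apply: (@ck_eq_on _ _ (fun x => (-1) * ((f x)^-1 * (f x)^-1) * partial i f x)) => //.
  by move=> x /set_mem Ux; rewrite partialV ?mulN1r ?mulNr//; [exact: df|exact: f0].
have cV := IH (ckS cf).
apply: ckM; [by []| |exact: pf].
by apply: ckM; [|exact: ck_cst|exact: ckM].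
Qed.

Lemma smooth_differentiable U f x : smooth_on U f -> U x -> differentiable f x.
Proof. by move=> sf; exact: (sf [::]). Qed.

Lemma smooth_partial U f i : smooth_on U f -> smooth_on U (partial i f).
Proof. by move=> /smooth_onP sf; apply/smooth_onP => k; exact: (sf k.+1).2. Qed.

Lemma smooth_eq_on U f g : open U -> {in U, f =1 g} -> smooth_on U f -> smooth_on U g.
Proof.
by move=> oU fg /smooth_onP sf; apply/smooth_onP => k; exact: ck_eq_on (sf k).
Qed.

Lemma smooth_cst U (c : R) : smooth_on U (fun=> c).
Proof. by apply/smooth_onP => k; exact: ck_cst. Qed.

Lemma smoothD U f g : open U -> smooth_on U f -> smooth_on U g ->
  smooth_on U (fun x => f x + g x).
Proof. by move=> oU /smooth_onP sf /smooth_onP sg; apply/smooth_onP => k; exact: ckD. Qed.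

Lemma smoothM U f g : open U -> smooth_on U f -> smooth_on U g ->
  smooth_on U (fun x => f x * g x).
Proof. by move=> oU /smooth_onP sf /smooth_onP sg; apply/smooth_onP => k; exact: ckM. Qed.

Lemma smoothV U f : open U -> (forall x, U x -> f x != 0) -> smooth_on U f ->
  smooth_on U (fun x => (f x)^-1).
Proof. by move=> oU f0 /smooth_onP sf; apply/smooth_onP => k; exact: ckV. Qed.

Lemma smoothN U f : open U -> smooth_on U f -> smooth_on U (fun x => - f x).
Proof.
move=> oU sf; under eq_fun do rewrite -mulN1r.
by apply: smoothM => //; exact: smooth_cst.
Qed.

Lemma smoothB U f g : open U -> smooth_on U f -> smooth_on U g ->
  smooth_on U (fun x => f x - g x).
Proof. by move=> oU sf sg; apply: smoothD => //; exact: smoothN. Qed.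

Lemma smooth_sum (I : Type) (r : seq I) (P : pred I) (f : I -> V -> R) U : open U ->
  (forall a, P a -> smooth_on U (f a)) ->
  smooth_on U (fun x => \sum_(a <- r | P a) f a x).
Proof.
move=> oU sf; elim: r => [|a r IH].
  by under eq_fun do rewrite big_nil; exact: smooth_cst.
under eq_fun do rewrite big_cons.
by case: (boolP (P a)) => // Pa; apply: smoothD => //; exact: sf.
Qed.

Lemma smooth_prod (I : Type) (r : seq I) (P : pred I) (f : I -> V -> R) U : open U ->
  (forall a, P a -> smooth_on U (f a)) ->
  smooth_on U (fun x => \prod_(a <- r | P a) f a x).
Proof.
move=> oU sf; elim: r => [|a r IH].
  by under eq_fun do rewrite big_nil; exact: smooth_cst.
under eq_fun do rewrite big_cons.
case: (boolP (P a)) => // Pa; apply: smoothM => //; exact: sf.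
Qed.

Lemma partial_coord (c : R) x i j :
  partial i (fun y : V => y 0 j - c) x = (i == j)%:R.
Proof.
have d := @differentiable_coord R 1 n.+1 x 0 j.
rewrite partialB// partial_cst subr0 /partial.
apply: cvg_lim => //; apply: cvg_near_cst.
near=> h => /=; rewrite !mxE addrK eqxx eq_sym /=.
have h0 : h != 0 by near: h; exact: nbhs_dnbhs_neq.
by rewrite -[_ *: _]/(_ * _) mulrA mulVf// mul1r.
Unshelve. all: by end_near. Qed.

Lemma smooth_coord U j : open U -> smooth_on U (fun y : V => y 0 j).
Proof.
move=> oU; apply/smooth_onP => -[|k] /=.
  by move=> x _; exact: differentiable_coord.
split=> [x _|i]; first exact: differentiable_coord.
have -> : partial i (fun y : V => y 0 j) = (fun=> (i == j)%:R).
  apply/funext => x; rewrite -(partial_coord 0 x).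
  by congr (partial i _ x); apply/funext => y; rewrite subr0.
exact: ck_cst.
Qed.

Lemma smooth_det m (A : V -> 'M[R]_m) U : open U ->
  (forall a b : 'I_m, smooth_on U (fun x => A x a b)) -> smooth_on U (fun x => \det (A x)).
Proof.
move=> oU sA; rewrite /determinant; apply: smooth_sum => // s _.
by apply: smoothM => //; [exact: smooth_cst|exact: smooth_prod].
Qed.

Lemma smooth_invmx m (A : V -> 'M[R]_m) U : open U ->
  (forall x, U x -> A x \in unitmx) ->
  (forall a b : 'I_m, smooth_on U (fun x => A x a b)) ->
  forall a b : 'I_m, smooth_on U (fun x => invmx (A x) a b).
Proof.
move=> oU uA sA i j.
(* Cofactor formula: numerator and determinant are sums of products of entries. *)
apply: (@smooth_eq_on _ (fun x => (\det (A x))^-1 * ((-1) ^+ (j + i) *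
    \det (row' j (col' i (A x)))))) => //.
  by move=> x /set_mem Ux; rewrite /invmx uA// !mxE.
apply: smoothM => //.
  apply: smoothV => //; last exact: smooth_det.
  by move=> x /uA; rewrite unitmxE unitfE.
apply: smoothM => //; first exact: smooth_cst.
apply: smooth_det => // a b.
by under eq_fun do rewrite !mxE; exact: sA.
Qed.

End Smooth.

Lemma nbhs_normrP (R : realType) (M : normedModType R) (x : M) (P : set M) :
  nbhs x P <-> exists2 r : R, 0 < r & forall y, `|y - x| < r -> P y.
Proof.
split=> [/nbhs_ballP[r r0 rP]|[r r0 rP]].
  by exists r => // y yx; apply: rP; rewrite -ball_normE/= distrC.
apply/nbhs_ballP; exists r => // y.
by rewrite -ball_normE/= distrC; exact: rP.
Qed.

(** * Symmetry of second partial derivatives *)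

Section Schwarz.
Context {R : realType} {n : nat}.
Local Notation V := 'rV[R]_n.+1.
Implicit Types (f g : V -> R) (x : V) (i j : 'I_n.+1) (U : set V).

Lemma norm_delta_mx i : `|delta_mx 0 i : V| <= 1.
Proof.
rewrite [leLHS]/Num.Def.normr/= mx_normrE; apply: bigmax_le => // -[a b] _ /=.
by rewrite mxE; case: (_ && _); rewrite ?normr0 ?normr1.
Qed.


Lemma partial_shift f (w y : V) i :
  partial i (fun z => f (z + w)) y = partial i f (y + w).
Proof.
rewrite /partial /derive.
rewrite (_ : (fun h : R => h^-1 *: (((fun z => f (z + w)) \o shift y)
    (h *: delta_mx 0 i) - f (y + w))) = (fun h : R => h^-1 *:
    ((f \o shift (y + w)) (h *: delta_mx 0 i) - f (y + w)))) //.
by apply/funext => h /=; rewrite addrA.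
Qed.

Lemma differentiable_shift f (w y : V) : differentiable f (y + w) ->
  differentiable (fun z => f (z + w)) y.
Proof.
move=> df; have ds : differentiable (fun z : V => z + w) y.
  by apply: differentiableD => //; exact: differentiable_cst.
exact: (@differentiable_comp _ _ _ _ (fun z : V => z + w) f).
Qed.

Lemma derive_scale_delta f y (h : R) i : differentiable f y ->
  'D_(h *: delta_mx 0 i) f y = h * partial i f y.
Proof. by move=> df; rewrite deriveE// linearZ /= /partial deriveE. Qed.

(** The mean value theorem applies twice: to the increment of [f] in direction [j], moved along [i],
    and then to [partial i f] along [j]. The second difference is symmetric in [i] and [j], which is
    what [partialC] exploits. *)
Lemma mixed_difference U f x i j (h : R) : smooth_on U f -> 0 < h ->
  (forall y, `|y - x| <= 2 * h -> U y) ->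
  exists2 p, `|p - x| <= 2 * h &
    f (x + h *: delta_mx 0 i + h *: delta_mx 0 j) - f (x + h *: delta_mx 0 i)
    - (f (x + h *: delta_mx 0 j) - f x) = h * (h * partial j (partial i f) p).
Proof.
move=> sf h0 hU.
pose ei : V := delta_mx 0 i; pose ej : V := delta_mx 0 j.
have Hd (s t : R) : 0 <= s <= 1 -> 0 <= t <= 1 ->
    `|x + s *: (h *: ei) + t *: (h *: ej) - x| <= 2 * h.
  move=> /andP[s0 s1] /andP[t0 t1].
  rewrite [X in `|X|](_ : _ = s *: (h *: ei) + t *: (h *: ej)); last first.
    by rewrite addrC !addrA addNr add0r.
  rewrite mulr_natl mulr2n (le_trans (ler_normD _ _))// lerD// !normrZ.
    rewrite (ger0_norm s0) (gtr0_norm h0) -[leRHS]mul1r.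
    by rewrite ler_pM ?mulr_ge0 ?ler_piMr ?norm_delta_mx// ltW.
  rewrite (ger0_norm t0) (gtr0_norm h0) -[leRHS]mul1r.
  by rewrite ler_pM ?mulr_ge0 ?ler_piMr ?norm_delta_mx// ltW.
pose F y := f (y + h *: ej) - f y.
have df z : U z -> differentiable f z by exact: smooth_differentiable.
have dF (t : R) : 0 <= t <= 1 -> differentiable F (x + t *: (h *: ei)).
  move=> t01; apply: differentiableB.
    apply: differentiable_shift; apply: df; apply: hU.
    by have := Hd t 1 t01; rewrite scale1r; apply; rewrite ler01 lexx.
  apply: df; apply: hU.
  by have := Hd t 0 t01; rewrite scale0r addr0; apply; rewrite ler01 lexx.
have [t /andP[t0 t1] Et] := MVT_line dF.
have t01 : 0 <= t <= 1 by rewrite !ltW.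
have dif (s : R) : 0 <= s <= 1 ->
    differentiable (partial i f) (x + t *: (h *: ei) + s *: (h *: ej)).
  move=> s01; apply: smooth_differentiable (hU _ (Hd _ _ t01 s01)).
  exact: smooth_partial.
have [s /andP[s0 s1] Es] := MVT_line dif.
have s01 : 0 <= s <= 1 by rewrite !ltW.
exists (x + t *: (h *: ei) + s *: (h *: ej)); first exact: Hd.
rewrite -[LHS]/(F (x + h *: ei) - F x) Et derive_scale_delta; last exact: dF.
congr (_ * _).
have U0 : U (x + t *: (h *: ei)).
  apply: hU; have := Hd t 0 t01; rewrite scale0r addr0; apply.
  by rewrite ler01 lexx.
have U1 : U (x + t *: (h *: ei) + h *: ej).
  by apply: hU; have := Hd t 1 t01; rewrite scale1r; apply; rewrite ler01 lexx.
rewrite partialB; [|exact/differentiable_shift/df|exact: df].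
rewrite partial_shift Es derive_scale_delta//.
exact: dif.
Qed.

Lemma partialC U f x i j : open U -> smooth_on U f -> U x ->
  partial i (partial j f) x = partial j (partial i f) x.
Proof.
move=> oU sf Ux.
have c a b : {for x, continuous (partial a (partial b f))}.
  apply/differentiable_continuous/(@smooth_differentiable _ _ U) => //.
  by do 2 apply: smooth_partial.
apply/eqP; rewrite -subr_eq0 -normr_le0; apply/ler_addgt0Pl => e e0.
have e20 : 0 < e / 2 by rewrite divr_gt0.
have /cvgrPdist_lt/(_ _ e20) Hi := c i j.
have /cvgrPdist_lt/(_ _ e20) Hj := c j i.
have HU : \forall y \near x, U y by exact: open_nbhs_nbhs.
have [r r0 Hr] := (nbhs_normrP _ _).1 (filterI (filterI Hi Hj) HU).
pose h := r / 3.
have h0 : 0 < h by rewrite divr_gt0.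
have h2r : 2 * h < r by rewrite /h; lra.
have hU y : `|y - x| <= 2 * h -> U y.
  by move=> yx; have [] := Hr y (le_lt_trans yx h2r).
have [p px Ep] := mixed_difference i j sf h0 hU.
have [q qx Eq] := mixed_difference j i sf h0 hU.
(* The same second difference, divided by the square of [h], is one mixed partial at [p] and the
   other at [q]; continuity at [x] does the rest. *)
have E : partial j (partial i f) p = partial i (partial j f) q.
  have hn : h != 0 by rewrite gt_eqF.
  have cancel (u v w z A B : R) : u - v - (w - z) = h * (h * A) ->
      u - w - (v - z) = h * (h * B) -> A = B.
    by move=> EA EB; apply/(mulfI hn)/(mulfI hn); rewrite -EA -EB; ring.
  rewrite [x + _ *: delta_mx 0 j + _]addrAC in Eq.
  exact: cancel Ep Eq.
have [[_ Hp] _] := Hr p (le_lt_trans px h2r).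
have [[Hq _] _] := Hr q (le_lt_trans qx h2r).
rewrite addr0.
move: E Hp Hq.
generalize (partial j (partial i f) p) (partial i (partial j f) q) => _ a ->.
generalize (partial i (partial j f) x) (partial j (partial i f) x) => b c' Hp Hq.
rewrite (_ : b - c' = (b - a) - (c' - a)); last by ring.
by rewrite [leRHS]splitr (le_trans (ler_normB _ _))//; apply: lerD; exact: ltW.
Qed.

End Schwarz.

Opaque partial.

(** * The Picard-Lindeloef theorem and existence of geodesics *)

Section Antiderivative.
Context {R : realType}.
Implicit Types (f F u du : R -> R) (t : R).

Lemma mean_value_bound u du (C a b : R) : a <= b ->
  (forall t, a <= t <= b -> is_derive t 1 u (du t)) ->
  (forall t, a <= t <= b -> `|du t| <= C) -> `|u b - u a| <= C * (b - a).
Proof.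
move=> ab Hu HC.
have [t tab ->] : exists2 c, c \in `[a, b] & u b - u a = du c * (b - a).
  apply: MVT_segment => //.
    by move=> t; rewrite in_itv => /andP[/ltW ta /ltW tb]; apply: Hu; rewrite ta tb.
  apply: (@derivable_within_continuous R R) => t.
  by rewrite in_itv => /Hu [].
rewrite normrM (ger0_norm (_ : 0 <= b - a)) ?subr_ge0// ler_wpM2r ?subr_ge0//.
by apply: HC; move: tab; rewrite in_itv.
Qed.

Lemma mean_value_bound0 u du (C T : R) :
  (forall t, `|t| <= T -> is_derive t 1 u (du t)) ->
  (forall t, `|t| <= T -> `|du t| <= C) ->
  forall t, `|t| <= T -> `|u t - u 0| <= C * `|t|.
Proof.
move=> Hu HC t tT.
have [t0|t0] := leP 0 t.
  rewrite (ger0_norm t0) -{2}(subr0 t).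
  have H s : 0 <= s <= t -> `|s| <= T.
    move=> /andP[s0 st]; rewrite (ger0_norm s0) (le_trans st)//.
    by rewrite -(ger0_norm t0).
  by apply: (@mean_value_bound _ du) => // s /H; [exact: Hu|exact: HC].
rewrite (ltr0_norm t0) distrC -(sub0r t).
have H s : t <= s <= 0 -> `|s| <= T.
  move=> /andP[s0 st]; rewrite (ler0_norm st) (le_trans _ tT)//.
  by rewrite (ltr0_norm t0) lerN2.
by apply: (@mean_value_bound _ du _ t 0 (ltW t0)) => // s /H; [exact: Hu|exact: HC].
Qed.

Lemma local_antiderivative f (A : R) : continuous f -> 0 < A ->
  exists2 F, F 0 = 0 & forall t, `|t| < A -> is_derive t 1 F (f t).
Proof.
move=> cf A0.
pose G (x : R) := (\int[lebesgue_measure]_(t in [set` `[- A, x]]) f t)%R.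
have dG t : `|t| < A -> is_derive t 1 G (f t).
  rewrite ltr_norml => /andP[At tA].
  have intf : lebesgue_measure.-integrable `[- A, A] (EFin \o f).
    apply: continuous_compact_integrable; first exact: segment_compact.
    exact: continuous_subspaceT.
  have [d e] := continuous_FTC1_closed tA intf At (cf t).
  by apply: DeriveDef; [exact: d|rewrite -derive1E; exact: e].
exists (fun t => G t - G 0); first by rewrite subrr.
move=> t /dG dGt; rewrite -[f t]subr0.
exact: is_deriveB.
Qed.

(** Integration gives a primitive on each bounded interval. Normalised at [0], any two of them agree
    where both are valid, since their difference has derivative [0], so they glue. *)
Lemma antiderivative f : continuous f ->
  exists2 F, F 0 = 0 & forall t, is_derive t 1 F (f t).
Proof.
move=> cf.
have /choice[G HG] : forall A : R, exists F, 0 < A ->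
    F 0 = 0 /\ forall t, `|t| < A -> is_derive t 1 F (f t).
  move=> A; have [A0|A0] := ltP 0 A; last by exists (fun=> 0).
  by have [F F0 dF] := local_antiderivative cf A0; exists F.
have coh A B (t : R) : `|t| < A -> `|t| < B -> G A t = G B t.
  move=> tA tB.
  have A0 : 0 < A by exact: le_lt_trans tA.
  have B0 : 0 < B by exact: le_lt_trans tB.
  have [GA0 dA] := HG A A0; have [GB0 dB] := HG B B0.
  have H := @mean_value_bound0 (fun s => G A s - G B s) (fun=> 0) 0 `|t|.
  have : `|(G A t - G B t) - (G A 0 - G B 0)| <= 0 * `|t|.
    apply: H => // [s st|s _]; last by rewrite normr0.
    rewrite -(subrr (f s)); apply: is_deriveB.
      exact/dA/(le_lt_trans st).
    exact/dB/(le_lt_trans st).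
  rewrite GA0 GB0 subrr subr0 mul0r normr_le0 subr_eq0.
  by move/eqP.
(* Here the index varies with the point; near a given [t] this function coincides with the single
   primitive of index [|t| + 2], hence is differentiable. *)
exists (fun t => G (`|t| + 1) t).
  by rewrite normr0 add0r; have [] := HG 1 ltr01.
move=> t; have t2 : 0 < `|t| + 2 by rewrite ltr_wpDl.
have [_ /(_ t)dt] := HG _ t2.
apply: (@near_eq_is_derive R R R (G (`|t| + 2)) _ t 1); last first.
  by apply: dt; rewrite ltrDl.
have : \forall s \near t, `|s - t| < 1.
  by apply: (@nbhs_normrP R R t (fun s => `|s - t| < 1)).2; exists 1.
apply: filterS => s st; apply: coh; last by rewrite ltrDl.
have := ler_normD t (s - t); rewrite addrC subrK => H.
apply: (le_lt_trans H); rewrite ltrD2l (lt_trans st)//.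
by rewrite ltr1n.
Qed.

End Antiderivative.

Section GeometricLimits.
Context {R : realType}.

Lemma le_geometric_error (x y D : R) : (forall k, x <= y + D / 2 ^+ k) -> x <= y.
Proof.
move=> H; apply/ler_addgt0Pl => e e0.
have [D0|D0] := leP D 0.
  have := H 0%N; rewrite expr0 divr1 => /le_trans; apply.
  by rewrite [leRHS]addrC lerD2l (le_trans D0)// ltW.
pose k := Num.truncn (D / e); apply: (le_trans (H k.+1)).
rewrite addrC lerD2r ler_pdivrMr ?exprn_gt0// mulrC -ler_pdivrMr//.
apply: (@le_trans _ _ (k.+1)%:R).
  by apply/ltW/truncnS_gt; rewrite divr_ge0 ?ltW.
by rewrite -natrX ler_nat ltnW// ltn_expl.
Qed.

(** Nested intervals: the lower ends [b k] increase, the upper ends [c k] decrease, and the supremum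
    of the lower ends lies in all of them. *)
Lemma geometric_cauchy (a : nat -> R) (C : R) :
  (forall k, `|a k.+1 - a k| <= C / 2 ^+ k) ->
  exists l, forall k, `|l - a k| <= 2 * C / 2 ^+ k.
Proof.
move=> Ha.
pose b k := a k - 2 * C / 2 ^+ k; pose c k := a k + 2 * C / 2 ^+ k.
have step k : 2 * C / 2 ^+ k.+1 = C / 2 ^+ k.
  rewrite exprS; field.
  by rewrite expf_neq0 ?pnatr_eq0.
have C0 : 0 <= C by have := Ha 0%N; rewrite expr0 divr1; exact: le_trans.
have Cp k : 0 <= C / 2 ^+ k by rewrite divr_ge0// exprn_ge0.
have bS k : b k <= b k.+1.
  rewrite /b step; have := Ha k; rewrite ler_norml => /andP[+ _].
  have -> : 2 * C / 2 ^+ k = C / 2 ^+ k + C / 2 ^+ k by rewrite mulr_natl mulr2n mulrDl.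
  lra.
have cS k : c k.+1 <= c k.
  rewrite /c step; have := Ha k; rewrite ler_norml => /andP[_].
  have -> : 2 * C / 2 ^+ k = C / 2 ^+ k + C / 2 ^+ k by rewrite mulr_natl mulr2n mulrDl.
  lra.
have bm : {homo b : i j / (i <= j)%N >-> i <= j} by exact: homo_leq le_trans bS.
have cm i j : (i <= j)%N -> c j <= c i.
  by apply: (@homo_leq _ c (fun x y => y <= x)) => // x y z /[swap]; exact: le_trans.
have bc i j : b i <= c j.
  have [ij|ji] := leqP i j.
    apply: le_trans (bm _ _ ij) _; rewrite /b /c lerD2l.
    by rewrite ge0_cp // -mulrA mulr_ge0.
  apply: le_trans (cm _ _ (ltnW ji)); rewrite /b /c lerD2l.
  by rewrite ge0_cp // -mulrA mulr_ge0.
have hs : has_sup (range b).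
  by split; [exists (b 0%N); exists 0%N|exists (c 0%N) => _ [k _ <-]].
exists (sup (range b)) => k; rewrite ler_norml; apply/andP; split.
  have : b k <= sup (range b) by apply: ub_le_sup; [exact: hs.2|exists k].
  by rewrite /b; lra.
have : sup (range b) <= c k by apply: ge_sup; [exact: hs.1|move=> _ [i _ <-]].
by rewrite /c; lra.
Qed.

End GeometricLimits.

Section PicardStep.
Context {R : realType} {m n : nat}.
Local Notation V := 'M[R]_(m.+1, n.+1).
Implicit Types (z y : R -> V) (p : V) (Phi : V -> V).

Lemma mx_norm_le (M : V) (c : R) : 0 <= c ->
  (forall i j, `|M i j| <= c) -> `|M| <= c.
Proof.
move=> c0 H; rewrite [leLHS]/Num.Def.normr/= mx_normrE.
by apply: bigmax_le => // -[i j] _; exact: H.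
Qed.

Lemma le_mx_norm (M : V) i j : `|M i j| <= `|M|.
Proof.
rewrite [leRHS]/Num.Def.normr/= mx_normrE.
exact: (le_bigmax _ (fun k : 'I_m.+1 * 'I_n.+1 => `|M k.1 k.2|) (i, j)).
Qed.

Lemma is_derive_mxP z (t : R) (D : V) :
  is_derive t 1 z D <-> forall i j, is_derive t 1 (fun s => z s i j) (D i j).
Proof.
split=> [[dz <-] i j|H].
  apply: DeriveDef; first exact: (derivable_mxP z t 1).1.
  by rewrite derive_mx// mxE.
have dz : derivable z t 1 by apply/derivable_mxP => i j; case: (H i j).
apply: DeriveDef => //; rewrite derive_mx//; apply/matrixP => i j.
by rewrite mxE; case: (H i j).
Qed.

Lemma mx_mean_value_bound0 z (dz : R -> V) (C T : R) : 0 <= C ->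
  (forall t : R, `|t| <= T -> is_derive t 1 z (dz t)) ->
  (forall t : R, `|t| <= T -> `|dz t| <= C) ->
  forall t : R, `|t| <= T -> `|z t - z 0| <= C * `|t|.
Proof.
move=> C0 Hz HC t tT; apply: mx_norm_le => [|i j]; first exact: mulr_ge0.
rewrite !mxE; apply: (@mean_value_bound0 R (fun s => z s i j) (fun s => dz s i j) C T).
- by move=> s sT; apply: (is_derive_mxP _ _ _).1; exact: Hz.
- by move=> s sT; rewrite (le_trans (le_mx_norm _ _ _))// HC.
- by [].
Qed.

Lemma lipschitz_continuous (W1 W2 : normedModType R) (f : W1 -> W2) (L : R) :
  (forall a b, `|f a - f b| <= L * `|a - b|) -> continuous f.
Proof.
move=> Hf x; apply/cvgrPdist_lt => e e0.
have L0 : 0 < `|L| + 1 by rewrite ltr_wpDl.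
apply/nbhs_normrP; exists (e / (`|L| + 1)); first by rewrite divr_gt0.
move=> a; rewrite ltr_pdivlMr// => xy; rewrite distrC.
apply: le_lt_trans xy; apply: (le_trans (Hf _ _)); rewrite mulrC.
by rewrite ler_wpM2l// (le_trans (ler_norm L))// lerDl.
Qed.

Lemma picard_step Phi p : continuous Phi -> forall y, continuous y ->
  exists z, z 0 = p /\ forall t : R, is_derive t 1 z (Phi (y t)).
Proof.
move=> cPhi y cy.
have cf i j : continuous (fun t => Phi (y t) i j).
  move=> t; apply: (@continuous_comp _ _ _ (Phi \o y) (fun M : V => M i j)).
    by apply: continuous_comp; [exact: cy|exact: cPhi].
  exact: coord_continuous.
have /choice[F HF] : forall k : 'I_m.+1 * 'I_n.+1, exists F : R -> R,
    F 0 = 0 /\ forall t : R, is_derive t 1 F (Phi (y t) k.1 k.2).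
  by move=> [i j]; have [F] := antiderivative (cf i j); exists F.
exists (fun t => p + \matrix_(i, j) F (i, j) t); split.
  by apply/matrixP => i j; rewrite !mxE (HF (i, j)).1 addr0.
move=> t; apply/is_derive_mxP => i j.
have -> : (fun s => (p + \matrix_(i0, j0) F (i0, j0) s) i j) =
    cst (p i j) + F (i, j) by apply/funext => s; rewrite !mxE.
rewrite -[Phi _ _ _]add0r; apply: is_deriveD.
exact: (HF (i, j)).2.
Qed.

End PicardStep.

Section Picard.
Context {R : realType} {m n : nat}.
Local Notation V := 'M[R]_(m.+1, n.+1).
Implicit Types (z y : R -> V) (p : V) (Phi : V -> V).

Definition clamp (a T t : R) : R := Num.max (a - T) (Num.min (a + T) t).

Lemma clamp_id a T t : `|t - a| <= T -> clamp a T t = t.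
Proof.
rewrite ler_norml => /andP[h1 h2]; rewrite /clamp.
by rewrite min_r ?max_r//; lra.
Qed.

Lemma clamp_dist a T t : 0 <= T -> `|clamp a T t - a| <= T.
Proof.
move=> T0; rewrite ler_norml /clamp; case: (leP (a + T) t) => h.
  by case: (leP (a - T) (a + T)) => h'; lra.
by case: (leP (a - T) t) => h'; lra.
Qed.

Lemma clamp_lipschitz a T s t : `|clamp a T s - clamp a T t| <= `|s - t|.
Proof.
have nb u v : `|u - v| <= `|s - t| -> `|v - u| <= `|s - t| by rewrite distrC.
have H : forall u v w : R, `|Num.min w u - Num.min w v| <= `|u - v|.
  move=> u v w; case: (leP w u) => wu; case: (leP w v) => wv.
  - by rewrite subrr normr0.
  - by rewrite (ger0_norm (_ : 0 <= w - v)) ?ger0_norm; lra.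
  - by rewrite (ler0_norm (_ : u - w <= 0)) ?ler0_norm; lra.
  - by [].
have H' : forall u v w : R, `|Num.max w u - Num.max w v| <= `|u - v|.
  move=> u v w; case: (leP w u) => wu; case: (leP w v) => wv.
  - by [].
  - by rewrite (ger0_norm (_ : 0 <= u - w)) ?ger0_norm; lra.
  - by rewrite (ler0_norm (_ : w - v <= 0)) ?ler0_norm; lra.
  - by rewrite subrr normr0.
exact: le_trans (H' _ _ _) (H _ _ _).
Qed.

(** The Picard iterates live on the whole line, but one step halves distances on [[-T, T]] only,
    because [L * T] is at most [1/2]. There they converge geometrically, and the limit is a fixed
    point. *)
Lemma picard_global Phi p (L B T : R) : 0 <= L -> 0 < T -> L * T <= 2^-1 ->
  (forall a b, `|Phi a - Phi b| <= L * `|a - b|) -> (forall a, `|Phi a| <= B) ->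
  exists z, [/\ z 0 = p, forall t : R, `|t| <= T -> is_derive t 1 z (Phi (z t))
    & forall t : R, `|t| <= T -> `|z t - p| <= B * `|t|].
Proof.
move=> L0 T0 LT Lip Bd.
have B0 : 0 <= B by exact: le_trans (Bd 0).
have cPhi := lipschitz_continuous Lip.
have /choice[step Hstep] : forall y, exists z, continuous y ->
    z 0 = p /\ forall t : R, is_derive t 1 z (Phi (y t)).
  move=> y; have [cy|ncy] := pselect (continuous y); last by exists y.
  by have [z Hz] := picard_step p cPhi cy; exists z.
pose Y k := iter k step (fun=> p).
have cder z dz : (forall t : R, is_derive t 1 z (dz t)) -> continuous z.
  move=> Hz t; apply/differentiable_continuous/derivable1_diffP.
  by case: (Hz t).
have cY k : continuous (Y k).
  elim: k => [|k IH]; first exact: cst_continuous.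
  exact: cder (Hstep _ IH).2.
have Y0 k : Y k 0 = p by case: k => [//|k]; exact: (Hstep _ (cY k)).1.
have dY k (t : R) : is_derive t 1 (Y k.+1) (Phi (Y k t)) by exact: (Hstep _ (cY k)).2.
have contraction z1 z2 y1 y2 (C : R) : 0 <= C -> z1 0 = p -> z2 0 = p ->
    (forall t : R, is_derive t 1 z1 (Phi (y1 t))) ->
    (forall t : R, is_derive t 1 z2 (Phi (y2 t))) ->
    (forall t : R, `|t| <= T -> `|y1 t - y2 t| <= C) ->
    forall t : R, `|t| <= T -> `|z1 t - z2 t| <= C / 2.
  move=> C0 z10 z20 d1 d2 Hy t tT.
  have LC0 : 0 <= L * C by rewrite mulr_ge0.
  have H : `|(z1 t - z2 t) - (z1 0 - z2 0)| <= L * C * `|t|.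
    apply: (@mx_mean_value_bound0 R m n (fun s => z1 s - z2 s)
      (fun s => Phi (y1 s) - Phi (y2 s)) (L * C) T) => //.
    by move=> s sT; rewrite (le_trans (Lip _ _))// ler_wpM2l// Hy.
  move: H; rewrite z10 z20 subrr subr0 => /le_trans; apply.
  rewrite mulrAC mulrC ler_wpM2l// (le_trans _ LT)//.
  by rewrite ler_wpM2l.
have YB k (t : R) : `|t| <= T -> `|Y k t - p| <= B * `|t|.
  move=> tT; case: k => [|k]; first by rewrite subrr normr0 mulr_ge0.
  rewrite -(Y0 k.+1).
  by apply: (@mx_mean_value_bound0 _ _ _ _ (fun s => Phi (Y k s)) _ T).
have YS k (t : R) : `|t| <= T -> `|Y k.+1 t - Y k t| <= (B * T) / 2 ^+ k.
  elim: k t => [|k IH] t tT.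
    by rewrite expr0 divr1 (le_trans (YB 1%N t tT))// ler_wpM2l.
  rewrite exprSr invfM mulrA.
  apply: (@contraction _ _ (Y k.+1) (Y k)) => //.
  by rewrite divr_ge0// ?mulr_ge0// ?exprn_ge0// ltW.
have lip k (s t : R) : `|Y k s - Y k t| <= B * `|s - t|.
  case: k => [|k]; first by rewrite subrr normr0 mulr_ge0.
  wlog st : s t / t <= s.
    move=> H; have [st|/ltW st] := leP t s; first exact: H.
    by rewrite distrC (distrC s); exact: H.
  rewrite (ger0_norm (_ : 0 <= s - t)) ?subr_ge0//.
  apply: mx_norm_le => [|i j]; first by rewrite mulr_ge0 ?subr_ge0.
  rewrite !mxE.
  apply: (@mean_value_bound R (fun u => Y k.+1 u i j) (fun u => Phi (Y k u) i j)) => //.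
    by move=> u _; apply: (is_derive_mxP _ _ _).1.
  by move=> u _; rewrite (le_trans (le_mx_norm _ _ _)).
have /choice[y0 Hy0] : forall t : R, exists M : V, `|t| <= T ->
    forall k, `|M - Y k t| <= 2 * (B * T) / 2 ^+ k.
  move=> t; have [tT|tT] := leP `|t| T; last by exists 0.
  have /choice[l Hl] : forall k : 'I_m.+1 * 'I_n.+1, exists l : R,
      forall h, `|l - Y h t k.1 k.2| <= 2 * (B * T) / 2 ^+ h.
    move=> [i j]; apply: (geometric_cauchy (a := fun h => Y h t i j)) => h.
    apply: le_trans (YS h t tT); apply: le_trans (le_mx_norm _ i j).
    by rewrite !mxE.
  exists (\matrix_(i, j) l (i, j)) => _ k; apply: mx_norm_le => [|i j].
    by rewrite divr_ge0// ?mulr_ge0// ?exprn_ge0// ltW.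
  by rewrite !mxE; exact: (Hl (i, j)).
have T0' := ltW T0.
(* Freezing the limit outside [[-T, T]] makes it continuous on the whole line, as [step]
   requires. *)
pose yb t := y0 (clamp 0 T t).
have cT t : `|clamp 0 T t| <= T by have := clamp_dist 0 t T0'; rewrite subr0.
have yby k (t : R) : `|t| <= T -> `|yb t - Y k t| <= 2 * (B * T) / 2 ^+ k.
  by move=> tT; rewrite /yb clamp_id ?subr0//; exact: Hy0.
have cyb : continuous yb.
  apply: (@lipschitz_continuous _ _ _ _ B) => s t.
  apply: le_trans (ler_wpM2l B0 (clamp_lipschitz 0 T s t)).
  apply: (@le_geometric_error _ _ _ (4 * (B * T))) => k.
  have Hs := Hy0 _ (cT s) k; have Ht := Hy0 _ (cT t) k.
  have Hl := lip k (clamp 0 T s) (clamp 0 T t).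
  rewrite /yb.
  set s' := clamp 0 T s in Hs Hl *; set t' := clamp 0 T t in Ht Hl *.
  have -> : y0 s' - y0 t' = (y0 s' - Y k s') - (y0 t' - Y k t') + (Y k s' - Y k t').
    by rewrite opprB [RHS]addrAC !addrA !subrK.
  apply: le_trans (ler_normD _ _) _; rewrite addrC lerD//.
  apply: le_trans (ler_normB _ _) _.
  have -> : 4 * (B * T) / 2 ^+ k = 2 * (B * T) / 2 ^+ k + 2 * (B * T) / 2 ^+ k.
    by rewrite -!mulrDl; congr (_ / _); ring.
  exact: lerD.
have [z0 dz] := Hstep _ cyb.
exists (step yb).
(* Both [step yb] and [yb] are within a geometric error of [Y k.+1] for every [k], so they coincide
   on [[-T, T]]. *)
have zy (t : R) : `|t| <= T -> step yb t = yb t.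
  move=> tT; apply/eqP; rewrite -subr_eq0 -normr_le0.
  apply: (@le_geometric_error _ _ _ (2 * (B * T))) => k; rewrite add0r.
  have -> : step yb t - yb t = (step yb t - Y k.+1 t) - (yb t - Y k.+1 t).
    by rewrite opprB addrA subrK.
  apply: le_trans (ler_normB _ _) _.
  have -> : 2 * (B * T) / 2 ^+ k =
      2 * (B * T) / 2 ^+ k / 2 + 2 * (B * T) / 2 ^+ k.+1.
    by rewrite exprSr invfM [X in _ = _ + X]mulrA -splitr.
  apply: lerD; last exact: yby.
  apply: (@contraction _ _ yb (Y k)) => //.
  - by rewrite divr_ge0// ?mulr_ge0// ?exprn_ge0// ltW.
  - by move=> u uT; exact: yby.
split=> // [t tT|t tT]; first by rewrite zy.
rewrite -z0; apply: (@mx_mean_value_bound0 _ _ _ _ (fun s => Phi (yb s)) _ T) => //.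
Qed.

Lemma picard_local Phi p (r L : R) : 0 < r -> 0 <= L ->
  (forall a b, `|a - p| <= r -> `|b - p| <= r -> `|Phi a - Phi b| <= L * `|a - b|) ->
  exists (T : R) z, [/\ 0 < T, z 0 = p,
    forall t : R, `|t| < T -> is_derive t 1 z (Phi (z t))
    & forall t : R, `|t| < T -> `|z t - p| <= r].
Proof.
move=> r0 L0 Lip.
(* Clamping the argument makes the vector field bounded and globally Lipschitz. *)
pose c (a : V) : V := \matrix_(i, j) clamp (p i j) r (a i j).
have r0' := ltW r0.
have cr a : `|c a - p| <= r.
  by apply: mx_norm_le => // i j; rewrite !mxE; exact: clamp_dist.
have cl a b : `|c a - c b| <= `|a - b|.
  apply: mx_norm_le => // i j; rewrite !mxE.
  apply: le_trans (clamp_lipschitz _ _ _ _) _.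
  by apply: le_trans (le_mx_norm _ i j); rewrite !mxE.
have cid a : `|a - p| <= r -> c a = a.
  move=> ar; apply/matrixP => i j; rewrite mxE clamp_id//.
  by apply: le_trans ar; apply: le_trans (le_mx_norm _ i j); rewrite !mxE.
pose B := `|Phi p| + L * r.
have B0 : 0 <= B by rewrite addr_ge0// mulr_ge0.
have pr : `|p - p| <= r by rewrite subrr normr0.
(* The first bound makes [L * T] at most [1/2]; the second, with [B] bounding the clamped field,
   keeps the solution within [r] of [p], where clamping changes nothing. *)
pose T := Num.min (1 / (2 * (L + 1))) (r / (B + 1)).
have T0 : 0 < T.
  by rewrite lt_min !divr_gt0// ?mulr_gt0// ltr_wpDl.
have [| | |z [z0 dz zB]] := @picard_global (Phi \o c) p L B T L0 T0.
- apply: (@le_trans _ _ (L * (1 / (2 * (L + 1))))).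
    by rewrite ler_wpM2l// ge_min lexx.
  by rewrite mulrA mulr1 ler_pdivrMr ?mulr_gt0// ?ltr_wpDl//; lra.
- move=> a b; rewrite /=; apply: le_trans (Lip _ _ (cr _) (cr _)) _.
  by rewrite ler_wpM2l.
- move=> a; rewrite /= -(subrK (Phi p) (Phi (c a))).
  apply: le_trans (ler_normD _ _) _; rewrite addrC lerD2l.
  by apply: le_trans (Lip _ _ (cr _) pr) _; rewrite ler_wpM2l.
have zr (t : R) : `|t| <= T -> `|z t - p| <= r.
  move=> tT; apply: le_trans (zB t tT) _.
  apply: (@le_trans _ _ (B * (r / (B + 1)))).
    by rewrite ler_wpM2l// (le_trans tT)// ge_min lexx orbT.
  rewrite mulrA ler_pdivrMr ?ltr_wpDl// mulrC ler_wpM2l// lerDl ler01//.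
exists T, z; split=> // t /ltW tT; last exact: zr.
by have := dz t tT; rewrite /= cid//; exact: zr.
Qed.

End Picard.

(** * Local Lipschitz estimates *)

Section LocallyLipschitz.
Context {R : realType}.
Implicit Types (W : normedModType R).

Definition locally_lipschitz W (p : W) (f : W -> R) : Prop :=
  exists r L : R, [/\ 0 < r, 0 <= L & forall a b, `|a - p| <= r -> `|b - p| <= r ->
    `|f a - f b| <= L * `|a - b|].

Lemma locally_lipschitz_cst W (p : W) (k : R) : locally_lipschitz p (fun=> k).
Proof.
by exists 1, 0; split=> // a b _ _; rewrite subrr normr0 mul0r.
Qed.

Lemma locally_lipschitzD W (p : W) (f g : W -> R) :
  locally_lipschitz p f -> locally_lipschitz p g ->
  locally_lipschitz p (fun a => f a + g a).
Proof.
move=> [r [L [r0 L0 Hf]]] [s [K [s0 K0 Hg]]].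
exists (Num.min r s), (L + K); split; [by rewrite lt_min r0|exact: addr_ge0|].
move=> a b; rewrite !le_min => /andP[ar as'] /andP[br bs].
rewrite opprD addrACA mulrDl (le_trans (ler_normD _ _))// lerD//; [exact: Hf|exact: Hg].
Qed.

Lemma locally_lipschitzM W (p : W) (f g : W -> R) :
  locally_lipschitz p f -> locally_lipschitz p g ->
  locally_lipschitz p (fun a => f a * g a).
Proof.
move=> [r [L [r0 L0 Hf]]] [s [K [s0 K0 Hg]]].
pose t := Num.min r s.
have t0 : 0 < t by rewrite lt_min r0.
pose F := `|f p| + L * t; pose G := `|g p| + K * t.
have bd (h : W -> R) (u M : R) a : t <= u -> 0 <= M -> `|a - p| <= t ->
    (forall a b, `|a - p| <= u -> `|b - p| <= u -> `|h a - h b| <= M * `|a - b|) ->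
    `|h a| <= `|h p| + M * t.
  move=> tu M0 at' H; rewrite -(subrK (h p) (h a)) addrC.
  rewrite (le_trans (ler_normD _ _))// lerD2l.
  apply: (@le_trans _ _ (M * `|a - p|)); last exact: ler_wpM2l.
  apply: H; first exact: le_trans tu.
  by rewrite subrr normr0 (le_trans _ tu)// ltW.
have tr : t <= r by rewrite ge_min lexx.
have ts : t <= s by rewrite ge_min lexx orbT.
exists t, (F * K + G * L); split=> //.
  by rewrite addr_ge0// mulr_ge0// addr_ge0// mulr_ge0// ltW.
move=> a b at' bt.
have -> : f a * g a - f b * g b = f a * (g a - g b) + g b * (f a - f b) by ring.
rewrite mulrDl -!mulrA (le_trans (ler_normD _ _))// lerD// normrM ler_pM//.
- exact: (bd f r L).
- by apply: Hg; exact: le_trans ts.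
- exact: (bd g s K).
- by apply: Hf; exact: le_trans tr.
Qed.

Lemma locally_lipschitz_sum W (p : W) (I : Type) (r : seq I) (f : I -> W -> R) :
  (forall i, locally_lipschitz p (f i)) ->
  locally_lipschitz p (fun a => \sum_(i <- r) f i a).
Proof.
move=> Hf; elim: r => [|i r IH].
  by under eq_fun do rewrite big_nil; exact: locally_lipschitz_cst.
by under eq_fun do rewrite big_cons; exact: locally_lipschitzD.
Qed.

Lemma locally_lipschitz_comp W W' (p : W) (u : W -> W') (f : W' -> R) :
  (forall a b, `|u a - u b| <= `|a - b|) -> locally_lipschitz (u p) f ->
  locally_lipschitz p (f \o u).
Proof.
move=> Hu [r [L [r0 L0 Hf]]]; exists r, L; split=> // a b ar br.
apply: le_trans (Hf _ _ _ _) _; [exact: le_trans (Hu _ _) ar|exact: le_trans (Hu _ _) br|].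
exact: ler_wpM2l.
Qed.

(** Balls are convex, so the segment between two points of a small ball stays where the partial
    derivatives are bounded, and the mean value theorem applies along it. *)
Lemma smooth_locally_lipschitz n (U : set 'rV[R]_n.+1) f x :
  open U -> smooth_on U f -> U x -> locally_lipschitz x f.
Proof.
move=> oU sf Ux.
have HU : \forall y \near x, U y by exact: open_nbhs_nbhs.
have Hp : \forall y \near x, forall i, `|partial i f y| <= `|partial i f x| + 1.
  suff H i : \forall y \near x, `|partial i f y| <= `|partial i f x| + 1.
    exact: filter_forall H.
  have c : {for x, continuous (partial i f)}.
    apply/differentiable_continuous/(@smooth_differentiable _ _ U) => //.
    exact: smooth_partial.
  have /cvgrPdist_lt/(_ _ ltr01) := c; apply: filterS => y /ltW Hy.
  rewrite -(subKr (partial i f x) (partial i f y)).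
  by rewrite (le_trans (ler_normB _ _))// lerD2l.
have [r r0 Hr] := (nbhs_normrP _ _).1 (filterI HU Hp).
have r20 : 0 < r / 2 by rewrite divr_gt0.
have r2r : r / 2 < r by rewrite ltr_pdivrMr// ltr_pMr// ltr1n.
exists (r / 2), (\sum_i (`|partial i f x| + 1)); split=> //.
  by apply: sumr_ge0 => i _; rewrite addr_ge0.
move=> a b ar br.
have seg (t : R) : 0 <= t <= 1 -> `|b + t *: (a - b) - x| < r.
  move=> /andP[t0 t1].
  have -> : b + t *: (a - b) - x = (1 - t) *: (b - x) + t *: (a - x).
    by apply/matrixP => i j; rewrite !mxE; ring.
  apply: le_lt_trans r2r; apply: le_trans (ler_normD _ _) _; rewrite !normrZ.
  rewrite (ger0_norm t0) ger0_norm ?subr_ge0//.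
  have -> : r / 2 = (1 - t) * (r / 2) + t * (r / 2) by ring.
  by apply: lerD; rewrite ler_wpM2l// subr_ge0.
have df (t : R) : 0 <= t <= 1 -> differentiable f (b + t *: (a - b)).
  by move=> /seg /Hr [Uy _]; exact: (smooth_differentiable sf).
have [t /andP[t0 t1] Et] := MVT_line df.
have t01 : 0 <= t <= 1 by rewrite !ltW.
rewrite (_ : b + (a - b) = a) in Et; last by rewrite addrC subrK.
rewrite Et derive_partials; last exact: df.
apply: le_trans (ler_norm_sum _ _ _) _; rewrite mulr_suml; apply: ler_sum => i _.
rewrite normrM mulrC ler_pM//; last by have := le_mx_norm (a - b) 0 i.
by have [_] := Hr _ (seg t t01); exact.
Qed.

End LocallyLipschitz.

(** * Existence of geodesics with prescribed initial data *)

Section Geodesics.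
Context {R : realType} {n : nat}.
Local Notation V := 'rV[R]_n.+1.
Implicit Types (U : set V) (g : V -> 'M[R]_n.+1).

Lemma smooth_christoffel U g k i j : open U -> metric_on U g ->
  smooth_on U (christoffel g k i j).
Proof.
move=> oU [sg _ ug]; apply: smoothM => //; first exact: smooth_cst.
apply: smooth_sum => // l _; apply: smoothM => //.
  by apply: smooth_invmx => // a b; exact: sg.
by apply: smoothB => //; first apply: smoothD => //; apply: smooth_partial; exact: sg.
Qed.

Lemma exists_geodesic U g (x v : V) : open U -> metric_on U g -> U x ->
  exists I c, [/\ geodesic_on U g I c, I 0, c 0 = x & derive1 c 0 = v].
Proof.
move=> oU mg Ux.
(* The geodesic equation becomes an autonomous first order system: the first row is the position,
   the second the velocity. *)
pose S := 'M[R]_(2, n.+1).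
pose pos (M : S) : V := row ord0 M; pose vel (M : S) : V := row ord_max M.
pose acc (k : 'I_n.+1) (M : S) : R := - \sum_(i < n.+1) \sum_(j < n.+1)
  christoffel g k i j (pos M) * M ord_max i * M ord_max j.
pose Phi (M : S) : S :=
  \matrix_(i < 2, k < n.+1) if i == ord0 then M ord_max k else acc k M.
pose p : S := \matrix_(i < 2, k < n.+1) if i == ord0 then x 0 k else v 0 k.
have posp : pos p = x by apply/rowP => k; rewrite !mxE eqxx.
have velp : vel p = v by apply/rowP => k; rewrite !mxE.
have lcoord a k : locally_lipschitz p (fun M : S => M a k).
  exists 1, 1; split=> // M N _ _; rewrite mul1r.
  by apply: le_trans (le_mx_norm _ a k); rewrite !mxE.
have lpos (M N : S) : `|pos M - pos N| <= `|M - N|.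
  apply: mx_norm_le => // a k; rewrite !mxE.
  by apply: le_trans (le_mx_norm _ ord0 k); rewrite !mxE.
have lacc k : locally_lipschitz p (acc k).
  rewrite /acc; under eq_fun do rewrite -mulN1r.
  apply: locally_lipschitzM; first exact: locally_lipschitz_cst.
  apply: locally_lipschitz_sum => i; apply: locally_lipschitz_sum => j.
  apply: locally_lipschitzM; last exact: lcoord.
  apply: locally_lipschitzM; last exact: lcoord.
  apply: (@locally_lipschitz_comp _ _ _ p pos (christoffel g k i j) lpos).
  rewrite posp; apply: (@smooth_locally_lipschitz _ _ U) => //.
  exact: smooth_christoffel.
have lPhi : exists r L : R, [/\ 0 < r, 0 <= L & forall a b, `|a - p| <= r -> `|b - p| <= r ->
    `|Phi a - Phi b| <= L * `|a - b|].
  have /choice[rL HrL] : forall k : 'I_n.+1, exists rL : R * R, [/\ 0 < rL.1, 0 <= rL.2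
    & forall a b, `|a - p| <= rL.1 -> `|b - p| <= rL.1 ->
    `|acc k a - acc k b| <= rL.2 * `|a - b|].
    by move=> k; have [r [L H]] := lacc k; exists (r, L).
  (* The summand [1] is the Lipschitz constant of the position row, whose field is the velocity
     itself; the sum dominates the constants of all acceleration components. *)
  exists (\big[Num.min/1]_k (rL k).1), (1 + \sum_k (rL k).2); split.
  - by apply: lt_bigmin => // k _; case: (HrL k).
  - by rewrite addr_ge0// sumr_ge0// => k _; case: (HrL k).
  - move=> a b ar br; apply: mx_norm_le => [|i k].
      by rewrite mulr_ge0// addr_ge0// sumr_ge0// => k _; case: (HrL k).
    rewrite !mxE; case: ifP => _; rewrite mulrDl mul1r.
      rewrite -[leLHS]addr0 lerD//; last first.
        by rewrite mulr_ge0// sumr_ge0// => h _; case: (HrL h).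
      by apply: le_trans (le_mx_norm _ ord_max k); rewrite !mxE.
    have [h1 h2 h3] := HrL k.
    have rk : \big[Num.min/1]_k0 (rL k0).1 <= (rL k).1 by exact: bigmin_le_cond.
    apply: le_trans (h3 _ _ (le_trans ar rk) (le_trans br rk)) _.
    rewrite -[leLHS]add0r lerD// ler_wpM2r// (bigD1 k)//= lerDl.
    by rewrite sumr_ge0// => h _; case: (HrL h).
have [r [L [r0 L0 Lip]]] := lPhi.
have [T [z [T0 z0 dz _]]] := picard_local r0 L0 Lip.
have dpos (t : R) : `|t| < T -> is_derive t 1 (pos \o z) (vel (z t)).
  move=> tT; apply/is_derive_mxP => a k.
  have := (is_derive_mxP _ _ _).1 (dz t tT) ord0 k.
  rewrite !mxE eqxx; congr is_derive.
  by apply/funext => s; rewrite /= !mxE.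
have dvel (t : R) : `|t| < T -> is_derive t 1 (vel \o z) (\row_k acc k (z t)).
  move=> tT; apply/is_derive_mxP => a k.
  have := (is_derive_mxP _ _ _).1 (dz t tT) ord_max k.
  rewrite !mxE; congr is_derive.
  by apply/funext => s; rewrite /= !mxE.
have Upos : \forall t \near (0 : R), U (pos (z t)).
  have c0 : {for 0, continuous (pos \o z)}.
    apply/differentiable_continuous/derivable1_diffP.
    by case: (dpos 0 _); rewrite ?normr0.
  apply: c0; rewrite /= z0 posp; exact: open_nbhs_nbhs.
have [s s0 Hs] := (nbhs_normrP _ _).1 Upos.
pose d := Num.min s T.
have d0 : 0 < d by rewrite lt_min s0.
pose I : set R := [set` `]- d, d[].
have Id t : I t -> `|t| < d.
  by rewrite /I /= in_itv /= ltr_norml.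
have IT t : I t -> `|t| < T by move=> /Id /lt_le_trans; apply; rewrite ge_min lexx orbT.
have oI : open I by exact: interval_open.
have dc t : I t -> derive1 (pos \o z) t = vel (z t).
  by move=> /IT tT; rewrite derive1E; case: (dpos t tT).
have nI t : I t -> \forall s \near t, I s by move=> It; exact: open_nbhs_nbhs.
have ddc t : I t -> is_derive t 1 (derive1 (pos \o z)) (\row_k acc k (z t)).
  move=> It; apply: near_eq_is_derive (dvel t (IT t It)).
  by apply: filterS (nI t It) => u Iu; rewrite /= dc.
exists I, (pos \o z); split.
- split=> //.
  + by split=> //; exact: interval_is_interval.
  + move=> t It; apply: Hs; rewrite subr0 (lt_le_trans (Id t It))// ge_min lexx//.
  + move=> t It; split; first by case: (dpos t (IT t It)).
    by case: (ddc t It).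
  + move=> t It k; rewrite /derive1n /= dc//.
    rewrite (derive1E (derive1 (pos \o z))) (@derive_val _ _ _ _ _ _ _ (ddc t It)) mxE.
    rewrite /acc addrC; apply/eqP; rewrite subr_eq0; apply/eqP.
    by apply: eq_bigr => i _; apply: eq_bigr => j _; rewrite !mxE.
- by rewrite /I /= in_itv /= oppr_lt0 d0.
- by rewrite /= z0.
- by rewrite dc ?z0 ?velp// /I /= in_itv /= oppr_lt0 d0.
Qed.

End Geodesics.

(** * Geodesic equivalence and the difference of connections *)

Lemma is_derive_comp1 (R : realType) (W : normedModType R) (f : R -> W)
    (u : R -> R) (t du : R) (df : W) :
  is_derive t 1 u du -> is_derive (u t) 1 f df -> is_derive t 1 (f \o u) (du *: df).
Proof.
move=> [du1 <-] [df1 <-].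
have {}du1 : differentiable u t by apply/derivable1_diffP.
have {}df1 : differentiable f (u t) by apply/derivable1_diffP.
have dc : differentiable (f \o u) t by exact: differentiable_comp.
apply: DeriveDef; first exact/derivable1_diffP.
rewrite (deriveE _ dc) (deriveE _ df1) (deriveE _ du1) (diff_comp du1 df1) /= -linearZ /=.
by congr ('d f _ _); rewrite [RHS]mulr1.
Qed.

Section PureTrace.
Context {R : realFieldType} {n : nat}.
Local Notation I := 'I_n.+1.

(** The vectors [e_a + t e_b] suffice as tests: [t = 0] kills [T k i i] for [k] different from [i],
    and [t = 1] with [t = -1] then determine the mixed components. *)
Lemma pure_trace_tensor (T : I -> I -> I -> R) :
  (forall k i j, T k i j = T k j i) ->
  (forall v : 'rV[R]_n.+1, exists rho, forall k,
    \sum_i \sum_j T k i j * v 0 i * v 0 j = rho * v 0 k) ->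
  forall k i j, T k i j =
    (k == i)%:R * (2^-1 * T j j j) + (k == j)%:R * (2^-1 * T i i i).
Proof.
move=> sT HT.
have Q a b (t : R) : exists rho, forall k,
    T k a a + 2 * t * T k a b + t ^+ 2 * T k b b =
    rho * ((k == a)%:R + t * (k == b)%:R).
  have [rho Hrho] := HT (delta_mx 0 a + t *: delta_mx 0 b).
  exists rho => k; have := Hrho k; rewrite !mxE eqxx /= => <-.
  have E i : \sum_j T k i j * (delta_mx 0 a + t *: delta_mx 0 b : 'rV[R]_n.+1) 0 j =
      T k i a + t * T k i b.
    under eq_bigr do rewrite !mxE eqxx /= mulrDr.
    rewrite big_split /=; congr (_ + _).
      rewrite (bigD1 a)//= eqxx mulr1 big1 ?addr0// => j /negPf ->.
      by rewrite mulr0.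
    rewrite (bigD1 b)//= eqxx mulr1 mulrC big1 ?addr0// => j /negPf ->.
    by rewrite !mulr0.
  have E' (F : I -> R) : \sum_i F i * (delta_mx 0 a + t *: delta_mx 0 b : 'rV[R]_n.+1) 0 i =
      F a + t * F b.
    under eq_bigr do rewrite !mxE eqxx /= mulrDr.
    rewrite big_split /=; congr (_ + _).
      rewrite (bigD1 a)//= eqxx mulr1 big1 ?addr0// => j /negPf ->.
      by rewrite mulr0.
    rewrite (bigD1 b)//= eqxx mulr1 mulrC big1 ?addr0// => j /negPf ->.
    by rewrite !mulr0.
  transitivity (\sum_i (T k i a + t * T k i b) *
      (delta_mx 0 a + t *: delta_mx 0 b : 'rV[R]_n.+1) 0 i); last first.
    apply: eq_bigr => i _; rewrite -E mulr_suml; apply: eq_bigr => j _; ring.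
  by rewrite E' (sT k b a); ring.
have D k i : k != i -> T k i i = 0.
  move=> /negPf ki; have [rho /(_ k)] := Q i i 0.
  by rewrite ki !mul0r !mulr0 expr0n /= mul0r !addr0 mulr0.
move=> k i j; have [<-{j}|ij] := eqVneq i j.
  have [->|/D ->] := eqVneq k i; last by rewrite !mul0r addr0.
  by rewrite !mul1r; field.
have [r1 H1] := Q i j 1; have [r2 H2] := Q i j (-1).
have ji : j != i by rewrite eq_sym.
have := H1 k; have := H1 i; have := H1 j; have := H2 i; have := H2 j.
rewrite !eqxx (negPf ij) (negPf ji) (D i j)// (D j i)//.
have [->|ki] := eqVneq k i; first by rewrite (negPf ij) /= sqrrN expr1n; lra.
have [->|kj] := eqVneq k j; first by rewrite /= sqrrN expr1n; lra.
by rewrite (D k i)// (D k j)//= sqrrN expr1n; lra.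
Qed.

End PureTrace.

Section ProjectiveChange.
Context {R : realType} {n : nat}.
Local Notation V := 'rV[R]_n.+1.
Implicit Types (U : set V) (g h : V -> 'M[R]_n.+1).

(** Along the geodesic of [g] with velocity [v], the reparametrized curve has velocity [phi' v] and
    acceleration [phi'' v + phi'^2 c'']. Inserting [c'' = - Gamma_g(v, v)] into the equation of [h]
    leaves [phi'^2] times the difference of the connections at [(v, v)] equal to [- phi'' v]. *)
Lemma geodesically_equivalent_acceleration U g h (x v : V) :
  open U -> metric_on U g -> geodesically_equivalent U g h -> U x ->
  exists rho, forall k, \sum_i \sum_j
    (christoffel h k i j x - christoffel g k i j x) * v 0 i * v 0 j = rho * v 0 k.
Proof.
move=> oU mg gh Ux.
have [I [c [gc I0 c0 v0]]] := exists_geodesic v oU mg Ux.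
have [J [phi [[[oJ _] phiJ dphi phi0] [_ _ _ eqh]]]] := gh I c gc.
have [s0 Js0 phis0] : (phi @` J) 0 by rewrite phiJ.
have [_ _ dc eqg] := gc.
have IJ s : J s -> I (phi s) by move=> Js; rewrite -phiJ; exists s.
have dcphi s : J s -> derive1 (c \o phi) s = derive1 phi s *: derive1 c (phi s).
  move=> Js; rewrite !derive1E.
  have d1 := derivableP (dphi s Js).1; have d2 := derivableP (dc _ (IJ s Js)).1.
  exact: (derive_val (is_derive := is_derive_comp1 d1 d2)).
have ddcphi k : derive1n 2 (c \o phi) s0 0 k =
    derive1 (derive1 phi) s0 * v 0 k + derive1 phi s0 ^+ 2 * derive1n 2 c 0 0 k.
  rewrite /derive1n /=.
  have d1 := derivableP (dphi s0 Js0).1; have d1' := derivableP (dphi s0 Js0).2.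
  have d2 := derivableP (dc _ (IJ s0 Js0)).2.
  have dcomp : is_derive s0 1 (derive1 c \o phi) _ := is_derive_comp1 d1 d2.
  have dall : is_derive s0 1 (derive1 (c \o phi))
      (\row_k (derive1 phi s0 * (derive1 phi s0 * derive1 (derive1 c) 0 0 k) +
        v 0 k * derive1 (derive1 phi) s0)).
    apply/is_derive_mxP => a l; rewrite (ord1 a) mxE.
    have dl := (is_derive_mxP _ _ _).1 dcomp 0 l.
    have dprod := is_deriveM d1' dl.
    apply: (@near_eq_is_derive _ _ _
      (derive1 phi * (fun s => (derive1 c \o phi) s 0 l)) _ s0 1); last first.
      apply: is_derive_eq dprod _.
      by rewrite /= phis0 v0 !derive1E mxE.
    have nJ : \forall s \near s0, J s by exact: open_nbhs_nbhs.
    by apply: filterS nJ => s Js; rewrite dcphi// mxE.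
  by rewrite derive1E (derive_val (is_derive := dall)) mxE; ring.
have eh := eqh s0 Js0; have eg := eqg _ (IJ s0 Js0).
set d := derive1 phi s0 in ddcphi.
have dn0 : d != 0 by exact: phi0.
exists (- derive1 (derive1 phi) s0 / d ^+ 2) => k.
have Ec : (c \o phi) s0 = x by rewrite -c0 -phis0.
have {eg} := eg k; rewrite phis0 c0 v0 => Eg.
have {eh} := eh k; rewrite ddcphi (dcphi _ Js0) Ec phis0 v0 => Eh.
have {}Ec : forall C F A B : R, C + A = 0 -> F * v 0 k + d ^+ 2 * C + d ^+ 2 * B = 0 ->
    B - A = - F / d ^+ 2 * v 0 k.
  move=> C F A B E1 E2; have d2 : d ^+ 2 != 0 by rewrite expf_neq0.
  apply: (mulfI d2); rewrite mulrA [d ^+ 2 * (_ / _)]mulrC divfK//.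
  have -> : A = - C by apply/eqP; rewrite -addr_eq0 addrC E1.
  have -> : d ^+ 2 * (B - - C) = (F * v 0 k + d ^+ 2 * C + d ^+ 2 * B) - F * v 0 k by ring.
  by rewrite E2; ring.
rewrite -(Ec _ _ _ (\sum_i \sum_j christoffel h k i j x * v 0 i * v 0 j) Eg); last first.
  rewrite -[RHS]Eh; congr (_ + _).
  rewrite mulr_sumr; apply: eq_bigr => i _; rewrite mulr_sumr.
  by apply: eq_bigr => j _; rewrite !mxE -/d; ring.
rewrite -sumrB; apply: eq_bigr => i _; rewrite -sumrB; apply: eq_bigr => j _; ring.
Qed.

Lemma christoffel_sym g U x k i j : open U -> metric_on U g -> U x ->
  christoffel g k i j x = christoffel g k j i x.
Proof.
move=> oU [_ tg _] Ux; rewrite /christoffel; congr (_ * _); apply: eq_bigr => l _.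
congr (_ * _); rewrite [in LHS](addrC (partial i _ x)); congr (_ - _).
have E : {in U, entry g i j =1 entry g j i}.
  by move=> y /set_mem Uy; rewrite /entry -{1}(tg y Uy) mxE.
exact: (partial_eq_on l oU E (mem_set Ux)).
Qed.

(* If Gammabar = Gamma + delta phi + phi delta, then Gammabar^i_ii - Gamma^i_ii = 2 phi_i. *)
Definition change_form g h (i : 'I_n.+1) : V -> R :=
  fun x => 2^-1 * (christoffel h i i i x - christoffel g i i i x).

Lemma smooth_change_form U g h i : open U -> metric_on U g -> metric_on U h ->
  smooth_on U (change_form g h i).
Proof.
move=> oU mg mh; apply: smoothM => //; first exact: smooth_cst.
by apply: smoothB => //; exact: smooth_christoffel.
Qed.

Lemma projective_change U g h : open U -> metric_on U g -> metric_on U h ->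
  geodesically_equivalent U g h -> forall x, U x -> forall k i j,
  christoffel h k i j x = christoffel g k i j x +
    (k == i)%:R * change_form g h j x + (k == j)%:R * change_form g h i x.
Proof.
move=> oU mg mh gh x Ux k i j; apply/eqP; rewrite -addrA addrC -subr_eq; apply/eqP.
have := @pure_trace_tensor R n
  (fun k i j => christoffel h k i j x - christoffel g k i j x).
apply=> [{}k {}i {}j|v].
  by rewrite (christoffel_sym _ _ _ oU mg Ux) (christoffel_sym _ _ _ oU mh Ux).
exact: (geodesically_equivalent_acceleration v oU mg gh Ux).
Qed.

End ProjectiveChange.

(** * Curvature *)

Section MatrixPartial.
Context {R : realType} {n : nat}.
Local Notation V := 'rV[R]_n.+1.
Implicit Types (U : set V) (x : V) (k l : 'I_n.+1).

Definition mxpartial p q k (A : V -> 'M[R]_(p, q)) : V -> 'M[R]_(p, q) :=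
  fun x => \matrix_(i, j) partial k (fun y => A y i j) x.

Lemma mxpartialE p q k (A : V -> 'M[R]_(p, q)) x i j :
  mxpartial k A x i j = partial k (fun y => A y i j) x.
Proof. exact: mxE. Qed.

Opaque mxpartial.

Definition mxsmooth_on p q U (A : V -> 'M[R]_(p, q)) : Prop :=
  forall i j, smooth_on U (fun x => A x i j).

Lemma mxsmooth_partial p q U (A : V -> 'M[R]_(p, q)) k :
  mxsmooth_on U A -> mxsmooth_on U (mxpartial k A).
Proof.
move=> sA i j; under eq_fun do rewrite mxpartialE; exact: smooth_partial.
Qed.

Lemma mxsmoothM p q r U (A : V -> 'M[R]_(p, q)) (B : V -> 'M[R]_(q, r)) : open U ->
  mxsmooth_on U A -> mxsmooth_on U B -> mxsmooth_on U (fun x => A x *m B x).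
Proof.
move=> oU sA sB i j; under eq_fun do rewrite mxE.
by apply: smooth_sum => // a _; exact: smoothM.
Qed.

Lemma mxsmoothT p q U (A : V -> 'M[R]_(p, q)) :
  mxsmooth_on U A -> mxsmooth_on U (fun x => (A x)^T).
Proof. by move=> sA i j; under eq_fun do rewrite mxE; exact: sA. Qed.

Lemma mxpartialD p q U (A B : V -> 'M[R]_(p, q)) k x : U x ->
  mxsmooth_on U A -> mxsmooth_on U B ->
  mxpartial k (fun y => A y + B y) x = mxpartial k A x + mxpartial k B x.
Proof.
move=> Ux sA sB; apply/matrixP => i j; rewrite !mxE.
under eq_fun do rewrite mxE.
by rewrite partialD//; apply: smooth_differentiable Ux.
Qed.

Lemma mxpartialM p q r U (A : V -> 'M[R]_(p, q)) (B : V -> 'M[R]_(q, r)) k x : U x ->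
  mxsmooth_on U A -> mxsmooth_on U B ->
  mxpartial k (fun y => A y *m B y) x = mxpartial k A x *m B x + A x *m mxpartial k B x.
Proof.
move=> Ux sA sB; apply/matrixP => i j; rewrite !mxE.
under eq_fun do rewrite mxE.
have dA a b := smooth_differentiable (sA a b) Ux.
have dB a b := smooth_differentiable (sB a b) Ux.
rewrite partial_sum => [|a]; last exact: differentiableM.
rewrite -big_split; apply: eq_bigr => a _ /=.
by rewrite partialM// !mxE.
Qed.

Lemma mxpartialT p q (A : V -> 'M[R]_(p, q)) k x :
  mxpartial k (fun y => (A y)^T) x = (mxpartial k A x)^T.
Proof.
apply/matrixP => i j; rewrite !mxE; congr (partial k _ x).
by apply/funext => y; rewrite mxE.
Qed.

Lemma mxpartial_eq_on p q U (A B : V -> 'M[R]_(p, q)) k x : open U -> U x ->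
  (forall y, U y -> A y = B y) -> mxpartial k A x = mxpartial k B x.
Proof.
move=> oU Ux AB; apply/matrixP => i j; rewrite !mxE.
have E : {in U, (fun y => A y i j) =1 (fun y => B y i j)}.
  by move=> y /set_mem /AB ->.
exact: (partial_eq_on k oU E (mem_set Ux)).
Qed.

Lemma mxpartialC p q U (A : V -> 'M[R]_(p, q)) k l x : open U -> U x ->
  mxsmooth_on U A -> mxpartial l (mxpartial k A) x = mxpartial k (mxpartial l A) x.
Proof.
move=> oU Ux sA; apply/matrixP => i j; rewrite [LHS]mxpartialE [RHS]mxpartialE.
have E a : (fun y => mxpartial a A y i j) = partial a (fun y => A y i j).
  by apply/funext => y; rewrite mxpartialE.
rewrite !E; exact: (partialC _ _ oU (sA i j) Ux).
Qed.

End MatrixPartial.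

Section Curvature.
Context {R : realType} {n : nat}.
Local Notation V := 'rV[R]_n.+1.
Local Notation M := 'M[R]_n.+1.
Implicit Types (U : set V) (x : V) (g h : V -> M) (k l : 'I_n.+1).

Definition gam g k : V -> M := fun x => \matrix_(a, j) christoffel g a k j x.

(* Christoffel symbols of the first kind: glow dg k a j = Gamma_{a,kj}. *)
Definition glow (K : fieldType) (dg : 'I_n.+1 -> 'M[K]_n.+1) k : 'M[K]_n.+1 :=
  \matrix_(a, j) (2^-1 * (dg k j a + dg j k a - dg a k j)).

(** The curvature endomorphism of the coordinate fields [l] and [k], with the contravariant index as
    row index, so that skewness and trace become matrix identities. *)
Definition curv g l k : V -> M := fun x =>
  mxpartial l (gam g k) x - mxpartial k (gam g l) x
  + (gam g l x *m gam g k x - gam g k x *m gam g l x).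

Lemma gamE g k x : gam g k x = invmx (g x) *m glow (fun l => mxpartial l g x) k.
Proof.
apply/matrixP => a j; rewrite mxE [RHS]mxE /christoffel mulr_sumr.
by apply: eq_bigr => b _; rewrite [glow _ _ _ _]mxE !mxpartialE /entry; ring.
Qed.

Lemma gam_christoffel g k x a j : gam g k x a j = christoffel g a k j x.
Proof. exact: mxE. Qed.

Lemma curvE g l k x a j : curv g l k x a j =
  mxpartial l (gam g k) x a j - mxpartial k (gam g l) x a j
  + ((gam g l x *m gam g k x) a j - (gam g k x *m gam g l x) a j).
Proof.
rewrite /curv; move: (mxpartial l _ x) (mxpartial k _ x) (_ *m _) (_ *m _) => A B C D.
by rewrite !mxE.
Qed.

Lemma mxsmooth_gam U g k : open U -> metric_on U g -> mxsmooth_on U (gam g k).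
Proof.
move=> oU mg a j; under eq_fun do rewrite gam_christoffel; exact: smooth_christoffel.
Qed.

Lemma mxpartial_sym U g l x : open U -> metric_on U g -> U x ->
  (mxpartial l g x)^T = mxpartial l g x.
Proof.
move=> oU [_ tg _] Ux; rewrite -mxpartialT.
exact: (mxpartial_eq_on _ oU Ux).
Qed.

Lemma metric_compatible U g k x : open U -> metric_on U g -> U x ->
  mxpartial k g x = (gam g k x)^T *m g x + g x *m gam g k x.
Proof.
move=> oU mg Ux; have [_ tg ug] := mg.
have E : g x *m gam g k x = glow (fun l => mxpartial l g x) k.
  by rewrite gamE mulmxA mulmxV ?mul1mx// ug.
have -> : (gam g k x)^T *m g x = (glow (fun l => mxpartial l g x) k)^T.
  by rewrite -E trmx_mul tg.
rewrite E; apply/matrixP => i j; rewrite [RHS]mxE [(glow _ _)^T _ _]mxE ![glow _ _ _ _]mxE.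
have S l a b : mxpartial l g x a b = mxpartial l g x b a.
  by rewrite -{1}(mxpartial_sym l oU mg Ux) mxE.
by rewrite (S k j i); field.
Qed.

(** Differentiate metric compatibility once more and antisymmetrise: the second derivatives of [g]
    commute, and what remains is the curvature acting on [g]. *)
Lemma curvature_skew U g l k x : open U -> metric_on U g -> U x ->
  (curv g l k x)^T *m g x + g x *m curv g l k x = 0.
Proof.
move=> oU mg Ux; have [sg tg ug] := mg.
have sg' : mxsmooth_on U g by exact: sg.
have sgam a : mxsmooth_on U (gam g a) by exact: mxsmooth_gam.
have P a b : mxpartial a (mxpartial b g) x =
    (mxpartial a (gam g b) x)^T *m g x
    + (gam g b x)^T *m ((gam g a x)^T *m g x + g x *m gam g a x)
    + (((gam g a x)^T *m g x + g x *m gam g a x) *m gam g b x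
    + g x *m mxpartial a (gam g b) x).
  rewrite (@mxpartial_eq_on _ _ _ _ U _ (fun y => (gam g b y)^T *m g y + g y *m gam g b y))//.
    rewrite (mxpartialD _ Ux).
    - rewrite !(mxpartialM _ Ux)//; last exact: mxsmoothT.
      by rewrite mxpartialT -(metric_compatible _ oU mg Ux).
    - by apply: mxsmoothM => //; exact: mxsmoothT.
    - exact: mxsmoothM.
  by move=> y Uy; exact: metric_compatible mg Uy.
have := mxpartialC k l oU Ux sg'; rewrite !P /curv.
move: (mxpartial l _ x) (mxpartial k _ x) (gam g l x) (gam g k x) (g x) => a b p q G.
rewrite !mulmxDr !mulmxDl !mulmxA => E.
rewrite linearD !linearB /= !trmx_mul ?(mulmxDl, mulmxDr, mulNmx, mulmxN) ?mulmxA.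
move: E.
move: (a^T *m G) (G *m a) (b^T *m G) (G *m b) (q^T *m p^T *m G) (p^T *m q^T *m G).
move: (q^T *m G *m p) (p^T *m G *m q) (G *m p *m q) (G *m q *m p).
move=> m1 m2 m3 m4 m5 m6 m7 m8 m9 m10 /matrixP E; apply/matrixP => i j.
by move: (E i j); rewrite !mxE; lra.
Qed.

Lemma curvature_inverse_skew U g l k x : open U -> metric_on U g -> U x ->
  (curv g l k x *m invmx (g x))^T = - (curv g l k x *m invmx (g x)).
Proof.
move=> oU mg Ux; have [sg tg ug] := mg.
have /eqP := curvature_skew l k oU mg Ux; rewrite addr_eq0 => /eqP E.
have tV : (invmx (g x))^T = invmx (g x) by rewrite trmx_inv tg.
have uG := ug x Ux.
rewrite trmx_mul tV.
apply: (@row_free_inj _ _ _ _ (g x)); first by rewrite row_free_unit.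
by rewrite -mulmxA E mulNmx mulmxN mulmxA mulVmx// mul1mx mulmxKV.
Qed.

Lemma curvature_traceless U g l k x : open U -> metric_on U g -> U x ->
  \tr (curv g l k x) = 0.
Proof.
move=> oU mg Ux; have [sg tg ug] := mg; have uG := ug x Ux.
have /eqP := curvature_skew l k oU mg Ux; rewrite addr_eq0 => /eqP E.
have : \tr (curv g l k x) = - \tr (curv g l k x).
  rewrite -{1}(mxtrace_tr (curv g l k x)) -[X in \tr X](mulmxK uG) E.
  by rewrite mulNmx linearN /= mxtrace_mulC mulmxA mulVmx// mul1mx.
by move=> /eqP; rewrite -addr_eq0 -mulr2n -mulr_natl mulf_eq0 pnatr_eq0 => /eqP.
Qed.

Lemma mxpartial_glow U (F : 'I_n.+1 -> V -> M) l k x : U x ->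
  (forall m, mxsmooth_on U (F m)) ->
  mxpartial l (fun y => glow (fun m => F m y) k) x = glow (fun m => mxpartial l (F m) x) k.
Proof.
move=> Ux sF; apply/matrixP => a j; rewrite mxpartialE [RHS]mxE !mxpartialE.
have d m b c : differentiable (fun y => F m y b c) x.
  exact: smooth_differentiable (sF m b c) Ux.
have -> : (fun y => glow (fun m => F m y) k a j) =
    (fun y => 2^-1 * ((F k y j a + F j y k a) - F a y k j)).
  by apply/funext => y; rewrite mxE.
have dD : differentiable (fun y => F k y j a + F j y k a) x by exact: differentiableD.
rewrite partialZ; last exact: differentiableB.
by rewrite partialB// partialD.
Qed.

(** Differentiating the product of [g] with [gam g k], which is [glow], avoids differentiating an
    inverse matrix. *)
Lemma mxpartial_gam U g l k x : open U -> metric_on U g -> U x ->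
  mxpartial l (gam g k) x = invmx (g x) *m
    (glow (fun m => mxpartial l (mxpartial m g) x) k - mxpartial l g x *m gam g k x).
Proof.
move=> oU mg Ux; have [sg tg ug] := mg.
have sg' : mxsmooth_on U g by exact: sg.
have E y : U y -> g y *m gam g k y = glow (fun m => mxpartial m g y) k.
  by move=> Uy; rewrite gamE mulmxA mulmxV ?mul1mx// ug.
have dE := mxpartial_glow l k Ux (fun m => mxsmooth_partial m sg').
have := mxpartial_eq_on l oU Ux E; rewrite dE (mxpartialM _ Ux sg') => [<-|].
  rewrite addrC addKr mulmxA mulVmx ?mul1mx//; exact: ug.
exact: mxsmooth_gam.
Qed.

(** With the inverse metric as a separate argument [A], the curvature is polynomial in all arguments
    and affine in the second derivatives. The perturbation and the stability arguments rest on
    this. *)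
Definition jet_curv (A : M) (dg : 'I_n.+1 -> M) (ddg : 'I_n.+1 -> 'I_n.+1 -> M) l k : M :=
  A *m (glow (ddg l) k - dg l *m (A *m glow dg k))
  - A *m (glow (ddg k) l - dg k *m (A *m glow dg l))
  + (A *m glow dg l *m (A *m glow dg k) - A *m glow dg k *m (A *m glow dg l)).

Lemma curv_jet U g l k x : open U -> metric_on U g -> U x ->
  curv g l k x = jet_curv (invmx (g x)) (fun m => mxpartial m g x)
    (fun m p => mxpartial m (mxpartial p g) x) l k.
Proof.
by move=> oU mg Ux; rewrite /curv !(mxpartial_gam _ _ oU mg Ux) !gamE.
Qed.

End Curvature.

Opaque christoffel gam curv.

Lemma sum_delta (R : pzSemiRingType) (I : finType) (i : I) (F : I -> R) :
  \sum_j (j == i)%:R * F j = F i.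
Proof.
rewrite (bigD1 i)//= eqxx mul1r big1 ?addr0// => j /negPf ->.
by rewrite mul0r.
Qed.

Lemma mulmx_row_eq (R : pzSemiRingType) m n p (A B : 'M[R]_(m, n)) (C : 'M[R]_(n, p)) i j :
  (forall k, A i k = B i k) -> (A *m C) i j = (B *m C) i j.
Proof. by move=> AB; rewrite !mxE; apply: eq_bigr => k _; rewrite AB. Qed.

Lemma skew_entries (R : pzRingType) n (A : 'M[R]_n) i j :
  A^T = - A -> A i j + A j i = 0.
Proof. by move/matrixP/(_ i j); rewrite !mxE => ->; rewrite addrN. Qed.

Section CurvatureChange.
Context {R : realType} {n : nat}.
Local Notation V := 'rV[R]_n.+1.
Local Notation M := 'M[R]_n.+1.
Variables (U : set V) (g h : V -> M) (phi : 'I_n.+1 -> V -> R).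
Hypotheses (oU : open U) (mg : metric_on U g) (mh : metric_on U h).
Hypothesis sphi : forall i, smooth_on U (phi i).
Hypothesis Hphi : forall x, U x -> forall k i j,
  christoffel h k i j x = christoffel g k i j x +
    (k == i)%:R * phi j x + (k == j)%:R * phi i x.
Implicit Types (x : V) (a i j k l : 'I_n.+1).

Definition dform l k x : R := partial l (phi k) x - partial k (phi l) x.

(** The covariant derivative of [phi] for [g], minus the tensor square of [phi]: up to sign, the
    change of the projective Schouten tensor. *)
Definition schouten_change l j x : R := partial l (phi j) x - phi l x * phi j x
  - \sum_b phi b x * christoffel g b l j x.

Lemma curv_change l k x a j : U x ->
  curv h l k x a j = curv g l k x a j + (a == j)%:R * dform l k x
    + (a == k)%:R * schouten_change l j x - (a == l)%:R * schouten_change k j x.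
Proof.
move=> Ux.
have dG b c d := smooth_differentiable (smooth_christoffel b c d oU mg) Ux.
have dphi i := smooth_differentiable (sphi i) Ux.
have [DH HDH] : exists D, forall p q, mxpartial p (gam h q) x a j = D p q.
  by exists (fun p q => mxpartial p (gam h q) x a j).
have [DG HDG] : exists D, forall p q, mxpartial p (gam g q) x a j = D p q.
  by exists (fun p q => mxpartial p (gam g q) x a j).
have [MH HMH] : exists D, forall p q, (gam h p x *m gam h q x) a j = D p q.
  by exists (fun p q => (gam h p x *m gam h q x) a j).
have [MG HMG] : exists D, forall p q, (gam g p x *m gam g q x) a j = D p q.
  by exists (fun p q => (gam g p x *m gam g q x) a j).
have Ch : curv h l k x a j = DH l k - DH k l + (MH l k - MH k l).
  by rewrite -!HDH -!HMH; exact: curvE.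
have Cg : curv g l k x a j = DG l k - DG k l + (MG l k - MG k l).
  by rewrite -!HDG -!HMG; exact: curvE.
have dE p q : DH p q = DG p q +
    (a == q)%:R * partial p (phi j) x + (a == j)%:R * partial p (phi q) x.
  rewrite -HDH -HDG; apply: (eq_trans (mxpartialE p (gam h q) x a j)).
  have Eg := mxpartialE p (gam g q) x a j.
  transitivity (partial p (fun y => christoffel g a q j y +
      (a == q)%:R * phi j y + (a == j)%:R * phi q y) x).
    have E : {in U, (fun y => gam h q y a j) =1 (fun y => christoffel g a q j y +
        (a == q)%:R * phi j y + (a == j)%:R * phi q y)}.
      by move=> y /set_mem Uy; rewrite gam_christoffel Hphi.
    exact: (partial_eq_on p oU E (mem_set Ux)).
  have dZ (c : R) f : differentiable f x -> differentiable (fun y : V => c * f y) x.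
    by move=> df; apply: differentiableM => //; exact: differentiable_cst.
  rewrite partialD; [|apply: differentiableD; [exact: dG|exact: dZ]|exact: dZ].
  rewrite partialD; [|exact: dG|exact: dZ].
  rewrite (partialZ _ _ (dphi j)) (partialZ _ _ (dphi q)).
  congr (_ + _ + _); apply: etrans (esym Eg).
  by congr partial; apply/funext => y; rewrite gam_christoffel.
have mE p q : MH p q = MG p q
    + christoffel g a p q x * phi j x + christoffel g a p j x * phi q x
    + (a == p)%:R * (\sum_b phi b x * christoffel g b q j x)
    + phi p x * christoffel g a q j x
    + (a == p)%:R * (phi q x * phi j x + phi j x * phi q x)
    + phi p x * ((a == q)%:R * phi j x + (a == j)%:R * phi q x).
  rewrite -HMH -HMG.
  have -> : (gam h p x *m gam h q x) a j = \sum_b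
     (christoffel g a p b x * christoffel g b q j x
     + (b == q)%:R * (christoffel g a p b x * phi j x)
     + (b == j)%:R * (christoffel g a p b x * phi q x)
     + (a == p)%:R * (phi b x * christoffel g b q j x)
     + (b == a)%:R * (phi p x * christoffel g b q j x)
     + ((b == q)%:R * ((a == p)%:R * phi b x * phi j x) +
        (b == j)%:R * ((a == p)%:R * phi b x * phi q x))
     + (b == a)%:R * (phi p x * ((b == q)%:R * phi j x + (b == j)%:R * phi q x))).
    rewrite mxE; apply: eq_bigr => b _; rewrite !gam_christoffel !Hphi// [a == b]eq_sym.
    by move: (_ == _)%:R (_ == _)%:R (_ == _)%:R (_ == _)%:R => c1 c2 c3 c4; ring.
  have -> : (gam g p x *m gam g q x) a j =
      \sum_b christoffel g a p b x * christoffel g b q j x.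
    by rewrite mxE; apply: eq_bigr => b _; rewrite !gam_christoffel.
  by rewrite !big_split /= !sum_delta mulr_sumr; ring.
apply: (etrans Ch); rewrite Cg !dE !mE /dform /schouten_change.
rewrite (christoffel_sym a k l oU mg Ux); clear.
ring.
Qed.

(** Both curvature endomorphisms are trace free, being skew for a metric, while the trace of their
    difference is [d phi] times the dimension plus one. So [phi] is closed. *)
Lemma dform0 l k x : U x -> dform l k x = 0.
Proof.
move=> Ux.
have : \tr (curv h l k x) = \tr (curv g l k x) + (n.+1%:R + 1) * dform l k x.
  apply: (etrans (eq_bigr _ (fun a _ => curv_change l k a a Ux))).
  rewrite sumrB !big_split /= -addrA -addrA; congr (_ + _); rewrite mulrDl mul1r.
  have -> : \sum_(a < n.+1) (a == a)%:R * dform l k x = n.+1%:R * dform l k x.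
    under eq_bigr do rewrite eqxx mul1r.
    by rewrite sumr_const card_ord mulr_natl.
  rewrite !sum_delta /schouten_change /dform.
  have -> : \sum_b phi b x * christoffel g b l k x = \sum_b phi b x * christoffel g b k l x.
    by apply: eq_bigr => b _; rewrite (christoffel_sym _ _ _ oU mg Ux).
  by ring.
have zero_trace (a b d : R) : a = 0 -> b = 0 -> a = b + d -> d = 0.
  by move=> -> ->; rewrite add0r.
move=> /(zero_trace _ _ _ (curvature_traceless l k oU mh Ux)
  (curvature_traceless l k oU mg Ux)) /eqP; rewrite mulf_eq0 => /orP[|/eqP//].
by rewrite -natr1 -!mulrSr -?natrD pnatr_eq0.
Qed.

Lemma curv_change_off l k x a j : U x -> a != k -> a != l ->
  curv h l k x a j = curv g l k x a j.
Proof.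
move=> Ux /negPf ak /negPf al.
apply: (etrans (curv_change l k a j Ux)).
by rewrite ak al dform0// !mul0r mulr0 !addr0 subr0.
Qed.

(* The components of R_lk sigma + (R_lk sigma)^T with indices outside {k, l} only
   involve the curvature of g, so they give linear equations for sigma = h^-1. *)
Lemma inverse_metric_equation l k x a b : U x ->
  a != k -> a != l -> b != k -> b != l ->
  (curv g l k x *m invmx (h x)) a b + (curv g l k x *m invmx (h x)) b a = 0.
Proof.
move=> Ux ak al bk bl.
have E c d : c != k -> c != l ->
    (curv g l k x *m invmx (h x)) c d = (curv h l k x *m invmx (h x)) c d.
  move=> ck cl.
  by apply: mulmx_row_eq => i; exact/esym/curv_change_off.
have E1 := E a b ak al; have E2 := E b a bk bl.
have S := skew_entries a b (curvature_inverse_skew l k oU mh Ux).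
exact: (etrans (f_equal2 +%R E1 E2) S).
Qed.

End CurvatureChange.

(** * Generic curvature tensors in dimension 4 *)

Section RingClosed.
Context {R : realFieldType} {T : Type}.
Implicit Types (P : (T -> R) -> Prop) (f g : T -> R).

(** Used with two predicates, being a polynomial in one real variable and converging along a filter
    to the value at a point. One pass through determinants, adjugates and [jet_curv] thus serves the
    perturbation, openness and stability. *)
Record ring_closed P : Prop := RingClosed {
  closed_cst : forall c, P (fun=> c);
  closedD : forall f g, P f -> P g -> P (fun t => f t + g t);
  closedM : forall f g, P f -> P g -> P (fun t => f t * g t)
}.

Variable P : (T -> R) -> Prop.
Hypothesis cP : ring_closed P.

Lemma closedN f : P f -> P (fun t => - f t).
Proof.
by move=> Pf; under eq_fun do rewrite -mulN1r; apply: (closedM cP) => //; exact: closed_cst.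
Qed.

Lemma closedB f g : P f -> P g -> P (fun t => f t - g t).
Proof. by move=> Pf Pg; apply: (closedD cP) => //; exact: closedN. Qed.

Lemma closed_sum (I : Type) (r : seq I) (Q : pred I) (f : I -> T -> R) :
  (forall i, P (f i)) -> P (fun t => \sum_(i <- r | Q i) f i t).
Proof.
move=> Pf; elim: r => [|a r IH].
  by under eq_fun do rewrite big_nil; exact: closed_cst.
under eq_fun do rewrite big_cons.
by case: (Q a) => //; exact: (closedD cP).
Qed.

Lemma closed_prod (I : Type) (r : seq I) (Q : pred I) (f : I -> T -> R) :
  (forall i, P (f i)) -> P (fun t => \prod_(i <- r | Q i) f i t).
Proof.
move=> Pf; elim: r => [|a r IH].
  by under eq_fun do rewrite big_nil; exact: closed_cst.
under eq_fun do rewrite big_cons.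
by case: (Q a) => //; exact: (closedM cP).
Qed.

Definition mxclosed m n (A : T -> 'M[R]_(m, n)) := forall i j, P (fun t => A t i j).

Lemma closed_det n (A : T -> 'M[R]_n) : mxclosed A -> P (fun t => \det (A t)).
Proof.
move=> PA; rewrite /determinant; apply: closed_sum => s.
by apply: (closedM cP); [exact: closed_cst|exact: closed_prod].
Qed.

Lemma mxclosed_adj n (A : T -> 'M[R]_n) : mxclosed A -> mxclosed (fun t => \adj (A t)).
Proof.
move=> PA i j; under eq_fun do rewrite !mxE.
apply: (closedM cP); first exact: closed_cst.
by apply: closed_det => a b; under eq_fun do rewrite !mxE.
Qed.

Lemma mxclosedD m n (A B : T -> 'M[R]_(m, n)) :
  mxclosed A -> mxclosed B -> mxclosed (fun t => A t + B t).
Proof. by move=> PA PB i j; under eq_fun do rewrite mxE; exact: (closedD cP). Qed.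

Lemma mxclosedN m n (A : T -> 'M[R]_(m, n)) :
  mxclosed A -> mxclosed (fun t => - A t).
Proof. by move=> PA i j; under eq_fun do rewrite mxE; exact: closedN. Qed.

Lemma mxclosedM m n p (A : T -> 'M[R]_(m, n)) (B : T -> 'M[R]_(n, p)) :
  mxclosed A -> mxclosed B -> mxclosed (fun t => A t *m B t).
Proof.
move=> PA PB i j; under eq_fun do rewrite mxE.
by apply: closed_sum => k; exact: (closedM cP).
Qed.

Lemma mxclosed_cst m n (A : 'M[R]_(m, n)) : mxclosed (fun=> A).
Proof. by move=> i j; exact: closed_cst. Qed.

End RingClosed.

Section Weyl.
Context {R : realFieldType}.
Local Notation M := 'M[R]_4.
Local Notation I := 'I_4.

Definition o4 (m : nat) (lm : (m < 4)%N) : I := Ordinal lm.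
Notation o0 := (@o4 0 isT).
Notation o1 := (@o4 1 isT).
Notation o2 := (@o4 2 isT).
Notation o3 := (@o4 3 isT).

(** For distinct [i] and [j], the values [p = 0] and [p = 1] give the two other indices in
    increasing order: a curvature plane avoiding both [i] and [j]. *)
Definition compl (p : nat) (i j : I) : I :=
  nth o0 [seq k <- [:: o0; o1; o2; o3] | (k != i) && (k != j)] p.
Notation compl0 := (compl 0).
Notation compl1 := (compl 1).

Lemma I4P (Q : I -> Prop) : Q o0 -> Q o1 -> Q o2 -> Q o3 -> forall i, Q i.
Proof.
move=> q0 q1 q2 q3 [m lm].
case: m lm => [|[|[|[|m]]]] lm //.
- by rewrite (_ : Ordinal lm = o0)//; exact: val_inj.
- by rewrite (_ : Ordinal lm = o1)//; exact: val_inj.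
- by rewrite (_ : Ordinal lm = o2)//; exact: val_inj.
- by rewrite (_ : Ordinal lm = o3)//; exact: val_inj.
Qed.

Lemma compl_neq p i j : (p < 2)%N -> i != j ->
  (i != compl p i j) && (j != compl p i j).
Proof. by move: p => [|[|p]] // _; move: i j; apply: I4P; apply: I4P. Qed.

Lemma compl_sym p i j : compl p i j = compl p j i.
Proof. by congr nth; apply: eq_filter => k; rewrite andbC. Qed.

(* The equations of [inverse_metric_equation] that are used, together with the symmetry
   of sigma and the normalisation sigma_00 = 0. *)
Definition weylmap (Rm : I -> I -> M) (s : M) : M :=
  \matrix_(i, j)
    if i == j then
      if i == 0 then s 0 0
      else (Rm (compl0 0 i) (compl1 0 i) *m s) 0 i + (Rm (compl0 0 i) (compl1 0 i) *m s) i 0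
    else if (i < j)%N then
      (Rm (compl0 i j) (compl1 i j) *m s) i i + (Rm (compl0 i j) (compl1 i j) *m s) i i
    else s i j - s j i.

Lemma weylmap_is_linear Rm : linear (weylmap Rm).
Proof.
move=> c s t; apply/matrixP => i j.
have E' (A B : M) a b : (c *: A + B) a b = c * A a b + B a b by rewrite !mxE.
have E (A : M) a b : (A *m (c *: s + t)) a b = c * (A *m s) a b + (A *m t) a b.
  by rewrite mulmxDr -scalemxAr E'.
rewrite E' ![weylmap _ _ _ _]mxE.
by rewrite !E !E'; case: ifP => _; last case: ifP => _; try case: ifP => _; ring.
Qed.

HB.instance Definition _ Rm := GRing.isLinear.Build R M M *:%R (weylmap Rm)
  (weylmap_is_linear Rm).

(** There are sixteen equations for the sixteen entries of [s], so unique solvability is the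
    nonvanishing of one polynomial in [Rm]. *)
Definition weyl_det Rm : R := \det (lin_mx (weylmap Rm)).

Lemma weyl_det_inj Rm s : weyl_det Rm != 0 -> weylmap Rm s = 0 -> s = 0.
Proof.
move=> d0 s0.
have u : lin_mx (weylmap Rm) \in unitmx by rewrite unitmxE unitfE.
have E : mxvec s *m lin_mx (weylmap Rm) = 0 by rewrite mul_vec_lin /= s0 linear0.
apply: (can_inj mxvecK); rewrite linear0.
by rewrite -(mulmxK u (mxvec s)) E mul0mx.
Qed.

Lemma inj_weyl_det Rm : (forall s, weylmap Rm s = 0 -> s = 0) -> weyl_det Rm != 0.
Proof.
move=> inj; apply/det0P => -[v v0 vM]; move/negP: v0; apply; apply/eqP.
rewrite -(vec_mxK v); rewrite -(vec_mxK v) mul_vec_lin in vM.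
rewrite (inj (vec_mx v)) ?linear0//.
by apply: (can_inj mxvecK); rewrite vM linear0.
Qed.

(** Scaling affects the curvature equations but neither the symmetry nor the normalisation ones, so
    the argument compares kernels instead of using homogeneity. *)
Lemma weyl_det_scale Rm (c : R) : c != 0 ->
  weyl_det Rm != 0 -> weyl_det (fun l k => c *: Rm l k) != 0.
Proof.
move=> c0 d0; apply: inj_weyl_det => s /matrixP s0.
have E (A : M) a b : (c *: A *m s) a b = c * (A *m s) a b.
  by rewrite -scalemxAl; move: (A *m s) => B; rewrite mxE.
apply: (weyl_det_inj d0); apply/matrixP => i j; have := s0 i j.
rewrite ![weylmap _ _ _ _]mxE ![(0 : M) _ _]mxE !E.
case: ifP => _; last case: ifP => _ //.
- case: ifP => _ //; rewrite -mulrDr => /eqP.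
  by rewrite mulf_eq0 (negPf c0) => /eqP.
- rewrite -mulrDr => /eqP.
  by rewrite mulf_eq0 (negPf c0) => /eqP.
Qed.

Lemma closed_weyl_det (T : Type) (P : (T -> R) -> Prop) (Rm : T -> I -> I -> M) :
  ring_closed P -> (forall l k, mxclosed P (fun t => Rm t l k)) ->
  P (fun t => weyl_det (Rm t)).
Proof.
move=> cP PR; apply: closed_det => // i j.
under eq_fun do rewrite !mxE /=.
have PRs l k a b s : P (fun t => (Rm t l k *m s) a b).
  by apply: (mxclosedM cP (B := fun=> s)) => //; exact: mxclosed_cst.
case/mxvec_indexP: j => a b.
under eq_fun do rewrite mxvecE mxE.
case: (a == b); last case: (a < b)%N.
- case: (a == 0); first exact: (closed_cst cP).
  by apply: (closedD cP); exact: PRs.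
- by apply: (closedD cP); exact: PRs.
- exact: (closed_cst cP).
Qed.

(* d_l d_k of the (i, j) entry of
   4 x_1 x_3 (dx_0 dx_2 + dx_2 dx_0) + 2 x_1 x_2 (dx_0 dx_3 + dx_3 dx_0);
   at a flat metric it only produces curvature components R_abcd with four distinct
   indices, all of them nonzero. *)
Definition perturbation_hessian (l k i j : I) : int :=
  let pair (a b c d : nat) : bool := ((a == c) && (b == d)) || ((a == d) && (b == c)) in
  if pair l k 1 3 && pair i j 0 2 then 4
  else if pair l k 1 2 && pair i j 0 3 then 2 else 0.
Local Notation Q := perturbation_hessian.

Lemma perturbation_hessianC1 l k i j : Q l k i j = Q k l i j.
Proof. by move: l k i j; do 4 apply: I4P. Qed.

Lemma perturbation_hessianC2 l k i j : Q l k i j = Q l k j i.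
Proof. by move: l k i j; do 4 apply: I4P. Qed.

(** Twice the curvature, at a point where the metric is the identity and its first derivatives
    vanish, produced by second derivatives [Q]. *)
Definition weyl_example (l k a j : I) : int := Q l j k a - Q l a k j - Q k j l a + Q k a l j.
Local Notation D := weyl_example.

Lemma weyl_example_support i j m : i != j -> m != j ->
  D (compl0 i j) (compl1 i j) i m = 0.
Proof. by move: i j m; do 3 apply: I4P. Qed.

(** Up to sign the values are [4], [2] and [4 - 2], tied together by the first Bianchi identity. Two
    equal coefficients in the Hessian would make the third value vanish. *)
Lemma weyl_example_neq0 i j : i != j -> D (compl0 i j) (compl1 i j) i j != 0.
Proof. by move: i j; do 2 apply: I4P. Qed.

Lemma weyl_example_row (i j : I) (s : M) (m : I) : i != j ->
  ((\matrix_(a < 4, b < 4) (2^-1 * (D (compl0 i j) (compl1 i j) a b)%:~R)) *m s) i m =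
  2^-1 * (D (compl0 i j) (compl1 i j) i j)%:~R * s j m :> R.
Proof.
move=> ij; rewrite mxE (bigD1 j)//= mxE big1 ?addr0// => b bj.
by rewrite mxE weyl_example_support// mulr0 mul0r.
Qed.

(** Each row of the tensor that enters an equation has a single nonzero entry. The equations for
    [i < j] kill the lower triangle of [s], the symmetry ones the upper triangle, and the diagonal
    ones link [s i i] to [s 0 0], which the normalisation kills. *)
Lemma weyl_example_generic :
  weyl_det (fun l k => \matrix_(a < 4, b < 4) (2^-1 * (D l k a b)%:~R)) != 0.
Proof.
apply: inj_weyl_det => s /matrixP s0.
have nz (i j : I) : i != j -> 2^-1 * (D (compl0 i j) (compl1 i j) i j)%:~R != 0 :> R.
  by move=> ij; rewrite mulf_neq0 ?invr_eq0 ?pnatr_eq0// intr_eq0 weyl_example_neq0.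
have lower (i j : I) : (i < j)%N -> s j i = 0.
  move=> ij; have nij : i != j by rewrite -val_eqE neq_ltn ij.
  have := s0 i j; rewrite mxE [RHS]mxE (negPf nij) ij weyl_example_row// -mulr2n => /eqP.
  by rewrite mulrn_eq0 /= mulf_eq0 (negPf (nz _ _ nij)) => /eqP.
have s00 : s 0 0 = 0 by have := s0 0 0; rewrite mxE [RHS]mxE.
apply/matrixP => i j; rewrite [RHS]mxE.
have [ij|ji|/val_inj <-{j}] := ltngtP i j.
- have nji : j != i by rewrite -val_eqE neq_ltn ij orbT.
  have := s0 j i; rewrite mxE [RHS]mxE (negPf nji) ltnNge ltnW//=.
  by rewrite (lower i j)// sub0r => /eqP; rewrite oppr_eq0 => /eqP.
- exact: lower.
have [->//|i0] := eqVneq i 0.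
have i0' : 0 != i by rewrite eq_sym.
have := s0 i i; rewrite mxE [RHS]mxE eqxx (negPf i0) weyl_example_row//.
rewrite (compl_sym 0 0 i) (compl_sym 1 0 i) weyl_example_row// s00 mulr0 addr0 => /eqP.
rewrite mulf_eq0 (compl_sym 0 i 0) (compl_sym 1 i 0) (negPf (nz _ _ i0')).
by move=> /eqP.
Qed.

End Weyl.

Section RingClosedInstances.
Context {R : realType}.

Definition polynomial_function (f : R -> R) : Prop := exists p : {poly R}, forall t, f t = p.[t].

Lemma ring_closed_polynomial : ring_closed polynomial_function.
Proof.
split=> [c|f g [p fp] [q gq]|f g [p fp] [q gq]].
- by exists c%:P => t; rewrite hornerC.
- by exists (p + q) => t; rewrite hornerD fp gq.
- by exists (p * q) => t; rewrite hornerM fp gq.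
Qed.

Lemma polynomial_function_id : polynomial_function id.
Proof. by exists 'X => t; rewrite hornerX. Qed.

(** Among [size p] distinct points beyond [B], one is not a root. Applied with [B = d^-1], this
    yields parameters [u^-1] below [d]. *)
Lemma polynomial_function_neq0 f (B : R) : polynomial_function f -> f 0 != 0 ->
  exists2 u, B < u & f u != 0.
Proof.
move=> [p fp] f0.
have p0 : p != 0 by apply: contraNneq f0 => p0; rewrite fp p0 horner0.
pose rs := [seq B + 1 + i%:R | i <- iota 0 (size p)].
have urs : uniq rs.
  rewrite map_inj_uniq ?iota_uniq// => i j /addrI /eqP.
  by rewrite eqr_nat => /eqP.
have : ~~ all (root p) rs.
  apply/negP => ars; have := max_poly_roots p0 ars urs.
  by rewrite size_map size_iota ltnn.
move=> /allPn[u /mapP[i _ ->]] ru; exists (B + 1 + i%:R).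
  by rewrite -addrA ltrDl ltr_wpDr.
by rewrite fp.
Qed.

Lemma ring_closed_cvg (T : Type) (F : set_system T) (t0 : T) : Filter F ->
  ring_closed (fun f : T -> R => f t @[t --> F] --> f t0).
Proof.
move=> FF; split=> [c|f g cf cg|f g cf cg].
- exact: cvg_cst.
- exact: cvgD.
- exact: cvgM.
Qed.

End RingClosedInstances.

(** * Reaching a generic 2-jet by a small perturbation *)

Section GenericJets.
Context {R : realType}.
Local Notation M := 'M[R]_4.
Local Notation I := 'I_4.

Lemma closed_glow (T : Type) (P : (T -> R) -> Prop) (dg : T -> I -> M) k :
  ring_closed P -> (forall l, mxclosed P (fun t => dg t l)) ->
  mxclosed P (fun t => glow (dg t) k).
Proof.
move=> cP Pd a j; under eq_fun do rewrite mxE.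
apply: (closedM cP); first exact: (closed_cst cP).
apply: (closedB cP); last exact: Pd.
by apply: (closedD cP); exact: Pd.
Qed.

Lemma closed_jet_curv (T : Type) (P : (T -> R) -> Prop) (A : T -> M)
    (dg : T -> I -> M) (ddg : T -> I -> I -> M) l k :
  ring_closed P -> mxclosed P A -> (forall m, mxclosed P (fun t => dg t m)) ->
  (forall m p, mxclosed P (fun t => ddg t m p)) ->
  mxclosed P (fun t => jet_curv (A t) (dg t) (ddg t) l k).
Proof.
move=> cP PA Pd Pdd.
have Pg m := closed_glow m cP Pd.
have Pgg m p := closed_glow p cP (Pdd m).
have PAg m : mxclosed P (fun t => A t *m glow (dg t) m) by exact: mxclosedM.
have H m p : mxclosed P (fun t => A t *m (glow (ddg t m) p - dg t m *m (A t *m glow (dg t) p))).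
  apply: mxclosedM => //; apply: mxclosedD => //; apply: mxclosedN => //.
  exact: mxclosedM.
apply: mxclosedD => //; apply: mxclosedD => //; try apply: mxclosedN => //.
  exact: mxclosedM.
exact: mxclosedM.
Qed.

Definition hessian_matrix (l k : I) : M := \matrix_(i, j) (perturbation_hessian l k i j)%:~R.

Definition example_tensor (l k : I) : M := \matrix_(a, b) (2^-1 * (weyl_example l k a b)%:~R).

Lemma example_tensorE l k :
  example_tensor l k = glow (hessian_matrix l) k - glow (hessian_matrix k) l.
Proof.
apply/matrixP => a j; rewrite !mxE /weyl_example !(intrD, intrB).
by rewrite (perturbation_hessianC1 k l); ring.
Qed.

Lemma glowD (d e : I -> M) (t : R) k :
  glow (fun m => d m + t *: e m) k = glow d k + t *: glow e k.
Proof. by apply/matrixP => a j; rewrite !mxE; ring. Qed.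

Lemma jet_curv_perturbed (A : M) dg ddg (t : R) l k :
  jet_curv A dg (fun m p => ddg m p + t *: hessian_matrix m p) l k =
  jet_curv A dg ddg l k + t *: (A *m example_tensor l k).
Proof.
rewrite /jet_curv !glowD example_tensorE.
move: (glow _ _) (glow _ _) (glow _ _) (glow _ _) (glow _ _) (glow _ _).
move=> a b c d e f; rewrite !mulmxBr !mulmxDr -!scalemxAr scalerBr.
move: (A *m a) (A *m _) (A *m _) (A *m _) (A *m _) (A *m _) => B1 B2 B3 B4 B5 B6.
move: (_ *m _) (_ *m _) => B7 B8.
by apply/matrixP => i j; rewrite !mxE; ring.
Qed.

Lemma weyl_det_ext (F G : I -> I -> M) : (forall l k, F l k = G l k) ->
  weyl_det F = weyl_det G.
Proof.
by move=> FG; congr weyl_det; apply/funext => l; apply/funext => k.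
Qed.

(* For s = 1/u, the inverse of g0 + s is a multiple of \adj (1 + u g0), which is polynomial
   in u and equal to 1 at u = 0. *)
Lemma generic_inverse (g0 : M) (d : R) : 0 < d ->
  (forall s : R, 0 < s < d -> g0 + s%:M \in unitmx) ->
  exists2 s, 0 < s < d & weyl_det (fun l k => invmx (g0 + s%:M) *m example_tensor l k) != 0.
Proof.
move=> d0 ug.
pose f u := weyl_det (fun l k => \adj (1%:M + u *: g0) *m example_tensor l k).
have Pf : polynomial_function f.
  apply: closed_weyl_det => [|l k]; first exact: ring_closed_polynomial.
  apply: mxclosedM; first exact: ring_closed_polynomial; last first.
    by apply: mxclosed_cst; exact: ring_closed_polynomial.
  apply: mxclosed_adj; first exact: ring_closed_polynomial.
  move=> a b; under eq_fun do rewrite !mxE.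
  apply: (closedD ring_closed_polynomial); first exact: (closed_cst ring_closed_polynomial).
  apply: (closedM ring_closed_polynomial); first exact: polynomial_function_id.
  exact: (closed_cst ring_closed_polynomial).
have f0 : f 0 != 0.
  rewrite /f (@weyl_det_ext _ example_tensor); first exact: weyl_example_generic.
  by move=> l k; rewrite scale0r addr0 adj1 mul1mx.
have [u ud fu] := polynomial_function_neq0 d^-1 Pf f0.
have u0 : 0 < u by apply: lt_trans ud; rewrite invr_gt0.
have sd : 0 < u^-1 < d by rewrite invr_gt0 u0 /= invf_plt ?posrE.
exists u^-1; first exact: sd.
have uu := ug _ sd; have un0 : u != 0 by rewrite gt_eqF.
have E : g0 + (u^-1)%:M = u^-1 *: (1%:M + u *: g0).
  by rewrite scalerDr scalerA mulVf// scale1r scale_scalar_mx mulr1 addrC.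
pose c := u * (\det (1%:M + u *: g0))^-1.
have u1 : 1%:M + u *: g0 \in unitmx.
  by move: uu; rewrite E unitmxZ// unitfE invr_eq0.
have c0 : c != 0 by rewrite mulf_neq0// invr_eq0 -unitfE -unitmxE.
rewrite (@weyl_det_ext _ (fun l k => c *: (\adj (1%:M + u *: g0) *m example_tensor l k))).
  exact: weyl_det_scale.
move=> l k; rewrite E scalemxAl; congr (_ *m _).
by rewrite invmxZ -?E// invrK /invmx u1 scalerA.
Qed.

(** The parameter [s] is fixed first, since the inverse [A] depends on it. With [t = 1/u], the
    curvature is [1/u] times an affine function of [u], whose value at [u = 0] is the tensor treated
    in [generic_inverse]. *)
Lemma generic_jet (g0 : M) dg ddg (d : R) : 0 < d ->
  (forall s : R, 0 < s < d -> g0 + s%:M \in unitmx) ->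
  exists s t, [/\ 0 < s < d, 0 < t < d & weyl_det (jet_curv (invmx (g0 + s%:M)) dg
    (fun m p => ddg m p + t *: hessian_matrix m p)) != 0].
Proof.
move=> d0 ug; have [s sd sE] := generic_inverse d0 ug.
set A := invmx (g0 + s%:M) in sE *.
pose f u := weyl_det (fun l k => u *: jet_curv A dg ddg l k + A *m example_tensor l k).
have cP := @ring_closed_polynomial R.
have Pf : polynomial_function f.
  apply: closed_weyl_det => // l k a b; under eq_fun do rewrite mxE [X in X + _]mxE.
  apply: (closedD cP); last exact: (closed_cst cP).
  by apply: (closedM cP); [exact: polynomial_function_id|exact: (closed_cst cP)].
have f0 : f 0 != 0.
  by rewrite /f (weyl_det_ext (G := fun l k => A *m example_tensor l k))// => l k;
    rewrite scale0r add0r.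
have [u ud fu] := polynomial_function_neq0 d^-1 Pf f0.
have u0 : 0 < u by apply: lt_trans ud; rewrite invr_gt0.
have td : 0 < u^-1 < d by rewrite invr_gt0 u0 /= invf_plt ?posrE.
exists s, u^-1; split; [exact: sd|exact: td|].
have un0 : u != 0 by rewrite gt_eqF.
have c0 : u^-1 != 0 by rewrite invr_eq0.
rewrite (weyl_det_ext (G := fun l k =>
  u^-1 *: (u *: jet_curv A dg ddg l k + A *m example_tensor l k))).
  exact: weyl_det_scale.
by move=> l k; rewrite jet_curv_perturbed scalerDr scalerA mulVf// scale1r.
Qed.

End GenericJets.

(** * Conformal metrics near a generic point *)

Section MetricDerivative.
Context {R : realType} {n : nat}.
Variables (U : set 'rV[R]_n.+1) (g : 'rV[R]_n.+1 -> 'M[R]_n.+1).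

Lemma metric_entry_derivative i j k x : open U -> metric_on U g -> U x ->
  mxpartial k g x i j = \sum_a christoffel g a k i x * g x a j +
    \sum_a christoffel g a k j x * g x i a.
Proof.
move=> oU mg Ux.
have [G EG] : exists G : 'M[R]_n.+1, gam g k x = G by exists (gam g k x).
have GE a b : G a b = christoffel g a k b x by rewrite -EG gam_christoffel.
rewrite (metric_compatible _ oU mg Ux) EG !mxE; congr (_ + _).
  by apply: eq_bigr => a _; rewrite mxE GE.
by apply: eq_bigr => a _; rewrite GE mulrC.
Qed.

End MetricDerivative.

Section Proportional.
Context {R : realType}.
Local Notation M := 'M[R]_4.
Local Notation I := 'I_4.

Definition skew_equations (Rm : I -> I -> M) (B : M) : Prop :=
  forall l k a b, a != k -> a != l -> b != k -> b != l ->
    (Rm l k *m B) a b + (Rm l k *m B) b a = 0.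

(** All coordinates of [weylmap] but the normalisation vanish on a symmetric solution. Solutions
    with equal [B 0 0] therefore have equal images, and coincide when [weyl_det] is nonzero. *)
Lemma weylmap_skew_equations Rm B : B^T = B -> skew_equations Rm B ->
  weylmap Rm B = B 0 0 *: delta_mx 0 0.
Proof.
move=> tB HB; apply/matrixP => i j; rewrite mxE [RHS]mxE [delta_mx _ _ _ _]mxE.
have Hc (a b : I) : a != b -> [/\ a != compl 0 a b, a != compl 1 a b,
    b != compl 0 a b & b != compl 1 a b].
  move=> ab; have /andP[h1 h2] := compl_neq (isT : 0 < 2)%N ab.
  by have /andP[h3 h4] := compl_neq (isT : 1 < 2)%N ab; split.
have [<-{j}|nij] := eqVneq i j.
  have [i0|i0] := eqVneq i 0; first by rewrite ?i0 ?eqxx ?mulr1.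
  rewrite mulr0.
  have [|h1 h2 h3 h4] := Hc 0 i; first by rewrite eq_sym.
  exact: HB.
have -> : (i == 0) && (j == 0) = false.
  by apply/negP => /andP[/eqP i0 /eqP j0]; move: nij; rewrite i0 j0 eqxx.
rewrite mulr0; case: ifP => _.
  by have [h1 h2 h3 h4] := Hc _ _ nij; exact: HB.
by rewrite -{1}tB mxE subrr.
Qed.

Lemma skew_equations_proportional Rm (A S : M) : weyl_det Rm != 0 ->
  A^T = A -> S^T = S -> skew_equations Rm A -> skew_equations Rm S ->
  A \in unitmx -> S \in unitmx -> exists2 c, c != 0 & S = c *: A.
Proof.
move=> d0 tA tS HA HS uA uS.
have n0 (B : M) : B \in unitmx -> B != 0.
  by apply: contraTneq => ->; rewrite unitmxE det0 unitr0.
have wA := weylmap_skew_equations tA HA; have wS := weylmap_skew_equations tS HS.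
(* Otherwise [A] is in the kernel of [weylmap], hence zero, although it is invertible. *)
have A00 : A 0 0 != 0.
  apply: contraNneq (n0 _ uA) => A0; apply/eqP; apply: (weyl_det_inj d0).
  by rewrite wA A0 scale0r.
have E : S = (S 0 0 / A 0 0) *: A.
  apply/eqP; rewrite -subr_eq0; apply/eqP; apply: (weyl_det_inj d0).
  by rewrite linearB linearZ /= wA wS scalerA divfK// subrr.
exists (S 0 0 / A 0 0) => //; apply: contraNneq (n0 _ uS) => c0.
by rewrite E c0 scale0r.
Qed.

Lemma generic_proportional (U : set 'rV[R]_4) (g h : 'rV[R]_4 -> M)
    (phi : I -> 'rV[R]_4 -> R) x :
  open U -> metric_on U g -> metric_on U h -> (forall i, smooth_on U (phi i)) ->
  (forall x, U x -> forall k i j, christoffel h k i j x = christoffel g k i j x +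
    (k == i)%:R * phi j x + (k == j)%:R * phi i x) ->
  U x -> weyl_det (fun l k => curv g l k x) != 0 ->
  exists2 c, c != 0 & h x = c *: g x.
Proof.
move=> oU mg mh sphi Hphi Ux d0; have [_ tg ug] := mg; have [_ th uh] := mh.
have Eg : skew_equations (fun l k => curv g l k x) (invmx (g x)).
  move=> l k a b _ _ _ _; exact: skew_entries (curvature_inverse_skew l k oU mg Ux).
have Eh : skew_equations (fun l k => curv g l k x) (invmx (h x)).
  move=> l k a b ak al bk bl.
  exact: (inverse_metric_equation oU mg mh sphi Hphi Ux ak al bk bl).
have tVg : (invmx (g x))^T = invmx (g x) by rewrite trmx_inv tg.
have tVh : (invmx (h x))^T = invmx (h x) by rewrite trmx_inv th.
have uVg : invmx (g x) \in unitmx by rewrite unitmx_inv ug.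
have uVh : invmx (h x) \in unitmx by rewrite unitmx_inv uh.
have [c c0 E] := skew_equations_proportional d0 tVg tVh Eg Eh uVg uVh.
exists c^-1; first by rewrite invr_eq0.
rewrite -(invmxK (h x)) E invmxZ ?invmxK//.
by rewrite -E.
Qed.

(** The hypothesis is the derivative of [h = f g] compared with the change of connection. In
    dimension [N], its two contractions with the inverse [A] give [N X = f (2 N + 2) phi] and
    [X = f (N + 3) phi]; eliminating [X] leaves the factor [(N + 2) (N - 1)], nonzero for
    [N > 1]. *)
Lemma conformal_projective_algebra n (G A : 'M[R]_n.+1) (f : R) (X phi : 'I_n.+1 -> R) :
  (0 < n)%N -> G^T = G -> G *m A = 1%:M -> f != 0 ->
  (forall k i j, X k * G i j = f * (2 * phi k * G i j + phi i * G k j + G i k * phi j)) ->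
  forall k, phi k = 0.
Proof.
move=> n0 tG GA f0 HX.
pose psi m := \sum_j phi j * A j m.
have GAe i m : \sum_j G i j * A j m = (i == m)%:R.
  by have /matrixP/(_ i m) := GA; rewrite !mxE.
have AG : A *m G = 1%:M by exact: mulmx1C.
have Gpsi k : \sum_m psi m * G m k = phi k.
  under eq_bigr do rewrite /psi mulr_suml.
  rewrite exchange_big /=.
  transitivity (\sum_j (j == k)%:R * phi j); last exact: sum_delta.
  apply: eq_bigr => j _; have /matrixP/(_ j k) := AG; rewrite !mxE => <-.
  by rewrite mulr_suml; apply: eq_bigr => m _; ring.
have E k i m : X k * (i == m)%:R =
    f * (2 * phi k * (i == m)%:R + phi i * (k == m)%:R + G i k * psi m).
  rewrite -(GAe i m) -(GAe k m) /psi !mulr_sumr -!big_split /= !mulr_sumr.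
  by apply: eq_bigr => j _; rewrite mulrA HX; ring.
have N1 k : X k * n.+1%:R = f * (2 * phi k * n.+1%:R + phi k + phi k).
  have : \sum_(i < n.+1) X k * (i == i)%:R =
      \sum_i f * (2 * phi k * (i == i)%:R + phi i * (k == i)%:R + G i k * psi i).
    by apply: eq_bigr => i _; exact: E.
  rewrite -!mulr_sumr !big_split /= -mulr_sumr.
  under eq_bigr do rewrite eqxx; rewrite sumr_const card_ord => ->.
  congr (_ * (_ + _ + _)).
    under eq_bigr do rewrite mulrC eq_sym; exact: sum_delta.
  by under eq_bigr do rewrite mulrC; exact: Gpsi.
have N2 i : X i = f * (2 * phi i + phi i * n.+1%:R + phi i).
  have : \sum_(k < n.+1) X k * (i == k)%:R =
      \sum_k f * (2 * phi k * (i == k)%:R + phi i * (k == k)%:R + G i k * psi k).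
    by apply: eq_bigr => k _; exact: E.
  rewrite -!mulr_sumr !big_split /= -mulr_sumr.
  under eq_bigr do rewrite mulrC eq_sym; rewrite sum_delta => ->.
  congr (_ * (_ + _ + _)).
  - under eq_bigr do rewrite mulrC eq_sym; exact: (@sum_delta _ _ i (fun k => 2 * phi k)).
  - by under eq_bigr do rewrite eqxx; rewrite sumr_const card_ord.
  - rewrite -[RHS]Gpsi; apply: eq_bigr => k _.
    by rewrite mulrC -{1}tG mxE.
move=> k; have := N1 k; rewrite N2 => H.
have : f * phi k * ((n%:R + 3) * n%:R) = 0.
  by move: H; rewrite -natr1; nra.
move=> /eqP; rewrite !mulf_eq0 (negPf f0) /= => /orP[/eqP//|/orP[|]].
  by rewrite -natrD pnatr_eq0 addnS.
by rewrite pnatr_eq0 -leqn0 leqNgt n0.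
Qed.

Lemma conformal_projective (U : set 'rV[R]_4) (g h : 'rV[R]_4 -> M)
    (phi : I -> 'rV[R]_4 -> R) (c : 'rV[R]_4 -> R) :
  open U -> metric_on U g -> metric_on U h ->
  (forall x, U x -> forall k i j, christoffel h k i j x = christoffel g k i j x +
    (k == i)%:R * phi j x + (k == j)%:R * phi i x) ->
  (forall x, U x -> c x != 0 /\ h x = c x *: g x) ->
  forall x, U x -> forall k, phi k x = 0.
Proof.
move=> oU mg mh Hphi Hc x Ux.
have [sg tg ug] := mg; have [sh th uh] := mh.
(* The factor [c] is only known pointwise; a quarter of the trace of [g^-1 h] equals it on [U] and
   is visibly smooth. *)
pose f y := \sum_i \sum_j 4^-1 * (invmx (g y) i j * h y j i).
have fc y : U y -> f y = c y.
  move=> Uy; have [_ E] := Hc y Uy.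
  transitivity (4^-1 * \tr (invmx (g y) *m h y)).
    rewrite /mxtrace mulr_sumr; apply: eq_bigr => i _.
    by rewrite mxE mulr_sumr.
  rewrite E -scalemxAr mulVmx ?ug// linearZ /= mxtrace1.
  by rewrite mulrCA mulVf ?mulr1// pnatr_eq0.
have sf : smooth_on U f.
  apply: smooth_sum => // i _; apply: smooth_sum => // j _.
  apply: smoothM => //; first exact: smooth_cst.
  apply: smoothM => //; last exact: sh.
  by apply: smooth_invmx => // a b; exact: sg.
have hf y : U y -> h y = f y *: g y by move=> Uy; rewrite fc//; case: (Hc y Uy).
have [cx0 _] := Hc x Ux.
have fx0 : f x != 0 by rewrite fc.
have GA : g x *m invmx (g x) = 1%:M by rewrite mulmxV// ug.
apply: (@conformal_projective_algebra _ _ _ _ (fun k => partial k f x) _ _ (tg x Ux) GA fx0) => //.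
move=> k i j.
have dh : mxpartial k h x i j = partial k f x * g x i j + f x * mxpartial k g x i j.
  rewrite !mxpartialE.
  have -> : partial k (fun y => h y i j) x = partial k (fun y => f y * g y i j) x.
    have E : {in U, (fun y => h y i j) =1 (fun y => f y * g y i j)}.
      by move=> y /set_mem Uy; rewrite hf// mxE.
    exact: (partial_eq_on k oU E (mem_set Ux)).
  rewrite partialM//; first exact: smooth_differentiable sf Ux.
  exact: smooth_differentiable (sg i j) Ux.
have dhE := metric_entry_derivative i j k oU mh Ux.
have dgE := metric_entry_derivative i j k oU mg Ux.
have e1 : \sum_a christoffel h a k i x * h x a j =
    f x * (\sum_a christoffel g a k i x * g x a j + phi i x * g x k j + phi k x * g x i j).
  rewrite -[phi i x * _](sum_delta k (fun a => phi i x * g x a j)).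
  rewrite -[phi k x * g x i j](sum_delta i (fun a => phi k x * g x a j)).
  rewrite -!big_split /= mulr_sumr; apply: eq_bigr => a _.
  by rewrite Hphi// hf// mxE; ring.
have e2 : \sum_a christoffel h a k j x * h x i a =
    f x * (\sum_a christoffel g a k j x * g x i a + phi j x * g x i k + phi k x * g x i j).
  rewrite -[phi j x * _](sum_delta k (fun a => phi j x * g x i a)).
  rewrite -[phi k x * g x i j](sum_delta j (fun a => phi k x * g x i a)).
  rewrite -!big_split /= mulr_sumr; apply: eq_bigr => a _.
  by rewrite Hphi// hf// mxE; ring.
move: dh; rewrite dhE dgE e1 e2.
move: (\sum__ _) (\sum__ _) => A B /eqP; rewrite -subr_eq => /eqP <-.
ring.
Qed.

End Proportional.

(** * Unique continuation *)

Section SmoothSpan.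
Context {R : realType} {n : nat}.
Local Notation V := 'rV[R]_n.+1.
Variable U : set V.
Hypothesis oU : open U.
Implicit Types (f : V -> R) (x : V).

(** Membership in the module generated by the [y b] over smooth functions on [U]. It allows
    computing modulo the unknowns without recording coefficients, which may depend on [g] and
    [h]. *)
Definition smooth_span (T : finType) (y : T -> V -> R) f : Prop :=
  exists C : T -> V -> R, (forall b, smooth_on U (C b)) /\
    forall x, U x -> f x = \sum_b C b x * y b x.

Section Fixed.
Variables (T : finType) (y : T -> V -> R).
Local Notation L := (smooth_span y).

Lemma span_eq_on f f' : (forall x, U x -> f x = f' x) -> L f -> L f'.
Proof. by move=> ff' [C [sC EC]]; exists C; split=> // x Ux; rewrite -ff'// EC. Qed.

Lemma span_generator b : L (y b).
Proof.
exists (fun b' => fun=> (b' == b)%:R); split=> [b'|x Ux]; first exact: smooth_cst.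
rewrite (bigD1 b)//= eqxx mul1r big1 ?addr0// => b' /negPf ->.
by rewrite mul0r.
Qed.

Lemma spanD f f' : L f -> L f' -> L (fun x => f x + f' x).
Proof.
move=> [C [sC EC]] [D [sD ED]]; exists (fun b x => C b x + D b x); split=> [b|x Ux].
  exact: smoothD.
by rewrite EC// ED// -big_split; apply: eq_bigr => b _; rewrite mulrDl.
Qed.

Lemma spanM a f : smooth_on U a -> L f -> L (fun x => a x * f x).
Proof.
move=> sa [C [sC EC]]; exists (fun b x => a x * C b x); split=> [b|x Ux].
  exact: smoothM.
by rewrite EC// mulr_sumr; apply: eq_bigr => b _; rewrite mulrA.
Qed.

Lemma spanZ (k : R) f : L f -> L (fun x => k * f x).
Proof. by apply: (@spanM (fun=> k)); exact: smooth_cst. Qed.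

Lemma spanN f : L f -> L (fun x => - f x).
Proof. by move=> /(spanZ (-1)); apply: span_eq_on => x _; rewrite mulN1r. Qed.

Lemma spanB f f' : L f -> L f' -> L (fun x => f x - f' x).
Proof. by move=> Lf Lf'; apply: spanD => //; exact: spanN. Qed.

Lemma span0 : L (fun=> 0).
Proof.
exists (fun _ => fun=> 0); split=> [b|x _]; first exact: smooth_cst.
by rewrite big1// => b _; rewrite mul0r.
Qed.

Lemma span_sum (I : Type) (r : seq I) (f : I -> V -> R) :
  (forall i, L (f i)) -> L (fun x => \sum_(i <- r) f i x).
Proof.
move=> Lf; elim: r => [|i r IH].
  by under eq_fun do rewrite big_nil; exact: span0.
by under eq_fun do rewrite big_cons; exact: spanD.
Qed.

End Fixed.

Lemma span_trans (T T' : finType) (y : T -> V -> R) (y' : T' -> V -> R) f :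
  (forall b, smooth_span y' (y b)) -> smooth_span y f -> smooth_span y' f.
Proof.
move=> yy' [C [sC EC]].
apply: (@span_eq_on _ _ (fun x => \sum_b C b x * y b x)); first by move=> x /EC.
by apply: span_sum => b; exact: spanM.
Qed.

Lemma span_partial (T T' : finType) (y : T -> V -> R) (y' : T' -> V -> R) f l :
  (forall b, smooth_on U (y b)) -> (forall b, smooth_span y' (y b)) ->
  (forall b, smooth_span y' (partial l (y b))) ->
  smooth_span y f -> smooth_span y' (partial l f).
Proof.
move=> sy yy' dyy' [C [sC EC]].
apply: (@span_eq_on _ _ (fun x =>
  \sum_b (partial l (C b) x * y b x + C b x * partial l (y b) x))).
  move=> x Ux.
  have E : {in U, f =1 fun x => \sum_b C b x * y b x}.
    by move=> z /set_mem /EC.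
  rewrite (partial_eq_on l oU E (mem_set Ux)) partial_sum => [|b].
    apply: eq_bigr => b _; rewrite partialM//.
      exact: smooth_differentiable (sC b) Ux.
    exact: smooth_differentiable (sy b) Ux.
  apply: differentiableM; first exact: smooth_differentiable (sC b) Ux.
  exact: smooth_differentiable (sy b) Ux.
apply: span_sum => b; apply: spanD; first exact/spanM/yy'/smooth_partial.
exact: spanM.
Qed.

Lemma closed_system_zero_near (T : finType) (y : T -> V -> R) x :
  (forall b, smooth_on U (y b)) -> (forall b l, smooth_span y (partial l (y b))) ->
  U x -> (forall b, y b x = 0) -> \forall z \near x, forall b, y b z = 0.
Proof.
move=> sy dy Ux y0.
have /choice[C HC] : forall bl : T * 'I_n.+1, exists C : T -> V -> R,
    (forall b, smooth_on U (C b)) /\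
    forall x, U x -> partial bl.2 (y bl.1) x = \sum_b C b x * y b x.
  by move=> [b l]; exact: dy.
have bdd f : smooth_on U f -> \forall z \near x, `|f z| <= `|f x| + 1.
  move=> sf; have /cvgrPdist_lt/(_ _ ltr01) : {for x, continuous f}.
    exact/differentiable_continuous/(smooth_differentiable sf).
  apply: filterS => z /ltW Hz; rewrite -(subKr (f x) (f z)).
  by rewrite (le_trans (ler_normB _ _))// lerD2l.
have nC : \forall z \near x, forall p : (T * 'I_n.+1) * T,
    `|C p.1 p.2 z| <= `|C p.1 p.2 x| + 1.
  suff H (p : (T * 'I_n.+1) * T) : \forall z \near x, `|C p.1 p.2 z| <= `|C p.1 p.2 x| + 1.
    exact: filter_forall H.
  by apply: bdd; exact: (HC p.1).1.
have ny : \forall z \near x, forall b, `|y b z| <= 1.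
  suff H b : \forall z \near x, `|y b z| <= 1 by exact: filter_forall H.
  by have := bdd _ (sy b); rewrite y0 normr0 add0r.
have nU : \forall z \near x, U z by exact: open_nbhs_nbhs.
have [r r0 Hr] := (nbhs_normrP _ _).1 (filterI nU (filterI nC ny)).
pose K := \sum_b \sum_l \sum_c (`|C (b, l) c x| + 1).
have Kge0 b : 0 <= \sum_l \sum_c (`|C (b, l) c x| + 1).
  by apply: sumr_ge0 => l _; apply: sumr_ge0 => c _; rewrite addr_ge0.
have K0 : 0 <= K by apply: sumr_ge0 => b _.
(* Small enough for the bounds on [C] and [y] to hold on the whole ball, and for [d * K] to be at
   most [1/2]. *)
pose d := Num.min (r / 2) (1 / (2 * (K + 1))).
have K1 : 0 < K + 1 by rewrite ltr_wpDl.
have d0 : 0 < d by rewrite lt_min !divr_gt0// mulr_gt0.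
have dr : d < r.
  by rewrite (@le_lt_trans _ _ (r / 2)) ?ge_min ?lexx// ltr_pdivrMr// ltr_pMr// ltr1n.
have dK : d * K <= 2^-1.
  apply: (@le_trans _ _ (1 / (2 * (K + 1)) * K)).
    by rewrite ler_wpM2r// ge_min lexx orbT.
  by rewrite mulrAC mul1r ler_pdivrMr ?mulr_gt0//; lra.
(* By the mean value theorem, any bound for y on the ball of radius d improves by 1/2. *)
have step k : forall v : V, `|v| <= d -> forall b, `|y b (x + v)| <= 1 / 2 ^+ k.
  elim: k => [|k IH] v vd b.
    rewrite expr0 divr1.
    have xv : `|x + v - x| < r by rewrite addrC addKr (le_lt_trans vd).
    by have [_ [_ H]] := Hr _ xv; exact: H.
  have inr (t : R) : 0 <= t <= 1 -> `|t *: v| <= d.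
    move=> /andP[t0 t1]; rewrite normrZ (ger0_norm t0) (le_trans _ vd)//.
    by rewrite ler_piMl.
  have inU (t : R) : 0 <= t <= 1 -> U (x + t *: v) /\ forall p : (T * 'I_n.+1) * T,
      `|C p.1 p.2 (x + t *: v)| <= `|C p.1 p.2 x| + 1.
    move=> /inr tv.
    have xv : `|x + t *: v - x| < r by rewrite addrC addKr (le_lt_trans tv).
    by have [? [? _]] := Hr _ xv; split.
  have df (t : R) : 0 <= t <= 1 -> differentiable (y b) (x + t *: v).
    by move=> /inU[Ut _]; exact: (smooth_differentiable (sy b)).
  have [t /andP[t0 t1] Et] := MVT_line df.
  have t01 : 0 <= t <= 1 by rewrite !ltW.
  have [Ut Ct] := inU t t01.
  rewrite y0 subr0 in Et; rewrite Et derive_partials; last exact: df.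
  apply: (@le_trans _ _ (d * K * (1 / 2 ^+ k))); last first.
    by rewrite exprS invfM !mul1r ler_wpM2r// invr_ge0 exprn_ge0.
  apply: le_trans (ler_norm_sum _ _ _) _.
  apply: (@le_trans _ _ (\sum_l d * (\sum_c (`|C (b, l) c x| + 1) * (1 / 2 ^+ k)))).
    apply: ler_sum => l _; rewrite normrM ler_pM//.
      by rewrite (le_trans _ vd)//; exact: (le_mx_norm v 0 l).
    rewrite (HC (b, l)).2// (le_trans (ler_norm_sum _ _ _))//.
    apply: ler_sum => c _; rewrite normrM ler_pM//.
      exact: (Ct ((b, l), c)).
    exact: IH (inr t t01) c.
  rewrite -mulr_sumr -[leRHS]mulrA (ler_wpM2l (ltW d0))//.
  under eq_bigr do rewrite -mulr_suml.
  rewrite -mulr_suml ler_wpM2r ?divr_ge0 ?exprn_ge0//.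
  by rewrite /K (bigD1 b)//= lerDl sumr_ge0.
apply/nbhs_normrP; exists d => // z /ltW zd b.
apply/eqP; rewrite -normr_le0; apply: (@le_geometric_error _ _ _ 1) => k.
by rewrite add0r -(subrK x z) addrC; exact: step.
Qed.

(** The common zero set is open in [U] by the local statement, closed in [U] by continuity, and
    contains [x]. *)
Lemma closed_system_zero (T : finType) (y : T -> V -> R) x :
  (forall b, smooth_on U (y b)) -> (forall b l, smooth_span y (partial l (y b))) ->
  connected U -> U x -> (forall b, y b x = 0) -> forall z, U z -> forall b, y b z = 0.
Proof.
move=> sy dy cU Ux y0.
pose Z := [set z | U z /\ forall b, y b z = 0].
have -> : U = Z; last by move=> z [].
apply/esym/cU; first by exists x.
- exists Z; last by rewrite (setIidr (_ : Z `<=` U))// => z [].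
  rewrite openE => z [Uz yz]; apply: filterI; first exact: open_nbhs_nbhs.
  exact: closed_system_zero_near.
- exists (closure Z); first exact: closed_closure.
  apply/seteqP; split=> [z Zz|z [Uz Zz]].
    by split; [exact: Zz.1|exact: subset_closure].
  split=> // b; apply/eqP/negP => /negP yb.
  have nz : \forall w \near z, y b w != 0.
    have c : {for z, continuous (y b)}.
      exact/differentiable_continuous/(smooth_differentiable (sy b)).
    exact: (cvgr_neq0 _ c yb).
  have [w [[Uw yw] /negP]] := Zz _ nz.
  by rewrite yw eqxx.
Qed.

End SmoothSpan.

Section Contractions.
Context {R : realFieldType} {n : nat}.
Variables (A B : 'M[R]_n.+1).
Hypotheses (tA : A^T = A) (tB : B^T = B) (AB : A *m B = 1%:M).

Let ABe i m : \sum_j A i j * B j m = (m == i)%:R.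
Proof. by have /matrixP/(_ i m) := AB; rewrite !mxE eq_sym. Qed.

Let tBe i j : B i j = B j i. Proof. by rewrite -{1}tB mxE. Qed.
Let tAe i j : A i j = A j i. Proof. by rewrite -{1}tA mxE. Qed.

Let trAB : \sum_j \sum_k B j k * A k j = n.+1%:R.
Proof.
have -> : n.+1%:R = \sum_(k < n.+1) 1 :> R by rewrite sumr_const card_ord.
rewrite exchange_big; apply: eq_bigr => k _ /=.
transitivity ((k == k)%:R : R); last by rewrite eqxx.
by rewrite -ABe; apply: eq_bigr => j _; rewrite mulrC.
Qed.

(** The second and third terms both contract to [p l i] and cancel, so what survives determines [p]
    by its trace. *)
Lemma contract_hessian (p : 'I_n.+1 -> 'I_n.+1 -> R) i l :
  \sum_j \sum_k B j k * (A k j * p l i + A i k * p l j - A l j * p k i - A i l * p k j) =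
  n.+1%:R * p l i - A i l * \sum_j \sum_k B j k * p k j.
Proof.
have e1 : \sum_j \sum_k B j k * A k j * p l i = n.+1%:R * p l i.
  by rewrite -trAB mulr_suml; apply: eq_bigr => j _; rewrite mulr_suml.
have e2 : \sum_j \sum_k B j k * A i k * p l j = p l i.
  rewrite -[RHS](sum_delta i (fun j => p l j)); apply: eq_bigr => j _.
  rewrite -ABe mulr_suml; apply: eq_bigr => k _.
  by rewrite (tBe j k); ring.
have e3 : \sum_j \sum_k B j k * A l j * p k i = p l i.
  rewrite -[RHS](sum_delta l (fun k => p k i)) exchange_big /=; apply: eq_bigr => k _.
  by rewrite -ABe mulr_suml; apply: eq_bigr => j _; ring.
transitivity (\sum_j \sum_k B j k * A k j * p l i + \sum_j \sum_k B j k * A i k * p l j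
    - \sum_j \sum_k B j k * A l j * p k i - A i l * \sum_j \sum_k B j k * p k j); last first.
  by rewrite e1 e2 e3 addrK.
rewrite mulr_sumr -!big_split /= -!sumrB; apply: eq_bigr => j _.
rewrite mulr_sumr -!big_split /= -!sumrB; apply: eq_bigr => k _.
ring.
Qed.

Lemma contract_gradient (v : 'I_n.+1 -> R) m :
  \sum_i \sum_l B i l * (A i l * v m - A i m * v l) = n%:R * v m.
Proof.
have e1 : \sum_i \sum_l B i l * A i l * v m = n.+1%:R * v m.
  rewrite -trAB mulr_suml; apply: eq_bigr => i _; rewrite mulr_suml.
  by apply: eq_bigr => l _; rewrite (tAe i l).
have e2 : \sum_i \sum_l B i l * A i m * v l = v m.
  rewrite -[RHS](sum_delta m v) exchange_big /=; apply: eq_bigr => l _.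
  rewrite -ABe mulr_suml; apply: eq_bigr => i _.
  by rewrite (tAe m i); ring.
transitivity (\sum_i \sum_l B i l * A i l * v m - \sum_i \sum_l B i l * A i m * v l);
    last by rewrite e1 e2 -natr1; ring.
rewrite -sumrB; apply: eq_bigr => i _; rewrite -sumrB.
by apply: eq_bigr => l _; ring.
Qed.

End Contractions.

(** * The closed first order system satisfied by a geodesically equivalent metric *)

Section Prolongation.
Context {R : realType} {n : nat}.
Local Notation V := 'rV[R]_n.+1.
Local Notation M := 'M[R]_n.+1.
Local Notation I := 'I_n.+1.
Variables (U : set V) (g h : V -> M) (phi : I -> V -> R) (c : R).
Hypotheses (oU : open U) (mg : metric_on U g) (mh : metric_on U h) (n0 : (0 < n)%N).
Hypothesis sphi : forall i, smooth_on U (phi i).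
Hypothesis Hphi : forall x, U x -> forall k i j,
  christoffel h k i j x = christoffel g k i j x +
    (k == i)%:R * phi j x + (k == j)%:R * phi i x.

Definition inverse_entry i j : V -> R := fun x => invmx (h x) i j.

Definition difference (p : I * I) : V -> R := fun x => h x p.1 p.2 - c * g x p.1 p.2.

Definition difference_form (t : (I * I) + I) : V -> R :=
  match t with inl p => difference p | inr i => phi i end.

(** The second order unknown: its normalisation makes [partial l (phi i)] equal to it times
    [h x i l] modulo the lower unknowns. *)
Definition hessian_trace : V -> R := fun x =>
  n.+1%:R^-1 * \sum_j \sum_k inverse_entry j k x * partial k (phi j) x.

Definition prolongation (t : option ((I * I) + I)) : V -> R :=
  if t is Some t' then difference_form t' else hessian_trace.

Local Notation L1 := (smooth_span U difference).
Local Notation L2 := (smooth_span U difference_form).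
Local Notation L3 := (smooth_span U prolongation).

Let sh i j : smooth_on U (fun x => h x i j).
Proof. by case: mh => s _ _; exact: s. Qed.

Let sg i j : smooth_on U (fun x => g x i j).
Proof. by case: mg => s _ _; exact: s. Qed.

Let sinv i j : smooth_on U (inverse_entry i j).
Proof. by case: mh => s _ u; exact: smooth_invmx. Qed.

Lemma smooth_difference p : smooth_on U (difference p).
Proof.
apply: smoothB => //.
by apply: smoothM => //; exact: smooth_cst.
Qed.

Lemma smooth_difference_form t : smooth_on U (difference_form t).
Proof. by case: t => [p|i] /=; [exact: smooth_difference|exact: sphi]. Qed.

Lemma smooth_hessian_trace : smooth_on U hessian_trace.
Proof.
apply: smoothM => //; first exact: smooth_cst.
apply: smooth_sum => // j _; apply: smooth_sum => // k _.
by apply: smoothM => //; exact: smooth_partial.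
Qed.

Lemma smooth_prolongation t : smooth_on U (prolongation t).
Proof. by case: t => [t|] /=; [exact: smooth_difference_form|exact: smooth_hessian_trace]. Qed.

Let L12 f : L1 f -> L2 f.
Proof. by apply: span_trans => // p; exact: (span_generator U difference_form (inl p)). Qed.

Let L23 f : L2 f -> L3 f.
Proof. by apply: span_trans => // t; exact: (span_generator U prolongation (Some t)). Qed.

Let L2phi i : L2 (phi i).
Proof. exact: (span_generator U difference_form (inr i)). Qed.

(** The covariant derivative of [h] for the connection of [g]. The other terms in the derivative of
    [h - c g] are Christoffel symbols of [g] times entries of [h - c g]. *)
Definition compat_defect k i j : V -> R := fun x =>
  2 * (h x i j * phi k x) + (h x k j * phi i x + h x i k * phi j x).

Lemma span_difference_partial k i j :
  L1 (fun x => partial k (difference (i, j)) x - compat_defect k i j x).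
Proof.
apply: (@span_eq_on _ _ _ _ _ (fun x =>
  \sum_a christoffel g a k i x * difference (a, j) x +
  \sum_a christoffel g a k j x * difference (i, a) x)); last first.
  apply: spanD => //; apply: span_sum => // a; apply: spanM => //;
    by [exact: smooth_christoffel|exact: span_generator].
move=> x Ux.
have dh := smooth_differentiable (sh i j) Ux.
have dg := smooth_differentiable (sg i j) Ux.
have -> : partial k (difference (i, j)) x =
    partial k (fun y => h y i j) x - c * partial k (fun y => g y i j) x.
  rewrite partialB//=; last by apply: differentiableM => //; exact: differentiable_cst.
  by rewrite partialZ.
have Eh := metric_entry_derivative i j k oU mh Ux.
have Eg := metric_entry_derivative i j k oU mg Ux.
rewrite mxpartialE in Eh; rewrite mxpartialE in Eg.
rewrite Eh Eg.
have e1 : \sum_a christoffel h a k i x * h x a j =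
    \sum_a christoffel g a k i x * h x a j + phi i x * h x k j + phi k x * h x i j.
  rewrite -[phi i x * _](sum_delta k (fun a => phi i x * h x a j)).
  rewrite -[phi k x * h x i j](sum_delta i (fun a => phi k x * h x a j)).
  rewrite -!big_split /=; apply: eq_bigr => a _.
  by rewrite Hphi//; ring.
have e2 : \sum_a christoffel h a k j x * h x i a =
    \sum_a christoffel g a k j x * h x i a + phi j x * h x i k + phi k x * h x i j.
  rewrite -[phi j x * _](sum_delta k (fun a => phi j x * h x i a)).
  rewrite -[phi k x * h x i j](sum_delta j (fun a => phi k x * h x i a)).
  rewrite -!big_split /=; apply: eq_bigr => a _.
  by rewrite Hphi//; ring.
rewrite e1 e2 /difference /compat_defect /=.
have e3 : \sum_a christoffel g a k i x * (h x a j - c * g x a j) =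
    \sum_a christoffel g a k i x * h x a j - c * \sum_a christoffel g a k i x * g x a j.
  by rewrite mulr_sumr -sumrB; apply: eq_bigr => a _; ring.
have e4 : \sum_a christoffel g a k j x * (h x i a - c * g x i a) =
    \sum_a christoffel g a k j x * h x i a - c * \sum_a christoffel g a k j x * g x i a.
  by rewrite mulr_sumr -sumrB; apply: eq_bigr => a _; ring.
rewrite e3 e4; ring.
Qed.

Lemma span_compat_defect k i j : L2 (compat_defect k i j).
Proof.
apply: spanD => //; first by apply: spanZ => //; exact: spanM.
by apply: spanD => //; exact: spanM.
Qed.

Lemma span_partial_difference l p : L2 (partial l (difference p)).
Proof.
case: p => i j; apply: (@span_eq_on _ _ _ _ _ (fun x =>
  (partial l (difference (i, j)) x - compat_defect l i j x) + compat_defect l i j x)).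
  by move=> x _; rewrite subrK.
by apply: spanD => //; [apply: L12; exact: span_difference_partial|exact: span_compat_defect].
Qed.

Lemma span_second_partial l k i j :
  L2 (fun x => partial l (partial k (difference (i, j))) x -
    (2 * (h x i j * partial l (phi k) x) +
      (h x k j * partial l (phi i) x + h x i k * partial l (phi j) x))).
Proof.
have H : L2 (partial l (fun x => partial k (difference (i, j)) x - compat_defect k i j x)).
  apply: (span_partial oU smooth_difference _ _ (span_difference_partial k i j)).
    by move=> p; exact: (span_generator U difference_form (inl p)).
  exact: span_partial_difference.
apply: (@span_eq_on _ _ _ _ _ (fun x =>
    partial l (fun x => partial k (difference (i, j)) x - compat_defect k i j x) x
    + (2 * (partial l (fun y => h y i j) x * phi k x) +
      (partial l (fun y => h y k j) x * phi i x + partial l (fun y => h y i k) x * phi j x)))).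
  move=> x Ux.
  have dphi a := smooth_differentiable (sphi a) Ux.
  have dh a b := smooth_differentiable (sh a b) Ux.
  have dM a b d : differentiable (fun x => h x a b * phi d x) x by exact: differentiableM.
  have d2M a b d : differentiable (fun x => 2 * (h x a b * phi d x)) x.
    by apply: differentiableM => //; exact: differentiable_cst.
  have dD : differentiable (fun x => h x k j * phi i x + h x i k * phi j x) x.
    exact: differentiableD.
  rewrite partialB; first last.
  - exact: differentiableD.
  - exact: smooth_differentiable (smooth_partial k (smooth_difference (i, j))) Ux.
  rewrite /compat_defect partialD// partialZ// partialD// !partialM//.
  by ring.
apply: spanD => //; apply: spanD => //.
  by apply: spanZ => //; apply: spanM => //; exact: smooth_partial.
by apply: spanD => //; apply: spanM => //; exact: smooth_partial.
Qed.

(* Symmetry of the second derivatives of h - c g, contracted with h^-1. *)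
Lemma span_hessian l i : L2 (fun x => partial l (phi i) x - hessian_trace x * h x i l).
Proof.
pose T j k x := h x k j * partial l (phi i) x + h x i k * partial l (phi j) x
  - h x l j * partial k (phi i) x - h x i l * partial k (phi j) x.
have LT j k : L2 (T j k).
  apply: (@span_eq_on _ _ _ _ _ (fun x => (partial k (partial l (difference (i, j))) x -
    (2 * (h x i j * partial k (phi l) x) +
      (h x l j * partial k (phi i) x + h x i l * partial k (phi j) x))) -
    (partial l (partial k (difference (i, j))) x -
    (2 * (h x i j * partial l (phi k) x) +
      (h x k j * partial l (phi i) x + h x i k * partial l (phi j) x))))).
    move=> x Ux; rewrite (partialC k l oU (smooth_difference (i, j)) Ux).
    (* Closedness of [phi] removes the terms carrying the factor [2], which exchange
       [partial l (phi k)] and [partial k (phi l)]. *)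
    have := dform0 oU mg mh sphi Hphi l k Ux; rewrite /dform => /eqP.
    rewrite subr_eq0 => /eqP ->; rewrite /T.
    by ring.
  by apply: spanB => //; exact: span_second_partial.
apply: (@span_eq_on _ _ _ _ _ (fun x =>
   n.+1%:R^-1 * \sum_j \sum_k inverse_entry j k x * T j k x)); last first.
  apply: spanZ => //; apply: span_sum => // j; apply: span_sum => // k.
  exact: spanM.
move=> x Ux; have [_ th uh] := mh.
have tB : (invmx (h x))^T = invmx (h x) by rewrite trmx_inv th.
have AB : h x *m invmx (h x) = 1%:M by rewrite mulmxV// uh.
rewrite (contract_hessian tB AB (fun a b => partial a (phi b) x)) /hessian_trace.
rewrite /inverse_entry; move: (\sum_j _) => S.
by rewrite mulrBr mulKf ?pnatr_eq0//; ring.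
Qed.

Lemma span_partial_form l i : L3 (partial l (phi i)).
Proof.
apply: (@span_eq_on _ _ _ _ _ (fun x =>
  (partial l (phi i) x - hessian_trace x * h x i l) + h x i l * hessian_trace x)).
  by move=> x _; ring.
apply: spanD => //; first by apply: L23; exact: span_hessian.
apply: spanM => //; exact: (span_generator U prolongation None).
Qed.

(* Symmetry of the second derivatives of phi, contracted with h^-1. *)
Lemma span_partial_hessian_trace m : L3 (partial m hessian_trace).
Proof.
have H a l i : L3 (fun x => partial a (partial l (phi i)) x - h x i l * partial a hessian_trace x).
  have H : L3 (partial a (fun x => partial l (phi i) x - hessian_trace x * h x i l)).
    apply: (span_partial oU smooth_difference_form _ _ (span_hessian l i)).
      by move=> t; exact: (span_generator U prolongation (Some t)).
    move=> [p|b] /=; last exact: span_partial_form.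
    by apply: L23; exact: span_partial_difference.
  apply: (@span_eq_on _ _ _ _ _ (fun x =>
    partial a (fun x => partial l (phi i) x - hessian_trace x * h x i l) x
    + partial a (fun x => h x i l) x * hessian_trace x)).
    move=> x Ux.
    have dm := smooth_differentiable smooth_hessian_trace Ux.
    have dh := smooth_differentiable (sh i l) Ux.
    have dp := smooth_differentiable (smooth_partial l (sphi i)) Ux.
    rewrite partialB//; last exact: differentiableM.
    by rewrite partialM//; ring.
  apply: spanD => //; apply: spanM; [by []|exact: smooth_partial|].
  exact: (span_generator U prolongation None).
have H2 l i : L3 (fun x => h x i l * partial m hessian_trace x - h x i m * partial l hessian_trace x).
  apply: (@span_eq_on _ _ _ _ _ (fun x =>
    (partial l (partial m (phi i)) x - h x i m * partial l hessian_trace x) -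
    (partial m (partial l (phi i)) x - h x i l * partial m hessian_trace x))).
    move=> x Ux; have E := partialC l m oU (sphi i) Ux.
    have A : forall a b d e : R, a = b -> a - d - (b - e) = e - d by move=> a b d e ->; ring.
    exact: (A _ _ _ _ E).
  by apply: spanB.
apply: (@span_eq_on _ _ _ _ _ (fun x => n%:R^-1 * \sum_i \sum_l inverse_entry i l x *
  (h x i l * partial m hessian_trace x - h x i m * partial l hessian_trace x))); last first.
  apply: spanZ => //; apply: span_sum => // i; apply: span_sum => // l.
  exact: spanM.
move=> x Ux; have [_ th uh] := mh.
have AB : h x *m invmx (h x) = 1%:M by rewrite mulmxV// uh.
rewrite (contract_gradient (th x Ux) AB (fun a => partial a hessian_trace x)).
by rewrite mulKf// pnatr_eq0 -lt0n.
Qed.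

Lemma span_partial_prolongation t l : L3 (partial l (prolongation t)).
Proof.
case: t => [[p|i]|] /=.
- by apply: L23; exact: span_partial_difference.
- exact: span_partial_form.
- exact: span_partial_hessian_trace.
Qed.

Lemma proportional_propagation x : connected U -> U x -> h x = c *: g x ->
  (\forall z \near x, forall i, phi i z = 0) -> forall z, U z -> h z = c *: g z.
Proof.
move=> cU Ux hx nphi z Uz.
have z0 : forall t, prolongation t x = 0.
  move=> [[p|i]|] /=.
  - by rewrite /difference hx mxE subrr.
  - exact: (nbhs_singleton nphi).
  (* [hessian_trace] contains derivatives of [phi], so [phi] has to vanish near [x] and not merely
     at [x]. *)
  - rewrite /hessian_trace big1 ?mulr0// => j _; rewrite big1// => k _.
    have E : {near x, phi j =1 fun=> 0} by apply: filterS nphi => w; exact.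
    by rewrite (near_partial k E) partial_cst mulr0.
have H := closed_system_zero oU smooth_prolongation span_partial_prolongation cU Ux z0 Uz.
apply/matrixP => i j; rewrite mxE; apply/eqP; rewrite -subr_eq0; apply/eqP.
exact: (H (Some (inl (i, j)))).
Qed.

End Prolongation.

(** * Rigidity, stability and the perturbation *)

Section Rigidity.
Context {R : realType}.
Local Notation V := 'rV[R]_4.
Local Notation M := 'M[R]_4.
Local Notation I := 'I_4.
Implicit Types (U : set V) (g h : V -> M) (x : V).

Lemma metric_on_subset (n : nat) (U U' : set 'rV[R]_n.+1) (g : 'rV[R]_n.+1 -> 'M[R]_n.+1) :
  U' `<=` U -> metric_on U g -> metric_on U' g.
Proof.
move=> UU [sg tg ug]; split=> [i j s x /UU Ux|x /UU Ux|x /UU Ux].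
- exact: (sg i j).
- exact: tg.
- exact: ug.
Qed.

Lemma smooth_continuous U f x : smooth_on U f -> U x -> {for x, continuous f}.
Proof. by move=> sf Ux; apply/differentiable_continuous/(smooth_differentiable sf). Qed.

Lemma smooth_curv U g l k a b : open U -> metric_on U g ->
  smooth_on U (fun x => curv g l k x a b).
Proof.
move=> oU mg; have sgam m := mxsmooth_gam m oU mg.
under eq_fun do rewrite curvE.
apply: smoothD => //; apply: smoothB => //; try exact: mxsmooth_partial.
  exact: mxsmoothM.
exact: mxsmoothM.
Qed.

Lemma generic_near U g x : open U -> metric_on U g -> U x ->
  weyl_det (fun l k => curv g l k x) != 0 ->
  \forall z \near x, weyl_det (fun l k => curv g l k z) != 0.
Proof.
move=> oU mg Ux dx.
have c : weyl_det (fun l k => curv g l k z) @[z --> x] --> weyl_det (fun l k => curv g l k x).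
  apply: (@closed_weyl_det _ _ (fun f : V -> R => f z @[z --> x] --> f x)
    (fun z l k => curv g l k z)).
    exact: (ring_closed_cvg x (nbhs_filter x)).
  by move=> l k a b; exact: smooth_continuous (smooth_curv l k a b oU mg) Ux.
exact: (cvgr_neq0 _ c dx).
Qed.

Lemma generic_rigid U g x : open U -> connected U -> U x -> metric_on U g ->
  weyl_det (fun l k => curv g l k x) != 0 -> geodesically_rigid U g.
Proof.
move=> oU cU Ux mg dx h mh gh.
pose phi := change_form g h.
have sphi i : smooth_on U (phi i) by exact: smooth_change_form.
have Hphi := projective_change oU mg mh gh.
(* Proportionality is available on this set only. In its interior it forces [phi = 0], which
   supplies the initial values at [x] for the propagation over [U]. *)
pose Z : set V := [set z | U z /\ weyl_det (fun l k => curv g l k z) != 0].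
have nZ : nbhs x Z.
  by apply: filterI; [exact: open_nbhs_nbhs|exact: generic_near Ux dx].
pose W := Z°%classic.
have WZ : W `<=` Z by exact: interior_subset.
have WU : W `<=` U by move=> z /WZ[].
have oW : open W by exact: open_interior.
have Wx : W x by [].
have /choice[c Hc] : forall z, exists c : R, W z -> c != 0 /\ h z = c *: g z.
  move=> z; have [Wz|nWz] := pselect (W z); last by exists 0.
  have [Uz dz] := WZ z Wz.
  by have [c c0 E] := generic_proportional oU mg mh sphi Hphi Uz dz; exists c.
have phi0 : forall z, W z -> forall i, phi i z = 0.
  apply: (conformal_projective oW (metric_on_subset WU mg) (metric_on_subset WU mh) _ Hc).
  by move=> z /WU; exact: Hphi.
exists (c x) => z Uz.
apply: (proportional_propagation oU mg mh _ sphi Hphi cU Ux _ _ Uz) => //.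
  by case: (Hc x Wx).
have : \forall z \near x, W z by exact: open_nbhs_nbhs.
by apply: filterS => w /phi0.
Qed.

Lemma cvg_invmx (T : Type) (F : set_system T) (A : T -> M) (t0 : T) : Filter F ->
  A t0 \in unitmx -> (forall i j, A t i j @[t --> F] --> A t0 i j) ->
  forall i j, invmx (A t) i j @[t --> F] --> invmx (A t0) i j.
Proof.
move=> FF u cA i j.
have cP := @ring_closed_cvg R T F t0 FF.
have cdet : \det (A t) @[t --> F] --> \det (A t0) by exact: (closed_det cP).
have d0 : \det (A t0) != 0 by rewrite -unitfE -unitmxE.
have cadj : (\adj (A t)) i j @[t --> F] --> (\adj (A t0)) i j.
  exact: (mxclosed_adj cP).
have -> : invmx (A t0) i j = (\det (A t0))^-1 * (\adj (A t0)) i j.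
  by rewrite /invmx u mxE.
(* [invmx] follows the cofactor formula only on invertible matrices, and [A t] is invertible
   eventually. *)
have nd : \forall t \near F, \det (A t) != 0 by exact: (cvgr_neq0 _ cdet d0).
have E : {near F, (fun t => (\det (A t))^-1 * (\adj (A t)) i j) =1 (fun t => invmx (A t) i j)}.
  apply: filterS nd => t dt; rewrite /invmx unitmxE unitfE dt.
  by move: (\adj _) => B; rewrite mxE.
apply: cvg_trans; first exact: (near_eq_cvg E).
by apply: cvgM => //; exact: cvgV.
Qed.

(** Neighbourhoods of the 2-jet of [g] at the single point [x], as a filter on matrix-valued
    functions. Closeness in the [C^2] sense becomes a statement about limits, to which
    [ring_closed_cvg] applies. *)
Definition jet_filter g x : set_system (V -> M) :=
  filter_from [set e : R | 0 < e] (fun e => [set h : V -> M | forall i j s, (size s <= 2)%N ->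
    `|iter_partial s (entry h i j) x - iter_partial s (entry g i j) x| < e]).

Lemma jet_filter_filter g x : Filter (jet_filter g x).
Proof.
apply: filter_from_filter; first by exists 1; exact: ltr01.
move=> a b a0 b0; exists (Num.min a b); first by rewrite /= lt_min a0.
by move=> h Hh; split=> i j s s2; have := Hh i j s s2; rewrite lt_min => /andP[].
Qed.

Opaque weyl_det jet_curv.

Lemma generic_stable U g x : open U -> metric_on U g -> U x ->
  weyl_det (fun l k => curv g l k x) != 0 ->
  exists2 e : R, 0 < e & forall h, metric_on U h -> C2_close U e h g ->
    weyl_det (fun l k => curv h l k x) != 0.
Proof.
move=> oU mg Ux dx; have FF := jet_filter_filter g x; have [sg tg ug] := mg.
have cP := @ring_closed_cvg R _ _ g FF.
have cj i j s : (size s <= 2)%N -> iter_partial s (entry h i j) x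
    @[h --> jet_filter g x] --> iter_partial s (entry g i j) x.
  move=> s2; apply/cvgrPdist_lt => e e0; exists e => //= h /(_ i j s s2).
  by rewrite distrC.
pose J h := weyl_det (jet_curv (invmx (h x)) (fun m => mxpartial m h x)
  (fun m p => mxpartial m (mxpartial p h) x)).
have cJ : J h @[h --> jet_filter g x] --> J g.
  apply: (closed_weyl_det cP) => l k; apply: (closed_jet_curv _ _ cP).
  - move=> a b; apply: (@cvg_invmx _ _ (fun h => h x) g FF); first exact: ug.
    by move=> i j; exact: (cj i j [::]).
  - move=> m a b; under eq_fun do rewrite mxpartialE; rewrite mxpartialE.
    exact: (cj a b [:: m]).
  - move=> m p a b.
    have E h : mxpartial m (mxpartial p h) x a b = iter_partial [:: m; p] (entry h a b) x.
      rewrite mxpartialE /=; congr (partial m _ x); apply/funext => y.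
      by rewrite mxpartialE.
    by under eq_fun do rewrite E; rewrite E; exact: (cj a b [:: m; p]).
have EJ h : metric_on U h -> J h = weyl_det (fun l k => curv h l k x).
  by move=> mh; apply: weyl_det_ext => l k; rewrite (curv_jet l k oU mh Ux).
have Jg : J g != 0 by rewrite EJ.
have [e e0 He] : \forall h \near jet_filter g x, J h != 0 by exact: (cvgr_neq0 _ cJ Jg).
exists e; first exact: e0.
move=> h mh Ch.
have Hn : J h != 0 := He h (fun i j s s2 => Ch i j s s2 x Ux).
have {}EJ := EJ h mh.
apply: contraNneq Hn => w0; apply/eqP; exact: (etrans EJ w0).
Qed.

End Rigidity.

(** * The quadratic perturbation and its estimates *)

Section Quadratic.
Context {R : realType} {n : nat}.
Local Notation V := 'rV[R]_n.+1.
Local Notation I := 'I_n.+1.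
Variables (x0 : V) (a : I -> I -> R).
Hypothesis aC : forall l k, a l k = a k l.

Definition affine_form (b : I -> R) : V -> R := fun x => \sum_k b k * (x 0 k - x0 0 k).

Definition quadratic_form (b : R) : V -> R := fun x =>
  b + 2^-1 * \sum_l (x 0 l - x0 0 l) * affine_form (a l) x.

Let dcoord x k : differentiable (fun y : V => y 0 k - x0 0 k) x.
Proof.
apply: differentiableB; first exact: differentiable_coord.
exact: differentiable_cst.
Qed.

Lemma smooth_affine_form U b : open U -> smooth_on U (affine_form b).
Proof.
move=> oU; apply: smooth_sum => // k _; apply: smoothM => //; first exact: smooth_cst.
by apply: smoothB => //; [exact: smooth_coord|exact: smooth_cst].
Qed.

Lemma smooth_quadratic_form U b : open U -> smooth_on U (quadratic_form b).
Proof.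
move=> oU; apply: smoothD => //; first exact: smooth_cst.
apply: smoothM => //; first exact: smooth_cst.
apply: smooth_sum => // l _; apply: smoothM => //; last exact: smooth_affine_form.
by apply: smoothB => //; [exact: smooth_coord|exact: smooth_cst].
Qed.

Lemma partial_affine_form b m x : partial m (affine_form b) x = b m.
Proof.
rewrite partial_sum => [|k]; last first.
  by apply: differentiableM => //; exact: differentiable_cst.
transitivity (\sum_k (k == m)%:R * b k); last exact: sum_delta.
apply: eq_bigr => k _; rewrite partialZ// partial_coord mulrC; congr (_%:R * _).
by rewrite eq_sym.
Qed.

Lemma partial_quadratic_form b m x : partial m (quadratic_form b) x = affine_form (a m) x.
Proof.
have daff c : differentiable (affine_form c) x.
  exact: (smooth_differentiable (smooth_affine_form c openT)).
have dM l : differentiable (fun y : V => (y 0 l - x0 0 l) * affine_form (a l) y) x.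
  exact: differentiableM.
have dS : differentiable (fun y : V => \sum_l (y 0 l - x0 0 l) * affine_form (a l) y) x.
  exact: differentiable_bigsum.
rewrite partialD; [|exact: differentiable_cst|by apply: differentiableM => //; exact: differentiable_cst].
rewrite partial_cst add0r partialZ// partial_sum//.
have -> : \sum_l partial m (fun y : V => (y 0 l - x0 0 l) * affine_form (a l) y) x =
    \sum_l ((l == m)%:R * affine_form (a l) x + (x 0 l - x0 0 l) * a l m).
  apply: eq_bigr => l _; rewrite partialM// partial_coord partial_affine_form.
  by rewrite eq_sym.
rewrite big_split /= sum_delta.
have -> : \sum_i (x 0 i - x0 0 i) * a i m = affine_form (a m) x.
  by apply: eq_bigr => i _; rewrite mulrC aC.
by field.
Qed.

Lemma affine_form_bound b (x : V) : (forall k, `|x 0 k - x0 0 k| <= 1) ->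
  `|affine_form b x| <= \sum_k `|b k|.
Proof.
move=> xb; apply: le_trans (ler_norm_sum _ _ _) _; apply: ler_sum => k _.
by rewrite normrM ler_piMr.
Qed.

(** At distance at most [1] from [x0], values and first derivatives obey the bound that the constant
    second derivatives satisfy, so one constant covers all three orders. *)
Lemma iter_partial_quadratic_form_bound b (x : V) s : (size s <= 2)%N ->
  (forall k, `|x 0 k - x0 0 k| <= 1) ->
  `|iter_partial s (quadratic_form b) x| <= `|b| + \sum_l \sum_k `|a l k|.
Proof.
move=> s2 xb.
have row l : \sum_k `|a l k| <= \sum_l \sum_k `|a l k|.
  by rewrite [leRHS](bigD1 l)//= lerDl sumr_ge0// => j _; exact: sumr_ge0.
have S0 : 0 <= \sum_l \sum_k `|a l k| by apply: sumr_ge0 => l _; exact: sumr_ge0.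
case: s s2 => [|m [|p [|//]]] _ /=.
- rewrite /quadratic_form (le_trans (ler_normD _ _))// lerD2l normrM gtr0_norm ?invr_gt0//.
  apply: (@le_trans _ _ `|\sum_l (x 0 l - x0 0 l) * affine_form (a l) x|).
    by rewrite ler_piMl// invf_le1// ler1n.
  apply: le_trans (ler_norm_sum _ _ _) _; apply: ler_sum => l _; rewrite normrM.
  by rewrite -[leRHS]mul1r ler_pM// affine_form_bound.
- rewrite partial_quadratic_form -[leLHS]add0r lerD//.
  exact: le_trans (affine_form_bound _ xb) (row m).
- have -> : partial p (quadratic_form b) = affine_form (a p).
    by apply/funext => y; exact: partial_quadratic_form.
  rewrite partial_affine_form -[leLHS]add0r lerD//.
  apply: le_trans (row p); rewrite (bigD1 m)//= lerDl.
  exact: sumr_ge0.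
Qed.

End Quadratic.

Lemma iter_partialD (R : realType) n (U : set 'rV[R]_n.+1) f p s x : open U ->
  smooth_on U f -> smooth_on U p -> U x ->
  iter_partial s (fun y => f y + p y) x = iter_partial s f x + iter_partial s p x.
Proof.
move=> oU sf sp; elim: s x => [//|m s IH] x Ux /=.
have E : {in U, iter_partial s (fun y => f y + p y) =1
    fun y => iter_partial s f y + iter_partial s p y}.
  by move=> y /set_mem; exact: IH.
rewrite (partial_eq_on m oU E (mem_set Ux)) partialD//; [exact: sf|exact: sp].
Qed.

Lemma jet_curv_congr (R : realType) n (A A' : 'M[R]_n.+1) dg dg' ddg ddg' l k :
  A = A' -> dg =1 dg' -> ddg =2 ddg' -> jet_curv A dg ddg l k = jet_curv A' dg' ddg' l k.
Proof.
move=> -> Ed Edd; have -> : dg = dg' by exact/funext.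
by have -> : ddg = ddg' by apply/funext => m; apply/funext => p; exact: Edd.
Qed.

Lemma addZmxE (R : pzRingType) m n (A B : 'M[R]_(m, n)) c i j :
  (A + c *: B) i j = A i j + c * B i j.
Proof. by rewrite !mxE. Qed.

Section Perturbation.
Context {R : realType}.
Local Notation V := 'rV[R]_4.
Local Notation M := 'M[R]_4.
Local Notation I := 'I_4.
Variables (x0 : V) (g : V -> M).

Definition perturbation (s t : R) : V -> M := fun x => \matrix_(i, j)
  quadratic_form x0 (fun l k => t * (perturbation_hessian l k i j)%:~R) (s *+ (i == j)) x.

Definition perturbed_metric s t : V -> M := fun x => g x + perturbation s t x.

(** Summing over the entries [i] and [j] as well gives one bound for all entries of the
    perturbation. *)
Definition hessian_bound : R := \sum_(i < 4) \sum_(j < 4) \sum_(l < 4) \sum_(k < 4)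
  `|(perturbation_hessian l k i j)%:~R|.

Let hC t i j l k : t * (perturbation_hessian l k i j)%:~R =
  t * (perturbation_hessian k l i j)%:~R :> R.
Proof. by rewrite perturbation_hessianC1. Qed.

Lemma entry_perturbation s t i j : entry (perturbation s t) i j =
  quadratic_form x0 (fun l k => t * (perturbation_hessian l k i j)%:~R) (s *+ (i == j)).
Proof. by apply/funext => x; rewrite /entry mxE. Qed.

Lemma entry_perturbed_metric s t i j : entry (perturbed_metric s t) i j =
  fun x => entry g i j x + entry (perturbation s t) i j x.
Proof. by apply/funext => x; rewrite /entry mxE. Qed.

Lemma perturbation_bound s t (d : R) (x : V) i j q : (size q <= 2)%N ->
  0 < s < d -> 0 < t < d -> (forall k, `|x 0 k - x0 0 k| <= 1) ->
  `|iter_partial q (entry (perturbation s t) i j) x| <= d * (1 + hessian_bound).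
Proof.
move=> q2 /andP[s0 sd] /andP[t0 td] xb; rewrite entry_perturbation.
have d0 : 0 <= d by rewrite ltW// (lt_trans s0).
apply: le_trans (iter_partial_quadratic_form_bound _ _ _ _) _ => //.
rewrite mulrDr mulr1 lerD//.
  by case: (i == j); rewrite ?mulr1n ?mulr0n ?normr0// gtr0_norm// ltW.
have -> : \sum_l \sum_k `|t * (perturbation_hessian l k i j)%:~R| =
    t * \sum_l \sum_k `|(perturbation_hessian l k i j)%:~R|.
  rewrite mulr_sumr; apply: eq_bigr => l _; rewrite mulr_sumr; apply: eq_bigr => k _.
  by rewrite normrM gtr0_norm.
have S0 i' j' : 0 <= \sum_(l < 4) \sum_(k < 4) `|(perturbation_hessian l k i' j')%:~R| :> R.
  by apply: sumr_ge0 => l _; exact: sumr_ge0.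
apply: ler_pM; [exact: ltW|exact: S0|exact: ltW|].
apply: (@le_trans _ _ (\sum_(j' < 4) \sum_(l < 4) \sum_(k < 4)
    `|(perturbation_hessian l k i j')%:~R|)).
  by rewrite [leRHS](bigD1 j)//= lerDl sumr_ge0.
by rewrite /hessian_bound [leRHS](bigD1 i)//= lerDl sumr_ge0// => i' _; exact: sumr_ge0.
Qed.

Lemma smooth_perturbation U s t i j : open U -> smooth_on U (entry (perturbation s t) i j).
Proof. by move=> oU; rewrite entry_perturbation; exact: smooth_quadratic_form. Qed.

Lemma iter_partial_perturbed U s t j q x : open U ->
  (forall i j, smooth_on U (entry g i j)) -> U x -> forall i,
  iter_partial q (entry (perturbed_metric s t) i j) x - iter_partial q (entry g i j) x =
  iter_partial q (entry (perturbation s t) i j) x.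
Proof.
move=> oU sg Ux i; rewrite entry_perturbed_metric.
have E := iter_partialD q oU (sg i j) (smooth_perturbation s t i j oU) Ux.
by apply/eqP; rewrite subr_eq addrC; apply/eqP.
Qed.

Lemma perturbed_metric_on U s t : open U -> metric_on U g ->
  (forall x, U x -> perturbed_metric s t x \in unitmx) -> metric_on U (perturbed_metric s t).
Proof.
move=> oU [sg tg _] ug; split=> // [i j|x Ux].
  by rewrite entry_perturbed_metric; apply: smoothD => //; exact: smooth_perturbation.
rewrite linearD /= tg//; congr (_ + _); apply/matrixP => i j; rewrite !mxE eq_sym.
rewrite /quadratic_form /affine_form; congr (_ + _ * _); apply: eq_bigr => l _.
by congr (_ * _); apply: eq_bigr => k _; rewrite perturbation_hessianC2.
Qed.

(** At its centre [x0] the quadratic term has vanishing value and gradient: the perturbation shifts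
    the metric by [s], keeps its first derivatives, and adds [t] times the Hessian to the second
    ones. *)
Lemma perturbed_curv U s t l k : open U -> metric_on U g -> U x0 ->
  metric_on U (perturbed_metric s t) ->
  curv (perturbed_metric s t) l k x0 = jet_curv (invmx (g x0 + s%:M))
    (fun m => mxpartial m g x0)
    (fun m p => mxpartial m (mxpartial p g) x0 + t *: hessian_matrix m p) l k.
Proof.
move=> oU mg Ux mp; rewrite (curv_jet l k oU mp Ux); have [sg _ _] := mg.
have aff0 b : affine_form x0 b x0 = 0.
  by rewrite /affine_form big1// => j _; rewrite subrr mulr0.
have E0 : perturbed_metric s t x0 = g x0 + s%:M.
  congr (_ + _); apply/matrixP => i j; rewrite !mxE /quadratic_form big1.
    by rewrite mulr0 addr0.
  by move=> m _; rewrite aff0 mulr0.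
have pE m i j y : U y -> partial m (entry (perturbed_metric s t) i j) y =
    partial m (entry g i j) y +
    affine_form x0 (fun k => t * (perturbation_hessian m k i j)%:~R) y.
  move=> Uy; rewrite entry_perturbed_metric partialD.
  - by rewrite entry_perturbation partial_quadratic_form.
  - exact: smooth_differentiable (sg i j) Uy.
  - exact: smooth_differentiable (smooth_perturbation s t i j oU) Uy.
have E1 m : mxpartial m (perturbed_metric s t) x0 = mxpartial m g x0.
  apply/matrixP => i j; rewrite [LHS]mxpartialE [RHS]mxpartialE.
  by apply: etrans (pE m i j x0 Ux) _; rewrite aff0 addr0.
have E2 m p : mxpartial m (mxpartial p (perturbed_metric s t)) x0 =
    mxpartial m (mxpartial p g) x0 + t *: hessian_matrix m p.
  apply/matrixP => i j; apply: etrans (mxpartialE _ _ _ _ _) _.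
  apply/esym; apply: etrans (addZmxE _ _ _ _ _) _.
  rewrite (mxpartialE m (mxpartial p g) x0 i j); apply/esym.
  have EE (g' : V -> M) : (fun y => mxpartial p g' y i j) = partial p (entry g' i j).
    by apply/funext => y; rewrite mxpartialE.
  rewrite !EE.
  have EU : {in U, partial p (entry (perturbed_metric s t) i j) =1 fun y =>
    partial p (entry g i j) y +
      affine_form x0 (fun k => t * (perturbation_hessian p k i j)%:~R) y}.
    by move=> y /set_mem Uy; exact: pE.
  rewrite (partial_eq_on m oU EU (mem_set Ux)) partialD.
  - by rewrite partial_affine_form [hessian_matrix _ _ _ _]mxE perturbation_hessianC1.
  - exact: smooth_differentiable (smooth_partial p (sg i j)) Ux.
  - exact: smooth_differentiable (smooth_affine_form _ _ oU) Ux.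
apply: jet_curv_congr; [by rewrite E0|exact: E1|exact: E2].
Qed.

End Perturbation.

(** The determinant of [g x + P] is continuous jointly in [(x, P)] and nonzero at [(x0, 0)], so a
    single radius bounds both the distance to [x0] and the perturbation. The bound [r <= 1] serves
    the estimates of the quadratic form. *)
Lemma uniformly_nondegenerate (R : realType) (x0 : 'rV[R]_4) (D : set 'rV[R]_4)
    (g : 'rV[R]_4 -> 'M[R]_4) : open D -> metric_on D g -> D x0 ->
  exists2 r : R, 0 < r & r <= 1 /\ forall x, `|x - x0| < r -> D x /\
    forall P : 'M[R]_4, (forall i j, `|P i j| < r) -> g x + P \in unitmx.
Proof.
move=> oD mg Dx0; have [sg _ ug] := mg.
pose z0 : 'rV[R]_4 * 'M[R]_4 := (x0, 0).
pose f (z : 'rV[R]_4 * 'M[R]_4) := \det (g z.1 + z.2).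
have cP := @ring_closed_cvg R _ _ z0 (nbhs_filter z0).
have cf : f z @[z --> z0] --> f z0.
  apply: (closed_det cP); apply: (mxclosedD cP) => i j.
    apply: (@cvg_comp _ _ _ fst (fun y => g y i j)); first exact: cvg_fst.
    exact: smooth_continuous (sg i j) Dx0.
  apply: (@cvg_comp _ _ _ snd (fun P : 'M[R]_4 => P i j)); first exact: cvg_snd.
  exact: coord_continuous.
have f0 : f z0 != 0 by rewrite /f addr0 -unitfE -unitmxE; exact: ug.
have nD : \forall z \near z0, D z.1.
  by apply: cvg_fst; exact: open_nbhs_nbhs.
have nf : \forall z \near z0, f z != 0 by exact: (cvgr_neq0 _ cf f0).
have [r r0 Hr] := (nbhs_normrP _ _).1 (filterI nD nf).
exists (Num.min r 1); first by rewrite lt_min r0 ltr01.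
split=> [|x]; first by rewrite ge_min lexx orbT.
rewrite lt_min => /andP[xr _].
have pn (P : 'M[R]_4) : `|P| < r -> `|(x, P) - z0| < r.
  move=> Pr; have -> : (x, P) - z0 = (x - x0, P) by congr pair; rewrite subr0.
  by rewrite [`|_|]prod_normE /= gt_max xr.
split.
  have P0 : `|0 : 'M[R]_4| < r by rewrite normr0.
  by have [] := Hr _ (pn 0 P0).
move=> P HP; rewrite unitmxE unitfE.
have Pr : `|P| < r.
  have : `|P| <= \big[Num.max/0]_(k : 'I_4 * 'I_4) `|P k.1 k.2|.
    by rewrite [leLHS]/Num.Def.normr/= mx_normrE.
  move=> /le_lt_trans; apply; apply: bigmax_lt => // k _.
  by have := HP k.1 k.2; rewrite lt_min => /andP[].
by have [] := Hr _ (pn P Pr).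
Qed.

Theorem mainTheorem1 (R : realType) (x0 : 'rV[R]_4) (D : set 'rV[R]_4)
    (g : 'rV[R]_4 -> 'M[R]_4) :
  open D -> D x0 -> metric_on D g ->
  exists W : set 'rV[R]_4,
    [/\ open W, W x0, W `<=` D
      & forall U : set 'rV[R]_4, open U -> connected U -> U x0 -> U `<=` W ->
        forall e : R, 0 < e ->
        exists ghat : 'rV[R]_4 -> 'M[R]_4,
          [/\ metric_on U ghat, C2_close U e ghat g, geodesically_rigid U ghat
            & exists2 e' : R, 0 < e' &
                forall h : 'rV[R]_4 -> 'M[R]_4,
                  metric_on U h -> C2_close U e' h ghat ->
                  geodesically_rigid U h]].
Proof.
move=> oD Dx0 mg.
have [r r0 [r1 Hr]] := uniformly_nondegenerate oD mg Dx0.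
(* This neighbourhood is fixed before [e]: a smaller [e] only shrinks the perturbation. *)
exists [set x | `|x - x0| < r]; split.
- have -> : [set x | `|x - x0| < r] = ball x0 r.
    by rewrite -ball_normE; apply/seteqP; split=> x /=; rewrite distrC.
  exact: ball_open.
- by rewrite /= subrr normr0.
- by move=> x /Hr[].
move=> U oU cU Ux0 UW e e0.
have mgU : metric_on U g by apply: metric_on_subset mg => x /UW /Hr[].
pose H := 1 + @hessian_bound R.
have H1 : 1 <= H.
  by rewrite lerDl /hessian_bound; do 4 (apply: sumr_ge0 => ? _).
have H0 : 0 < H by exact: lt_le_trans H1.
pose m := Num.min e r.
have m0 : 0 < m by rewrite lt_min e0.
(* [d * H] bounds the perturbation and its derivatives up to order two. Being below [e] it gives
   closeness, and being below [r] it keeps the perturbed metric nondegenerate on all of [U]. *)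
pose d := m / (2 * H).
have d0 : 0 < d by rewrite divr_gt0// mulr_gt0.
have dH : d * H < m.
  rewrite /d invfM mulrA divfK ?gt_eqF//.
  by rewrite ltr_pdivrMr// ltr_pMr// ltr1n.
have dHe : d * H < e by rewrite (lt_le_trans dH)// ge_min lexx.
have dHr : d * H < r by rewrite (lt_le_trans dH)// ge_min lexx orbT.
have dr : d < r by rewrite (le_lt_trans _ dHr)// ler_peMr// ltW.
have xb x : U x -> forall k, `|x 0 k - x0 0 k| <= 1.
  move=> Ux k; apply: le_trans r1; apply: le_trans (ltW (UW x Ux)).
  by have := le_mx_norm (x - x0) 0 k; rewrite !mxE.
have ug s : 0 < s < d -> g x0 + s%:M \in unitmx.
  move=> /andP[s0 sd]; have [|_] := Hr x0; first by rewrite subrr normr0.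
  apply=> i j; rewrite mxE; case: (i == j); rewrite ?mulr1n ?mulr0n ?normr0//.
  by rewrite gtr0_norm// (lt_trans sd).
have [s [t [sd td dst]]] := generic_jet (fun m => mxpartial m g x0)
  (fun m p => mxpartial m (mxpartial p g) x0) d0 ug.
pose ghat := perturbed_metric x0 g s t.
have mghat : metric_on U ghat.
  apply: perturbed_metric_on => // x Ux; have [_] := Hr x (UW x Ux).
  apply=> i j; apply: le_lt_trans dHr.
  exact: (perturbation_bound (q := [::]) i j _ sd td (xb x Ux)).
have gen : weyl_det (fun l k => curv ghat l k x0) != 0.
  rewrite (weyl_det_ext (fun l k => perturbed_curv l k oU mgU Ux0 mghat)).
  exact: dst.
exists ghat; split=> //.
- move=> i j q q2 x Ux; have [sg _ _] := mgU.
  have E := iter_partial_perturbed x0 s t j q oU sg Ux.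
  rewrite -/ghat in E; rewrite (E i).
  by apply: le_lt_trans dHe; exact: (perturbation_bound i j q2 sd td (xb x Ux)).
- exact: generic_rigid oU cU Ux0 mghat gen.
- have [e' e'0 He'] := generic_stable oU mghat Ux0 gen.
  exists e' => // h mh hC; apply: (generic_rigid oU cU Ux0 mh).
  exact: He'.
Qed.
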